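(* Let $(M,L)$ be a Finsler manifold admitting a concurrent $\pi$-vector field $\overline{\zeta}$, and let $(M,\widetilde{L})$ be the Finsler manifold obtained from it by the energy $\beta$-change $\widetilde{L}^{2}=L^{2}+B^{2}$, where $B:=g(\overline{\zeta},\overline{\eta})$. Put $p^{2}:=g(\overline{\zeta},\overline{\zeta})$. Then the curvature tensors of the associated Chern connections $D^{\diamond}$ and $\widetilde{D^{\diamond}}$ are related, for all vector fields $X,Y$ on $\mathcal{T}M$ and all $\overline{Z}\in\mathfrak{X}(\pi(M))$, by $$\widetilde{\mathbf{K}^{\diamond}}(X,Y)\overline{Z}=\mathbf{K}^{\diamond}(X,Y)\overline{Z}+\frac{g(\mathbf{T}(X,Y),\overline{Z})}{1+p^2}\,\overline{\zeta}+H^{\diamond}(X,Y)\overline{Z},$$ where $$H^{\diamond}(X,Y)\overline{Z}=\mathfrak{U}_{X,Y}\left\{\frac{g(\rho X,\overline{Z})}{1+p^2}\,\rho Y-\frac{g(\rho X,T(KY,\overline{Z}))}{1+p^2}\,\overline{\zeta}+\frac{g(\rho Y,\overline{Z})\,g(\rho X,\overline{\zeta})}{(1+p^2)^2}\,\overline{\zeta}\right\}.$$ In particular, for all $\overline{X},\overline{Y},\overline{Z}\in\mathfrak{X}(\pi(M))$: (a) $\widetilde{S^{\diamond}}(\overline{X},\overline{Y})\overline{Z}=S^{\diamond}(\overline{X},\overline{Y})\overline{Z}=0$; (b) $\widetilde{P^{\diamond}}(\overline{X},\overline{Y})\overline{Z}=P^{\diamond}(\overline{X},\overline{Y})\overline{Z}-2\,\dfrac{g(T(\overline{Y},\overline{X}),\overline{Z})}{1+p^2}\,\overline{\zeta}$;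 (c) $\widetilde{R^{\diamond}}(\overline{X},\overline{Y})\overline{Z}=R^{\diamond}(\overline{X},\overline{Y})\overline{Z}+\mathfrak{U}_{\overline{X},\overline{Y}}\left\{\dfrac{g(\overline{X},\overline{Z})}{1+p^2}\,\overline{Y}+\dfrac{g(\overline{Y},\overline{Z})\,g(\overline{X},\overline{\zeta})}{(1+p^2)^2}\,\overline{\zeta}\right\}$.
   Context: $M$ is a real paracompact smooth manifold of finite dimension $n$; all objects are $C^\infty$. $\pi:\mathcal{T}M\to M$ is the bundle of nonzero tangent vectors, $\pi^{-1}(TM)\to\mathcal{T}M$ the pullback of $TM$ by $\pi$. Sections of $\pi^{-1}(TM)$ are called $\pi$-vector fields, are written with bars, and form the module $\mathfrak{X}(\pi(M))$. The fundamental $\pi$-vector field is $\overline{\eta}(u)=(u,u)$. $\rho:T(\mathcal{T}M)\to\pi^{-1}(TM)$ is $\rho=(\pi_{\mathcal{T}M},d\pi)$, and $\gamma:\pi^{-1}(TM)\to T(\mathcal{T}M)$ is the vertical lift $\gamma(u,v)=j_u(v)$, with $j_u:T_{\pi(u)}M\to T_u(T_{\pi(u)}M)$ the natural isomorphism. $(M,L)$ is a Finsler manifold with Finsler metric $g$ on $\pi^{-1}(TM)$ (locally $g_{ij}=\frac12\partial^2L^2/\partial y^i\partial y^j$). For a linear connection $D$ on $\pi^{-1}(TM)$ its connection map is $K(X)=D_X\overline{\eta}$; $D$ is regular if $T_u(\mathcal{T}M)=V_u(\mathcal{T}M)\oplus\ker K_u$ for all $u$ ($V$ the vertical bundle), and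 then its horizontal map is $\beta:=(\rho|_{\ker K})^{-1}$. The torsion is $\mathbf{T}(X,Y)=D_X\rho Y-D_Y\rho X-\rho[X,Y]$, with $Q(\overline{X},\overline{Y})=\mathbf{T}(\beta\overline{X},\beta\overline{Y})$ and $(h)hv$-torsion $T(\overline{X},\overline{Y})=\mathbf{T}(\gamma\overline{X},\beta\overline{Y})$. The curvature is $\mathbf{K}(X,Y)\rho Z=-D_XD_Y\rho Z+D_YD_X\rho Z+D_{[X,Y]}\rho Z$, with $h$-, $hv$-, $v$-curvatures $R(\overline{X},\overline{Y})\overline{Z}=\mathbf{K}(\beta\overline{X},\beta\overline{Y})\overline{Z}$, $P(\overline{X},\overline{Y})\overline{Z}=\mathbf{K}(\beta\overline{X},\gamma\overline{Y})\overline{Z}$, $S(\overline{X},\overline{Y})\overline{Z}=\mathbf{K}(\gamma\overline{X},\gamma\overline{Y})\overline{Z}$. The Cartan connection $\nabla$ is the unique regular connection on $\pi^{-1}(TM)$ with $\nabla g=0$, $Q=0$ and $g(T(\overline{X},\overline{Y}),\overline{Z})=g(T(\overline{X},\overline{Z}),\overline{Y})$. A $\pi$-vector field $\overline{\zeta}$ is concurrent if $\nabla_{\beta\overline{X}}\overline{\zeta}=-\overline{X}$ and $\nabla_{\gamma\overline{X}}\overline{\zeta}=0$ for all $\overline{X}$. The Chern (Rund) connection of $(M,L)$ is $D^{\diamond}_X\overline{Y}=\nabla_X\overline{Y}-T(KX,\overline{Y})$; it has the same connection map and horizontal map as $\nabla$. Its curvature and $h$-, $hv$-, $v$-curvature tensors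 are $\mathbf{K}^{\diamond},R^{\diamond},P^{\diamond},S^{\diamond}$. The undecorated $\mathbf{T},T,K,\beta$ are those of the Cartan connection $\nabla$ of $L$. Tilded objects are those of $\widetilde{L}$ (defined with its own horizontal map). $\mathfrak{U}_{X,Y}\{A(X,Y)\}:=A(X,Y)-A(Y,X)$. *)

(* Defs.v *)
From HB Require Import structures.
From mathcomp Require Import all_boot all_order all_algebra.
From mathcomp Require Import all_classical all_reals all_analysis.

Set Implicit Arguments.
Unset Strict Implicit.
Unset Printing Implicit Defensive.

Import Order.TTheory GRing.Theory Num.Theory.
Import numFieldNormedType.Exports.

Local Open Scope classical_set_scope.
Local Open Scope ring_scope.

(* Smooth maps between normed spaces. *)
Section Smooth.
Context {R : realType} {V W : normedModType R}.

Fixpoint iter_derive (s : seq V) (f : V -> W) : V -> W :=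
  if s is v :: s' then (fun x => 'D_v (iter_derive s' f) x) else f.

(* C^infty on U (used for U open): f and all of its iterated directional
   derivatives are Frechet differentiable at every point of U. *)
Definition smooth_on (U : set V) (f : V -> W) : Prop :=
  forall (s : seq V) (x : V), U x -> differentiable (iter_derive s f) x.

End Smooth.

Definition paracompact (T : topologicalType) : Prop :=
  forall C : set (set T),
    (forall U, C U -> open U) -> \bigcup_(U in C) U = setT ->
    exists D : set (set T),
      [/\ forall U, D U -> open U,
          \bigcup_(U in D) U = setT,
          forall U, D U -> exists2 U', C U' & U `<=` U' &
          forall x : T, exists2 N, nbhs x N &
            finite_set [set U | D U /\ U `&` N !=set0]].

(* [chart_inv] is the inverse of [chart_map] on [chart_map @` chart_dom]; its
   values elsewhere are irrelevant. *)
Record chart (R : realType) (T : Type) (m : nat) := Chart {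
  chart_dom : set T;
  chart_map :> T -> 'rV[R]_m;
  chart_inv : 'rV[R]_m -> T }.

(* The differential at p of the change of coordinates from c to c': the
   components in c' of the tangent vector at p whose components in c are v. *)
Definition coord_change (R : realType) (T : Type) (m : nat)
    (c c' : chart R T m) (p : T) (v : 'rV[R]_m) : 'rV[R]_m :=
  'D_v (c' \o chart_inv c) (c p).

(* Paracompact Hausdorff smooth n-manifolds, given by a smooth atlas, together
   with a choice at each point x of a chart around x. Only the type of tangent
   vectors refers to this choice: a tangent vector at x is represented by its
   components in [chart_at x]. *)
Structure manifold (R : realType) (n : nat) := Manifold {
  carrier :> topologicalType;
  charts : set (chart R carrier n);
  chart_at : carrier -> chart R carrier n;
  chart_at_charts : forall x, charts (chart_at x);
  chart_at_dom : forall x, chart_dom (chart_at x) x;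
  chart_dom_open : forall c, charts c -> open (chart_dom c);
  chart_img_open : forall c, charts c -> open (c @` chart_dom c);
  chart_mapK : forall c, charts c ->
    forall x, chart_dom c x -> chart_inv c (c x) = x;
  chart_map_cont : forall c, charts c ->
    forall x, chart_dom c x -> {for x, continuous (chart_map c)};
  chart_inv_cont : forall c, charts c ->
    forall a, (c @` chart_dom c) a -> {for a, continuous (chart_inv c)};
  chart_compat : forall c c', charts c -> charts c' ->
    smooth_on (c @` (chart_dom c `&` chart_dom c')) (c' \o chart_inv c);
  manifold_hausdorff : hausdorff_space carrier;
  manifold_paracompact : paracompact carrier }.

Section TangentBundle.
Context {R : realType} {n : nat} (M : manifold R n).

(* The point (x, y) is the vector of T_x M with components y in [chart_at x]. *)
Definition TM : Type := (M * 'rV[R]_n)%type.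

(* The bundle of nonzero tangent vectors. Functions, pi-vector fields and
   vector fields on it are represented by functions on [TM], whose values
   outside [slit] are irrelevant. *)
Definition slit : set TM := [set u | u.2 != 0].

(* The chart (x^i, y^i) of TM induced by a chart (x^i) of M. *)
Definition tangent_chart (c : chart R M n) : chart R TM (n + n) :=
  Chart
    [set u | chart_dom c u.1]
    (fun u => row_mx (c u.1) (coord_change (chart_at u.1) c u.1 u.2))
    (fun a => let x := chart_inv c (lsubmx a) in
              (x, coord_change c (chart_at x) x (rsubmx a))).

(* Tangent vectors to TM at u are represented by their components in this
   chart. *)
Definition tchart_at (u : TM) : chart R TM (n + n) :=
  tangent_chart (chart_at u.1).

Definition smooth_on_slit (W : normedModType R) (F : TM -> W) : Prop :=
  forall c, charts c ->
    smooth_on (tangent_chart c @` (chart_dom (tangent_chart c) `&` slit))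
              (F \o chart_inv (tangent_chart c)).

(* Sections of the pullback bundle: sigma u is a vector of T_(u.1) M. *)
Definition pi_field : Type := TM -> 'rV[R]_n.

(* Vector fields on the slit tangent bundle: X u is a vector of T_u(TM). *)
Definition vfield : Type := TM -> 'rV[R]_(n + n).

(* Membership in X(pi(M)): the components in every chart of M are smooth. *)
Definition smooth_pi_field (sigma : pi_field) : Prop :=
  forall c, charts c ->
    smooth_on (tangent_chart c @` (chart_dom (tangent_chart c) `&` slit))
      ((fun u => coord_change (chart_at u.1) c u.1 (sigma u))
         \o chart_inv (tangent_chart c)).

Definition smooth_vfield (X : vfield) : Prop :=
  forall c, charts c ->
    smooth_on (tangent_chart c @` (chart_dom (tangent_chart c) `&` slit))
      ((fun u => coord_change (tchart_at u) (tangent_chart c) u (X u))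
         \o chart_inv (tangent_chart c)).

(* The derivative of F along the tangent vector w at u. *)
Definition derive_along (W : normedModType R) (F : TM -> W) (u : TM)
    (w : 'rV[R]_(n + n)) : W :=
  'D_w (F \o chart_inv (tchart_at u)) (tchart_at u u).

Definition lie (W : normedModType R) (X : vfield) (F : TM -> W) : TM -> W :=
  fun u => derive_along F u (X u).

(* [X, Y] has, in a chart, the components X(Y^i) - Y(X^i), where X^i = X(x^i)
   are the components of X. *)
Definition bracket (X Y : vfield) : vfield := fun u =>
  lie X (lie Y (tchart_at u)) u - lie Y (lie X (tchart_at u)) u.

(* The differential of the projection TM -> M at u. *)
Definition dpi (u : TM) (w : 'rV[R]_(n + n)) : 'rV[R]_n :=
  derive_along (chart_at u.1 \o fst) u w.

Definition rho (X : vfield) : pi_field := fun u => dpi u (X u).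

(* The vertical lift of v at u is the velocity at t = 0 of t |-> u + t v. *)
Definition gamma (sigma : pi_field) : vfield := fun u =>
  'D_1 (fun t : R => tchart_at u (u.1, u.2 + t *: sigma u)) 0.

Definition eta : pi_field := fun u => u.2.

Definition vertical (u : TM) : set 'rV[R]_(n + n) := [set w | dpi u w = 0].

Definition connection_op : Type := vfield -> pi_field -> pi_field.

(* Linear connections on the pullback bundle. *)
Record is_connection (D : connection_op) : Prop := IsConnection {
  conn_smooth : forall X sigma, smooth_vfield X -> smooth_pi_field sigma ->
    smooth_pi_field (D X sigma);
  conn_addl : forall X Y sigma, smooth_vfield X -> smooth_vfield Y ->
    smooth_pi_field sigma -> forall u, slit u ->
    D (fun u => X u + Y u) sigma u = D X sigma u + D Y sigma u;
  conn_scalel : forall (f : TM -> R) X sigma, smooth_on_slit f ->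
    smooth_vfield X -> smooth_pi_field sigma -> forall u, slit u ->
    D (fun u => f u *: X u) sigma u = f u *: D X sigma u;
  conn_addr : forall X sigma tau, smooth_vfield X -> smooth_pi_field sigma ->
    smooth_pi_field tau -> forall u, slit u ->
    D X (fun u => sigma u + tau u) u = D X sigma u + D X tau u;
  conn_leibniz : forall (f : TM -> R) X sigma, smooth_on_slit f ->
    smooth_vfield X -> smooth_pi_field sigma -> forall u, slit u ->
    D X (fun u => f u *: sigma u) u = lie X f u *: sigma u + f u *: D X sigma u }.

Definition conn_map (D : connection_op) (X : vfield) : pi_field := D X eta.

(* ker K_u; D_X eta at u depends only on the value of X at u. *)
Definition ker_conn_map (D : connection_op) (u : TM) : set 'rV[R]_(n + n) :=
  [set w | exists X, [/\ smooth_vfield X, X u = w & conn_map D X u = 0]].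

Definition regular (D : connection_op) : Prop :=
  forall u, slit u ->
    (forall w, exists v h, [/\ vertical u v, ker_conn_map D u h & w = v + h])
    /\ (forall w, vertical u w -> ker_conn_map D u w -> w = 0).

(* beta is the inverse of the restriction of rho to ker K. *)
Definition is_horizontal_map (D : connection_op) (beta : pi_field -> vfield)
    : Prop :=
  forall sigma, smooth_pi_field sigma ->
    smooth_vfield (beta sigma) /\
    forall u, slit u ->
      conn_map D (beta sigma) u = 0 /\ rho (beta sigma) u = sigma u.

Definition torsion (D : connection_op) (X Y : vfield) : pi_field := fun u =>
  D X (rho Y) u - D Y (rho X) u - rho (bracket X Y) u.

Definition curvature (D : connection_op) (X Y : vfield) (sigma : pi_field)
    : pi_field := fun u =>
  - D X (D Y sigma) u + D Y (D X sigma) u + D (bracket X Y) sigma u.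

Section WithHorizontalMap.
Variables (D : connection_op) (beta : pi_field -> vfield).
Implicit Types sigma tau upsilon : pi_field.

Definition h_torsion sigma tau : pi_field :=
  torsion D (beta sigma) (beta tau).

Definition hv_torsion sigma tau : pi_field :=
  torsion D (gamma sigma) (beta tau).

Definition h_curvature sigma tau upsilon : pi_field :=
  curvature D (beta sigma) (beta tau) upsilon.

Definition hv_curvature sigma tau upsilon : pi_field :=
  curvature D (beta sigma) (gamma tau) upsilon.

Definition v_curvature sigma tau upsilon : pi_field :=
  curvature D (gamma sigma) (gamma tau) upsilon.

End WithHorizontalMap.

(* g_u(v, w) = (1/2) v^i w^j d^2 L^2 / dy^i dy^j at u. *)
Definition finsler_metric (L : TM -> R) (u : TM) (v w : 'rV[R]_n) : R :=
  2^-1 * 'D_v (fun y => 'D_w (fun z => L (u.1, z) ^+ 2) y) u.2.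

Record is_finsler (L : TM -> R) : Prop := IsFinsler {
  finsler_smooth : smooth_on_slit L;
  finsler_cont : forall c, charts c -> forall u : TM, chart_dom c u.1 ->
    {for tangent_chart c u, continuous (L \o chart_inv (tangent_chart c))};
  finsler_gt0 : forall u, slit u -> 0 < L u;
  finsler_homog : forall (u : TM) (t : R), 0 < t ->
    L (u.1, t *: u.2) = t * L u;
  finsler_posdef : forall u, slit u -> forall v, v != 0 ->
    0 < finsler_metric L u v v }.

(* nabla is the Cartan connection of (M, L), with horizontal map beta. *)
Record is_cartan (L : TM -> R) (nabla : connection_op)
    (beta : pi_field -> vfield) : Prop := IsCartan {
  cartan_connection : is_connection nabla;
  cartan_regular : regular nabla;
  cartan_horizontal : is_horizontal_map nabla beta;
  cartan_metric : forall X sigma tau, smooth_vfield X ->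
    smooth_pi_field sigma -> smooth_pi_field tau -> forall u, slit u ->
    lie X (fun u => finsler_metric L u (sigma u) (tau u)) u =
    finsler_metric L u (nabla X sigma u) (tau u) +
    finsler_metric L u (sigma u) (nabla X tau u);
  cartan_h_torsion : forall sigma tau, smooth_pi_field sigma ->
    smooth_pi_field tau -> forall u, slit u ->
    h_torsion nabla beta sigma tau u = 0;
  cartan_hv_torsion : forall sigma tau upsilon, smooth_pi_field sigma ->
    smooth_pi_field tau -> smooth_pi_field upsilon -> forall u, slit u ->
    finsler_metric L u (hv_torsion nabla beta sigma tau u) (upsilon u) =
    finsler_metric L u (hv_torsion nabla beta sigma upsilon u) (tau u) }.

(* The Chern (Rund) connection, from the Cartan connection nabla. *)
Definition chern (nabla : connection_op) (beta : pi_field -> vfield)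
    : connection_op := fun X sigma u =>
  nabla X sigma u - hv_torsion nabla beta (conn_map nabla X) sigma u.

Record is_concurrent (nabla : connection_op) (beta : pi_field -> vfield)
    (zeta : pi_field) : Prop := IsConcurrent {
  concurrent_smooth : smooth_pi_field zeta;
  concurrent_horizontal : forall sigma, smooth_pi_field sigma ->
    forall u, slit u -> nabla (beta sigma) zeta u = - sigma u;
  concurrent_vertical : forall sigma, smooth_pi_field sigma ->
    forall u, slit u -> nabla (gamma sigma) zeta u = 0 }.

Definition energy_beta_change (L : TM -> R) (zeta : pi_field) : TM -> R :=
  fun u => Num.sqrt (L u ^+ 2 + finsler_metric L u (zeta u) (eta u) ^+ 2).

End TangentBundle.

Arguments eta {R n M} u.

Definition alternate (A : Type) (V : zmodType) (F : A -> A -> V) (a b : A) : V :=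
  F a b - F b a.

(* Main.v *)
Require Import Defs.
From HB Require Import structures.
From mathcomp Require Import all_boot all_order all_algebra.
From mathcomp Require Import all_classical all_reals all_analysis.
From mathcomp Require Import ring lra.

Set Implicit Arguments.
Unset Strict Implicit.
Unset Printing Implicit Defensive.

Import Order.TTheory GRing.Theory Num.Theory.
Import numFieldNormedType.Exports.

Local Open Scope classical_set_scope.
Local Open Scope ring_scope.

(** The statement hides a rigidity phenomenon: a Finsler manifold with a
   concurrent section [zeta] is Riemannian, that is, its (h)hv-torsion [T]
   vanishes. Once this is known, the Chern and Cartan connections of both
   metrics are torsion-free and metric, and the theorem becomes a computation
   of Levi-Civita type.

   Vanishing of [T]. Since [T] is half the derivative of the metric along the
   fibres ([hv_torsion_metric]), it suffices that the metric be constant on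
   fibres. Concurrence gives [K (beta X) (gamma Y) zeta = - T Y X] for the
   curvature [K]; as [K] is skew, [g (T Y X) zeta = 0]. The fibre derivative of
   the metric is a third derivative of the energy, hence totally symmetric, so
   that [g] does not change in the direction of [zeta], and [zeta] itself is
   locally constant on fibres. But [g] is homogeneous of degree 0: its value at
   [y] equals the one at [y + t zeta], hence at [y / t + zeta], hence at [zeta];
   so it is constant around each point where [zeta] is nonzero
   ([homogeneous_invariant_derive]). Finally [zeta] vanishes on no open set,
   because the horizontal lift of [eta] maps [g zeta eta] to [- L ^ 2], and the
   claim follows by continuity ([cartan_tensor0]).

   The changed metric. The function [B = g zeta eta] is now linear on fibres,
   so that the metric of the changed energy is [g + b (x) b] with
   [b = g zeta] ([energy_change_metric]); it is constant on fibres too, and the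
   (h)hv-torsion of its Cartan connection vanishes. The connection
   [nabla X sigma - g (rho X) sigma / (1 + p2) zeta] is torsion-free and metric
   for it, and Koszul's argument shows that there is only one such connection
   ([energy_change_cartan]). The relation between the curvatures follows by
   differentiating this formula, using [nabla X zeta = - rho X]
   ([energy_change_curvature]).

   The curvatures in (a), (b), (c). For a torsion-free connection the Bianchi
   identity and skewness kill the curvature with one vertical argument
   ([vertical_curvature]). This settles the v- and hv-curvatures, and it makes
   the h-curvature independent of the horizontal lifts that are used to
   define it ([eq_rho_curvature]).

   The objects on the tangent bundle are defined through charts; most of the
   work before the geometry consists in a calculus of smooth germs, in the
   change of charts, and in the construction of enough global sections. *)

(** * Germs of smooth maps *)

(** As a bounded bilinear map, scalar multiplication has a known differential,
   which yields the product rule. *)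
Lemma scaler_is_bilinear (R : realType) (W : normedModType R) :
  bilinear_for
    (GRing.Scale.Law.clone _ _ *:%R _) (GRing.Scale.Law.clone _ _ *:%R _)
    (@GRing.scale R W).
Proof.
split=> [u'|u] a x y /=; first by rewrite scalerDl scalerA.
by rewrite scalerDr !scalerA mulrC.
Qed.
HB.instance Definition _ (R : realType) (W : normedModType R) :=
  bilinear_isBilinear.Build R R W W _ _ (@GRing.scale R W)
    (scaler_is_bilinear W).

Section SmoothCalculus.
Context {R : realType}.
Implicit Types V W : normedModType R.

Lemma near_eq_differentiable V W (f g : V -> W) (x : V) :
  {near x, f =1 g} -> differentiable f x -> differentiable g x.
Proof.
move=> fg df.
have [dfc dfo] := (diff_locallyP x f).1 df.
have gx : g x = f x by rewrite (nbhs_singleton fg).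
have go : g \o shift x = cst (g x) + 'd f x +o_ 0 id.
  apply/eqaddoP => e e0.
  move/eqaddoP: dfo => /(_ e e0); rewrite gx => dfo.
  near=> y; rewrite (_ : (g \o shift x - _) y = (f \o shift x - (cst (f x) + 'd f x)) y).
    by near: y.
  rewrite !fctE /=; congr (_ - _); apply/esym.
  near: y; move: fg; rewrite (near_shift 0) /=.
  by apply: filterS => y; rewrite subr0.
have gd : 'd g x = 'd f x :> (V -> W) by apply: diff_unique.
by apply/diff_locallyP; rewrite gd.
Unshelve. all: by end_near. Qed.

Lemma open_eq_differentiable V W (U : set V) (f g : V -> W) x : open U -> U x ->
  (forall y, U y -> f y = g y) -> differentiable f x -> differentiable g x.
Proof.
move=> oU Ux fg; apply: near_eq_differentiable.
by apply: filterS (open_nbhs_nbhs (conj oU Ux)) => y; exact: fg.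
Qed.

Lemma open_eq_derive V W (U : set V) (f g : V -> W) x v : open U -> U x ->
  (forall y, U y -> f y = g y) -> 'D_v f x = 'D_v g x.
Proof.
move=> oU Ux fg; apply: near_eq_derive.
by apply: filterS (open_nbhs_nbhs (conj oU Ux)) => y; exact: fg.
Qed.

(** Induction over the order of differentiation is easier to run on this
   recursive form than on [smooth_on], which quantifies over lists. *)
Fixpoint diff_order V W (k : nat) (U : set V) (f : V -> W) : Prop :=
  (forall x, U x -> differentiable f x) /\
  if k is k'.+1 then forall v, diff_order k' U (fun x => 'D_v f x) else True.

Lemma iter_derive_rcons V W (s : seq V) (v : V) (f : V -> W) :
  iter_derive (rcons s v) f = iter_derive s (fun x => 'D_v f x).
Proof. by elim: s => //= w s ->. Qed.

Lemma smooth_onP V W (U : set V) (f : V -> W) :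
  smooth_on U f <-> forall k, diff_order k U f.
Proof.
split.
  move=> sf k; elim: k f sf => [|k IH] f sf; split => //.
  - by move=> x Ux; apply: (sf [::]).
  - by move=> x Ux; apply: (sf [::]).
  - by move=> v; apply: IH => s x Ux; rewrite -iter_derive_rcons; exact: sf.
move=> dk s; elim/last_ind: s f dk => [|s v IH] f dk x Ux.
  by have [+ _] := dk 0; exact.
rewrite iter_derive_rcons; apply: IH => // k.
by have [_ +] := dk k.+1; exact.
Qed.

Lemma diff_order_S V W k (U : set V) (f : V -> W) :
  diff_order k.+1 U f -> diff_order k U f.
Proof.
elim: k f => [|k IH] f [fd dd]; split => // v.
exact/IH/dd.
Qed.

Lemma diff_order_diff V W k (U : set V) (f : V -> W) :
  diff_order k U f -> forall x, U x -> differentiable f x.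
Proof. by case: k => [|k] []. Qed.

Lemma eq_diff_order V W k (U : set V) (f g : V -> W) : open U ->
  (forall x, U x -> f x = g x) -> diff_order k U f -> diff_order k U g.
Proof.
move=> oU; elim: k f g => [|k IH] f g fg [fd dd]; split => //.
- by move=> x Ux; apply: (open_eq_differentiable oU Ux fg); exact: fd.
- by move=> x Ux; apply: (open_eq_differentiable oU Ux fg); exact: fd.
- move=> v; apply: IH (dd v) => x Ux.
  exact: (open_eq_derive v oU Ux fg).
Qed.

Lemma diff_order_cst V W k (U : set V) (c : W) : diff_order k U (cst c : V -> W).
Proof.
elim: k c => [|k IH] c; split => // v.
rewrite (_ : (fun x => _) = cst 0); first exact: IH.
by apply/funext => x; rewrite derive_cst.
Qed.

Lemma diff_order_linear V W k (U : set V) (f : {linear V -> W}) :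
  continuous f -> diff_order k U f.
Proof.
move=> fc.
have fd x : differentiable f x by exact: linear_differentiable.
case: k => [|k]; split => //; do ?by move=> x _; exact: fd.
move=> v; rewrite (_ : (fun x => _) = cst (f v)); first exact: diff_order_cst.
by apply/funext => x; rewrite deriveE// diff_lin.
Qed.

Lemma diff_orderD V W k (U : set V) (f g : V -> W) : open U ->
  diff_order k U f -> diff_order k U g -> diff_order k U (fun x => f x + g x).
Proof.
move=> oU; elim: k f g => [|k IH] f g [fd df] [gd dg]; split => //;
  do ?by move=> x Ux; apply: differentiableD; [exact: fd|exact: gd].
move=> v; apply: (eq_diff_order oU _ (IH _ _ (df v) (dg v))) => x Ux /=.
by rewrite [RHS]deriveD//; apply: diff_derivable; [exact: fd|exact: gd].
Qed.

Lemma differentiable_scale V W (f : V -> R) (g : V -> W) x :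
  differentiable f x -> differentiable g x ->
  differentiable (fun y => f y *: g y) x /\
  forall v, 'D_v (fun y => f y *: g y) x = 'D_v f x *: g x + f x *: 'D_v g x.
Proof.
move=> df dg.
have dp : differentiable (fun y => (f y, g y)) x by exact: differentiable_pair.
pose B := @GRing.scale R W : {bilinear R -> W -> W}.
have cB : continuous (fun p : R * W => B p.1 p.2) by exact: scale_continuous.
have dB : differentiable (fun p : R * W => B p.1 p.2) (f x, g x).
  exact: differentiable_bilin.
have dc : differentiable ((fun p : R * W => B p.1 p.2) \o (fun y => (f y, g y))) x.
  exact: differentiable_comp.
split=> // v; rewrite [LHS](deriveE v dc) diff_comp//= diff_bilin//= diff_pair//=.
by rewrite -!deriveE// addrC.
Qed.

Lemma diff_orderZ V W k (U : set V) (f : V -> R) (g : V -> W) : open U ->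
  diff_order k U f -> diff_order k U g -> diff_order k U (fun x => f x *: g x).
Proof.
move=> oU; elim: k f g => [|k IH] f g sf sg.
  split=> // x Ux.
  by have [] := differentiable_scale (diff_order_diff sf Ux) (diff_order_diff sg Ux).
split=> [x Ux|v].
  by have [] := differentiable_scale (diff_order_diff sf Ux) (diff_order_diff sg Ux).
have [_ df] := sf; have [_ dg] := sg.
apply: (eq_diff_order oU _ (diff_orderD oU (IH _ _ (df v) (diff_order_S sg))
  (IH _ _ (diff_order_S sf) (dg v)))) => x Ux.
by have [_ ->] := differentiable_scale (diff_order_diff sf Ux) (diff_order_diff sg Ux).
Qed.

Lemma diff_order_sum V W k (U : set V) m (f : 'I_m -> V -> W) : open U ->
  (forall i, diff_order k U (f i)) ->
  diff_order k U (fun x => \sum_i f i x).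
Proof.
move=> oU; elim: m f => [|m IH] f sf.
  by apply: (eq_diff_order oU _ (@diff_order_cst V W k U 0)) => x _; rewrite big_ord0.
apply: (eq_diff_order oU _ (diff_orderD oU (sf ord0) (IH _ (fun i => sf (lift ord0 i))))).
by move=> x _; rewrite big_ord_recl.
Qed.

Lemma derive_lin V W (W' : normedModType R) (l : {linear W -> W'}) (f : V -> W)
    x v : continuous l -> differentiable f x ->
  'D_v (l \o f) x = l ('D_v f x).
Proof.
move=> lc df.
have dl : differentiable l (f x) by exact: linear_differentiable.
have dc : differentiable (l \o f) x by exact: differentiable_comp.
by rewrite (deriveE v dc) (deriveE v df) diff_comp//= diff_lin.
Qed.

Lemma diff_order_lin V W (W' : normedModType R) (l : {linear W -> W'})
    k (U : set V) (f : V -> W) : open U -> continuous l ->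
  diff_order k U f -> diff_order k U (l \o f).
Proof.
move=> oU lc; elim: k f => [|k IH] f sf.
  split=> // x Ux; apply: differentiable_comp; first exact: (diff_order_diff sf Ux).
  exact: linear_differentiable.
split=> [x Ux|v].
  apply: differentiable_comp; first exact: (diff_order_diff sf Ux).
  exact: linear_differentiable.
have [_ df] := sf.
apply: (eq_diff_order oU _ (IH _ (df v))) => x Ux /=.
by rewrite [RHS]derive_lin//; exact: (diff_order_diff sf Ux).
Qed.

Lemma derive_rV_sum m W (g : 'rV[R]_m -> W) y w : differentiable g y ->
  'D_w g y = \sum_j w 0 j *: 'D_(delta_mx 0 j) g y.
Proof.
move=> dg; rewrite deriveE// [in LHS](row_sum_delta w) linear_sum.
by apply: eq_bigr => j _; rewrite linearZ /= -deriveE.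
Qed.

Lemma derive_comp V W (V' : normedModType R) (f : V -> V') (g : V' -> W) x v :
  differentiable f x -> differentiable g (f x) ->
  'D_v (g \o f) x = 'D_('D_v f x) g (f x).
Proof.
move=> df dg; have dc : differentiable (g \o f) x by exact: differentiable_comp.
by rewrite (deriveE v dc) (deriveE v df) (deriveE _ dg) diff_comp.
Qed.

Lemma diff_order_coord V m k (U : set V) (f : V -> 'rV[R]_m) j : open U ->
  diff_order k U f -> diff_order k U (fun x => f x 0 j).
Proof.
move=> oU sf.
have lin : linear (fun w : 'rV[R]_m => w 0 j : R^o) by move=> a u w; rewrite !mxE.
pose lM := GRing.isLinear.Build _ _ _ _ _ lin.
pose L : {linear 'rV[R]_m -> R^o} := HB.pack (fun w : 'rV[R]_m => w 0 j : R^o) lM.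
by apply: (@diff_order_lin V 'rV[R]_m R L k U f) => //; exact: coord_continuous.
Qed.

Lemma diff_order_comp V m W k (U : set V) (U' : set 'rV[R]_m)
    (f : V -> 'rV[R]_m) (g : 'rV[R]_m -> W) : open U ->
  (forall x, U x -> U' (f x)) ->
  diff_order k U f -> diff_order k U' g -> diff_order k U (g \o f).
Proof.
move=> oU UU'; elim: k f g UU' => [|k IH] f g UU' sf sg.
  split=> // x Ux; apply: differentiable_comp; first exact: (diff_order_diff sf Ux).
  exact: (diff_order_diff sg (UU' _ Ux)).
split=> [x Ux|v].
  apply: differentiable_comp; first exact: (diff_order_diff sf Ux).
  exact: (diff_order_diff sg (UU' _ Ux)).
have [_ df] := sf; have [_ dg] := sg.
have S j := diff_orderZ oU (diff_order_coord j oU (df v))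
  (IH f _ UU' (diff_order_S sf) (dg (delta_mx 0 j))).
apply: (eq_diff_order oU _ (diff_order_sum oU S)) => x Ux.
rewrite [RHS]derive_comp ?derive_rV_sum//; do ?exact: (diff_order_diff sg (UU' _ Ux)).
exact: (diff_order_diff sf Ux).
Qed.

Lemma diff_orderV V k (U : set V) (f : V -> R) : open U ->
  (forall x, U x -> f x != 0) ->
  diff_order k U f -> diff_order k U (fun x => (f x)^-1).
Proof.
move=> oU f0; elim: k => [|k IH] sf.
  by split=> // x Ux; apply: differentiableV; [exact: (diff_order_diff sf Ux)|exact: f0].
split=> [x Ux|v].
  by apply: differentiableV; [exact: (diff_order_diff sf Ux)|exact: f0].
have [_ df] := sf; have sV := IH (diff_order_S sf).
apply: (eq_diff_order oU _ (diff_orderZ oU (diff_orderZ oU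
  (@diff_order_cst V R k U (-1)) (df v)) (diff_orderZ oU sV sV))) => x Ux /=.
have fx := diff_order_diff sf Ux.
rewrite [RHS]deriveV ?f0//; last exact: diff_derivable.
by rewrite /cst /GRing.scale /= expr2 invfM mulN1r !mulNr mulrC.
Qed.

Lemma near_open (T : topologicalType) (P : T -> Prop) x : (\forall y \near x, P y) ->
  exists2 U : set T, open U /\ U x & forall y, U y -> P y.
Proof.
rewrite /prop_near1 nbhsE => -[U [oU Ux] UP].
by exists U.
Qed.

(** Germs of smooth maps: this form is stable under all the constructions below
   without keeping track of the domain. *)
Definition smooth_near V W (f : V -> W) (x : V) : Prop :=
  exists2 U : set V, open U /\ U x & smooth_on U f.

Lemma smooth_near_nbhs V W (f : V -> W) x : smooth_near f x ->
  \forall y \near x, smooth_near f y.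
Proof.
move=> [U [oU Ux] sf]; apply: filterS (open_nbhs_nbhs (conj oU Ux)) => y Uy.
by exists U.
Qed.

Lemma smooth_near_diff V W (f : V -> W) x : smooth_near f x ->
  differentiable f x.
Proof. by move=> [U [_ Ux] /(_ [::] x Ux)]. Qed.

Lemma smooth_near_continuous V W (f : V -> W) x : smooth_near f x ->
  {for x, continuous f}.
Proof. by move=> /smooth_near_diff/differentiable_continuous. Qed.

Lemma smooth_near_derive V W (f : V -> W) x v : smooth_near f x ->
  smooth_near (fun y => 'D_v f y) x.
Proof.
move=> [U [oU Ux] sf]; exists U => // s y Uy.
by rewrite -iter_derive_rcons; exact: sf.
Qed.

Lemma eq_smooth_near V W (f g : V -> W) x : (\forall y \near x, f y = g y) ->
  smooth_near f x -> smooth_near g x.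
Proof.
move=> /near_open[U' [oU' Ux'] fg] [U [oU Ux] sf].
exists (U' `&` U); first by split; [exact: openI|].
have oI : open (U' `&` U) by exact: openI.
apply/smooth_onP => k.
apply: (@eq_diff_order _ _ k _ f) => // [y [U'y _]|]; first exact: fg.
by move: k; apply/smooth_onP => s y [_ Uy]; exact: sf.
Qed.

Lemma smooth_near_order1 V W (W' : normedModType R) (f : V -> W) (g : V -> W') x :
  (forall k (U : set V), open U -> diff_order k U f -> diff_order k U g) ->
  smooth_near f x -> smooth_near g x.
Proof.
move=> fg [U [oU Ux] sf]; exists U => //; apply/smooth_onP => k.
by apply: fg => //; move: k; apply/smooth_onP.
Qed.

Lemma smooth_near_order2 V W1 W2 W (f1 : V -> W1) (f2 : V -> W2) (g : V -> W) x :
  (forall k (U : set V), open U -> diff_order k U f1 -> diff_order k U f2 ->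
     diff_order k U g) ->
  smooth_near f1 x -> smooth_near f2 x -> smooth_near g x.
Proof.
move=> fg [U1 [oU1 U1x] s1] [U2 [oU2 U2x] s2].
exists (U1 `&` U2); first by split; [exact: openI|].
apply/smooth_onP => k; apply: fg; first exact: openI.
  by move: k; apply/smooth_onP => s y [Uy _]; exact: s1.
by move: k; apply/smooth_onP => s y [_ Uy]; exact: s2.
Qed.

Lemma smooth_near_cst V W (c : W) (x : V) : smooth_near (fun=> c) x.
Proof.
exists setT; first by split; [exact: openT|].
by apply/smooth_onP => k; exact: diff_order_cst.
Qed.

Lemma smooth_near_linear V W (l : {linear V -> W}) x : continuous l ->
  smooth_near l x.
Proof.
move=> lc; exists setT; first by split; [exact: openT|].
by apply/smooth_onP => k; exact: diff_order_linear.
Qed.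

Lemma smooth_near_id V (x : V) : smooth_near id x.
Proof. by apply: (@smooth_near_linear V V idfun) => y; exact: cvg_id. Qed.

Lemma smooth_nearD V W (f g : V -> W) x : smooth_near f x -> smooth_near g x ->
  smooth_near (fun y => f y + g y) x.
Proof. by apply: smooth_near_order2 => k U oU; exact: diff_orderD. Qed.

Lemma smooth_nearZ V W (f : V -> R) (g : V -> W) x : smooth_near f x ->
  smooth_near g x -> smooth_near (fun y => f y *: g y) x.
Proof. by apply: smooth_near_order2 => k U oU; exact: diff_orderZ. Qed.

Lemma smooth_nearM V (f g : V -> R) x : smooth_near f x ->
  smooth_near g x -> smooth_near (fun y => f y * g y) x.
Proof. exact: smooth_nearZ. Qed.

Lemma smooth_nearN V W (f : V -> W) x : smooth_near f x ->
  smooth_near (fun y => - f y) x.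
Proof.
move=> sf; apply: (eq_smooth_near _ (smooth_nearZ (@smooth_near_cst V R (-1) x) sf)).
by apply: nearW => y; rewrite scaleN1r.
Qed.

Lemma smooth_nearB V W (f g : V -> W) x : smooth_near f x -> smooth_near g x ->
  smooth_near (fun y => f y - g y) x.
Proof. by move=> sf sg; apply: smooth_nearD => //; exact: smooth_nearN. Qed.

Lemma smooth_near_sum V W m (f : 'I_m -> V -> W) x :
  (forall i, smooth_near (f i) x) -> smooth_near (fun y => \sum_i f i y) x.
Proof.
elim: m f => [|m IH] f sf.
  apply: (eq_smooth_near _ (@smooth_near_cst V W 0 x)).
  by apply: nearW => y; rewrite big_ord0.
apply: (eq_smooth_near _ (smooth_nearD (sf ord0) (IH _ (fun i => sf (lift ord0 i))))).
by apply: nearW => y; rewrite big_ord_recl.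
Qed.

Lemma smooth_near_lin V W (W' : normedModType R) (l : {linear W -> W'})
    (f : V -> W) x : continuous l ->
  smooth_near f x -> smooth_near (fun y => l (f y)) x.
Proof.
by move=> lc; apply: smooth_near_order1 => // k U oU; exact: diff_order_lin.
Qed.

Lemma smooth_near_rV V m (f : V -> 'rV[R]_m) x :
  (forall j, smooth_near (fun y => f y 0 j) x) -> smooth_near f x.
Proof.
move=> sf; apply: (eq_smooth_near _ (smooth_near_sum (fun j =>
  smooth_nearZ (sf j) (smooth_near_cst (delta_mx 0 j) x)))).
by apply: nearW => y; rewrite -row_sum_delta.
Qed.

Lemma smooth_near_coord V m (f : V -> 'rV[R]_m) j x :
  smooth_near f x -> smooth_near (fun y => f y 0 j) x.
Proof.
by apply: smooth_near_order1 => k U oU; exact: diff_order_coord.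
Qed.

Lemma smooth_nearV V (f : V -> R) x : f x != 0 ->
  smooth_near f x -> smooth_near (fun y => (f y)^-1) x.
Proof.
move=> f0 [U [oU Ux] sf].
have : \forall y \near x, f y != 0.
  have /differentiable_continuous fc : differentiable f x by exact: (sf [::]).
  by apply: (@cvgr_neq0 _ _ _ (nbhs x) _ f (f x)).
move=> /near_open[U' [oU' Ux'] f0'].
exists (U `&` U'); first by split; [exact: openI|].
apply/smooth_onP => k; apply: diff_orderV; first exact: openI.
  by move=> y [_ /f0'].
by move: k; apply/smooth_onP => s y [Uy _]; exact: sf.
Qed.

Lemma smooth_near_comp V m W (f : V -> 'rV[R]_m) (g : 'rV[R]_m -> W) x :
  smooth_near f x -> smooth_near g (f x) -> smooth_near (fun y => g (f y)) x.
Proof.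
move=> sf0 [U' [oU' Ux'] sg]; have [U [oU Ux] sf] := sf0.
have : \forall y \near x, U' (f y).
  by apply: (smooth_near_continuous sf0); exact: open_nbhs_nbhs.
move=> /near_open[U1 [oU1 U1x] fU1].
exists (U `&` U1); first by split; [exact: openI|].
apply/smooth_onP => k; apply: (@diff_order_comp _ _ _ _ _ U'); first exact: openI.
- by move=> y [_ /fU1].
- by move: k; apply/smooth_onP => s y [Uy _]; exact: sf.
- by move: k; apply/smooth_onP.
Qed.

Lemma smooth_near_row_mx V m1 m2 (f : V -> 'rV[R]_m1) (g : V -> 'rV[R]_m2) x :
  smooth_near f x -> smooth_near g x ->
  smooth_near (fun y => row_mx (f y) (g y)) x.
Proof.
move=> sf sg; apply: smooth_near_rV => j.
case: (split_ordP j) => i ->.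
  apply: (eq_smooth_near _ (smooth_near_coord i sf)).
  by apply: nearW => y; rewrite row_mxEl.
apply: (eq_smooth_near _ (smooth_near_coord i sg)).
by apply: nearW => y; rewrite row_mxEr.
Qed.

Lemma smooth_near_lsubmx V m1 m2 (f : V -> 'rV[R]_(m1 + m2)) x :
  smooth_near f x -> smooth_near (fun y => lsubmx (f y)) x.
Proof. by apply: smooth_near_lin; exact: continuous_lsubmx. Qed.

Lemma smooth_near_rsubmx V m1 m2 (f : V -> 'rV[R]_(m1 + m2)) x :
  smooth_near f x -> smooth_near (fun y => rsubmx (f y)) x.
Proof. by apply: smooth_near_lin; exact: continuous_rsubmx. Qed.

Lemma smooth_near_derive_dir m W (f : 'rV[R]_m -> W) (X : 'rV[R]_m -> 'rV[R]_m) x :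
  smooth_near f x -> smooth_near X x ->
  smooth_near (fun y => 'D_(X y) f y) x.
Proof.
move=> sf sX; apply: (eq_smooth_near _ (smooth_near_sum (fun j =>
  smooth_nearZ (smooth_near_coord j sX) (smooth_near_derive (delta_mx 0 j) sf)))).
apply: filterS (smooth_near_nbhs sf) => y sfy.
by rewrite [RHS]derive_rV_sum//; exact: smooth_near_diff.
Qed.

Lemma derive_line V W (f : V -> W) (p v : V) s :
  differentiable f (p + s *: v) ->
  is_derive s 1 (fun t : R => f (p + t *: v)) ('D_v f (p + s *: v)).
Proof.
move=> df.
pose l (t : R) := p + t *: v.
have dl : differentiable l s.
  by apply: differentiableD => //; exact: differentiableZl.
have dc : differentiable (f \o l) s by exact: differentiable_comp.
apply: DeriveDef; first exact: diff_derivable.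
rewrite [LHS](@derive_comp _ _ _ l f s 1 dl df); congr ('D__ f _).
rewrite /l deriveD; [|exact: derivable_cst|]; last first.
  by apply: diff_derivable; exact: differentiableZl.
rewrite derive_cst add0r deriveE; last exact: differentiableZl.
by rewrite diffZl//= diff_val scale1r.
Qed.

Lemma MVT_line V (f : V -> R) (p v : V) (h : R) : 0 < h ->
  (forall s, 0 <= s <= h -> differentiable f (p + s *: v)) ->
  exists2 s, 0 <= s <= h & f (p + h *: v) - f p = h * 'D_v f (p + s *: v).
Proof.
move=> h0 df.
have [||s] := @MVT R (fun t => f (p + t *: v)) (fun t => 'D_v f (p + t *: v)) 0 h h0.
- move=> s; rewrite in_itv /= => /andP[s0 sh]; apply: derive_line; apply: df.
  by rewrite !ltW.
- apply: derivable_within_continuous => s; rewrite in_itv /= => sh.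
  by case: (derive_line (df s sh)).
rewrite in_itv /= => /andP[s0 sh]; rewrite scale0r addr0 subr0 => ->.
by exists s; [rewrite !ltW|rewrite mulrC].
Qed.

(** Both mixed derivatives are values, at points tending to [x], of the second
   difference quotient of [f] on the parallelogram spanned by [v] and [w]. *)
Lemma derive_second_difference V (f : V -> R) (x v w : V) (r h : R) : 0 < h ->
  h * (`|v| + `|w|) < r ->
  (forall y, ball x r y -> differentiable f y) ->
  (forall y, ball x r y -> differentiable (fun z => 'D_v f z) y) ->
  exists2 y, ball x r y &
    f (x + h *: v + h *: w) - f (x + h *: v) - f (x + h *: w) + f x =
    h * (h * 'D_w (fun z => 'D_v f z) y).
Proof.
move=> h0 hr df ddf.
have inb s t : 0 <= s <= h -> 0 <= t <= h -> ball x r (x + s *: v + t *: w).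
  move=> /andP[s0 sh] /andP[t0 th]; rewrite -ball_normE /ball_ /=.
  rewrite -addrA opprD addNKr normrN; apply: le_lt_trans hr.
  rewrite (le_trans (ler_normD _ _))// !normrZ mulrDr !ger0_norm//.
  by rewrite lerD// ler_wpM2r.
have z0 : 0 <= (0 : R) <= h by rewrite lexx ltW.
have hh : 0 <= h <= h by rewrite lexx ltW.
have trl y : differentiable f (y + h *: w) -> differentiable (fun z => f (z + h *: w)) y.
  move=> d; apply: (@differentiable_comp _ _ _ _ (fun z => z + h *: w) f y) => //.
have trlD y : differentiable f (y + h *: w) ->
    'D_v (fun z => f (z + h *: w)) y = 'D_v f (y + h *: w).
  move=> d; rewrite [LHS](@derive_comp _ _ _ (fun z => z + h *: w) f)//.
  by rewrite deriveD// derive_cst derive_id addr0.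
pose g y := f (y + h *: w) - f y.
have dg s : 0 <= s <= h -> differentiable g (x + s *: v).
  move=> sh; apply: differentiableB; first exact/trl/df/inb.
  by apply: df; have := inb s 0 sh z0; rewrite scale0r addr0.
have [s sh gE] := MVT_line h0 dg.
have d1 : differentiable f (x + s *: v) by have := df _ (inb s 0 sh z0); rewrite scale0r addr0.
have d2 : differentiable f (x + s *: v + h *: w) by exact: df (inb s h sh hh).
have [t th tE] := @MVT_line _ (fun z => 'D_v f z) (x + s *: v) w h h0
  (fun t th => ddf _ (inb s t sh th)).
exists (x + s *: v + t *: w); first exact: inb.
rewrite -tE -(trlD _ d2) -deriveB; [|exact/diff_derivable/trl|exact: diff_derivable].
by rewrite -[X in h * X]/('D_v g (x + s *: v)) -gE /g opprB addrA addrAC.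
Qed.

Let mixed_derivatives_eq V (f A B : V -> R) x v w : smooth_near f x ->
  smooth_near A x -> smooth_near B x ->
  (forall y, A y = 'D_w (fun z => 'D_v f z) y) ->
  (forall y, B y = 'D_v (fun z => 'D_w f z) y) -> A x = B x.
Proof.
move=> sf sA sB AE BE.
have cA := smooth_near_continuous sA; have cB := smooth_near_continuous sB.
apply/eqP; apply: contrapT => /negP ne.
have e0 : 0 < `|A x - B x| / 2 by rewrite divr_gt0// normr_gt0 subr_eq0.
have : \forall y \near x, [/\ differentiable f y,
    differentiable (fun z => 'D_v f z) y, differentiable (fun z => 'D_w f z) y,
    `|A x - A y| < `|A x - B x| / 2 & `|B x - B y| < `|A x - B x| / 2].
  near=> y; split.
  - by near: y; apply: filterS (smooth_near_nbhs sf) => y; exact: smooth_near_diff.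
  - near: y; apply: filterS (smooth_near_nbhs (smooth_near_derive v sf)) => y.
    exact: smooth_near_diff.
  - near: y; apply: filterS (smooth_near_nbhs (smooth_near_derive w sf)) => y.
    exact: smooth_near_diff.
  - by near: y; move/cvgrPdist_lt: cA; exact.
  - by near: y; move/cvgrPdist_lt: cB; exact.
move=> /nbhs_ballP[r /= r0 H].
pose h := r / (`|v| + `|w| + 1) / 2.
have q0 : 0 < `|v| + `|w| + 1 by rewrite ltr_wpDl// addr_ge0.
have h0 : 0 < h by rewrite !divr_gt0.
have hr : h * (`|v| + `|w|) < r.
  have s0 : 0 <= `|v| + `|w| by rewrite addr_ge0.
  rewrite /h mulrAC ltr_pdivrMr// mulrAC ltr_pdivrMr// -mulrA ltr_pM2l//; lra.
have [||y1 b1 E1] := @derive_second_difference _ f x v w r h h0 hr.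
- by move=> y /H[].
- by move=> y /H[].
have [|||y2 b2 E2] := @derive_second_difference _ f x w v r h h0.
- by rewrite [_ + `|v|]addrC.
- by move=> y /H[].
- by move=> y /H[].
have AB : A y1 = B y2.
  apply: (mulfI (lt0r_neq0 h0)); apply: (mulfI (lt0r_neq0 h0)).
  rewrite -AE in E1; rewrite -BE in E2.
  by rewrite -E1 -E2 (addrAC x (h *: w)) (addrAC (f _) (- f (x + h *: w))).
have [_ _ _ A1 _] := H _ b1; have [_ _ _ _ B2] := H _ b2.
suff : `|A x - B x| < `|A x - B x| by rewrite ltxx.
rewrite {1}(_ : A x - B x = (A x - A y1) - (B x - B y2)); last by rewrite AB; ring.
by rewrite (le_lt_trans (ler_normB _ _))// [ltRHS]splitr ltrD.
Unshelve. all: by end_near. Qed.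

Lemma smooth_near_Schwarz V (f : V -> R) x v w : smooth_near f x ->
  'D_w (fun y => 'D_v f y) x = 'D_v (fun y => 'D_w f y) x.
Proof.
move=> sf; have sv := smooth_near_derive v sf; have sw := smooth_near_derive w sf.
have sA := smooth_near_derive w sv; have sB := smooth_near_derive v sw.
exact: (mixed_derivatives_eq sf sA sB (fun=> erefl) (fun=> erefl)).
Qed.

Lemma derive_coord V m (f : V -> 'rV[R]_m) x v j : differentiable f x ->
  'D_v (fun y => f y 0 j) x = ('D_v f x) 0 j.
Proof.
have lin : linear (fun w : 'rV[R]_m => w 0 j : R^o) by move=> a u w; rewrite !mxE.
pose lM := GRing.isLinear.Build _ _ _ _ _ lin.
pose L : {linear 'rV[R]_m -> R^o} := HB.pack (fun w : 'rV[R]_m => w 0 j : R^o) lM.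
by apply: (@derive_lin V 'rV[R]_m R L f x v) => //; exact: coord_continuous.
Qed.

Lemma smooth_near_Schwarz_rV V m (f : V -> 'rV[R]_m) x v w : smooth_near f x ->
  'D_w (fun y => 'D_v f y) x = 'D_v (fun y => 'D_w f y) x.
Proof.
move=> sf; apply/rowP => j.
have C v' w' : ('D_w' (fun y => 'D_v' f y) x) 0 j =
    'D_w' (fun y => 'D_v' (fun z => f z 0 j) y) x.
  rewrite -derive_coord; last exact: smooth_near_diff (smooth_near_derive v' sf).
  apply: near_eq_derive; apply: filterS (smooth_near_nbhs sf) => y sy.
  by rewrite derive_coord//; exact: smooth_near_diff.
have sj := smooth_near_coord j sf.
have S := smooth_near_Schwarz v w sj.
exact: etrans (C v w) (etrans S (esym (C w v))).
Qed.

Lemma derive_sum_fun V W m (f : 'I_m -> V -> W) x v :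
  (forall i, differentiable (f i) x) ->
  'D_v (fun y => \sum_i f i y) x = \sum_i 'D_v (f i) x.
Proof.
move=> df; rewrite -derive_sum; last by move=> i; exact: diff_derivable.
by congr ('D__ _ _); apply/funext => y; rewrite fct_sumE.
Qed.

(** Expanding the vector over the standard basis reduces this rule to the one
   for products with scalar functions. *)
Lemma derive_pairing V m W (l : V -> 'rV[R]_m -> W) (P : V -> 'rV[R]_m) a :
  (\forall b \near a, linear (l b)) -> (forall v, smooth_near (l^~ v) a) ->
  smooth_near P a ->
  smooth_near (fun b => l b (P b)) a /\
  forall v, 'D_v (fun b => l b (P b)) a = l a ('D_v P a) + 'D_v (l^~ (P a)) a.
Proof.
move=> ll sl sP.
have lE b (Pb : 'rV[R]_m) : linear (l b) ->
    l b Pb = \sum_j Pb 0 j *: l b (delta_mx 0 j).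
  move=> lb; pose lM := GRing.isLinear.Build _ _ _ _ _ lb.
  pose L : {linear 'rV[R]_m -> W} := HB.pack (l b) lM.
  rewrite -[LHS]/(L Pb) {1}(row_sum_delta Pb) linear_sum.
  by apply: eq_bigr => j _; rewrite linearZ.
have nE (Z : V -> 'rV[R]_m) : \forall b \near a,
    \sum_j Z b 0 j *: l b (delta_mx 0 j) = l b (Z b).
  by apply: filterS ll => b lb; rewrite [RHS]lE.
have sZ j (Z : V -> 'rV[R]_m) : smooth_near Z a ->
    smooth_near (fun b => Z b 0 j *: l b (delta_mx 0 j)) a.
  by move=> sZ; apply: smooth_nearZ (sl _); exact: smooth_near_coord.
have E (Z : V -> 'rV[R]_m) v : smooth_near Z a ->
    'D_v (fun b => l b (Z b)) a =
    \sum_j ('D_v Z a 0 j *: l a (delta_mx 0 j) +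
            Z a 0 j *: 'D_v (l^~ (delta_mx 0 j)) a).
  move=> sm; rewrite -(near_eq_derive v (nE Z)) derive_sum_fun; last first.
    by move=> j; apply: smooth_near_diff; exact: sZ.
  apply: eq_bigr => j _.
  have [_ ->] := differentiable_scale
    (smooth_near_diff (smooth_near_coord j sm)) (smooth_near_diff (sl (delta_mx 0 j))).
  by rewrite derive_coord//; exact: smooth_near_diff.
split; first by apply: (eq_smooth_near (nE P)); apply: smooth_near_sum => j; exact: sZ.
move=> v; rewrite E// (E (fun=> P a)); last exact: smooth_near_cst.
rewrite (lE a ('D_v P a)); last exact: (nbhs_singleton ll).
rewrite -big_split /=; apply: eq_bigr => j _.
by rewrite derive_cst mxE scale0r add0r.
Qed.

(** The product rule for the linear form [w |-> 'D_w G b]. *)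
Lemma derive_dir m W (G : 'rV[R]_m -> W) (Y : 'rV[R]_m -> 'rV[R]_m) a v :
  smooth_near G a -> smooth_near Y a ->
  'D_v (fun b => 'D_(Y b) G b) a =
  'D_('D_v Y a) G a + 'D_v (fun b => 'D_(Y a) G b) a.
Proof.
move=> sG sY.
have lG : \forall b \near a, linear (fun w => 'D_w G b).
  apply: filterS (smooth_near_nbhs sG) => b /smooth_near_diff dG k w w'.
  by rewrite !deriveE// linearP.
exact: (derive_pairing lG (fun w => smooth_near_derive w sG) sY).2.
Qed.

Lemma derive_along_increment V W (f : V -> W) a v d :
  (forall h : R, f (h *: v + a) - f a = h *: d) -> 'D_v f a = d.
Proof.
move=> fE; rewrite /derive; apply: cvg_lim => //.
apply: (@cvg_trans _ (nbhs d)); last by [].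
apply: cvg_trans (@cvg_cst _ d _ (0 : R)^' _).
apply: near_eq_cvg; near=> h.
rewrite /= /cst fE scalerA mulVf ?scale1r//.
by near: h; exact: nbhs_dnbhs_neq.
Unshelve. all: by end_near. Qed.

Lemma eq_derive_increment V (V' : normedModType R) W (f : V -> W) (g : V' -> W)
    a v b w :
  (forall h : R, f (h *: v + a) - f a = g (h *: w + b) - g b) ->
  'D_v f a = 'D_w g b.
Proof.
move=> fg; rewrite /derive.
have -> : (fun h => h^-1 *: ((f \o shift a) (h *: v) - f a)) =
    (fun h => h^-1 *: ((g \o shift b) (h *: w) - g b)).
  by apply/funext => h; rewrite /= fg.
by [].
Qed.

Lemma deriveMcst V (f : V -> R) (k : R) x v : differentiable f x ->
  'D_v (fun y => k * f y) x = k * 'D_v f x.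
Proof.
move=> df; have [_ H] := differentiable_scale (differentiable_cst k x) df.
have := H v; rewrite derive_cst scale0r add0r; exact.
Qed.

Lemma derive_homog V (f : V -> R) y v (t s : R) : differentiable f y ->
  differentiable f (t *: y) -> (\forall z \near y, f (t *: z) = s * f z) ->
  t * 'D_v f (t *: y) = s * 'D_v f y.
Proof.
move=> df dft fE.
have dl : differentiable ( *:%R t) y by exact: ex_diff.
have e1 := derive_comp v dl dft.
have e2 := near_eq_derive v fE.
have e3 : 'D_v ( *:%R t) y = t *: v by rewrite deriveE// diff_val.
rewrite e3 (deriveE _ dft) linearZ /= -(deriveE v dft) in e1.
exact: etrans (esym e1) (etrans e2 (deriveMcst s v df)).
Qed.

Lemma eq_derive V W (f g : V -> W) x v : f =1 g -> 'D_v f x = 'D_v g x.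
Proof. by move=> /funext ->. Qed.

End SmoothCalculus.

(** * Bump functions *)

Section Bump.
Context {R : realType}.
Implicit Types V : normedModType R.

(** The family is closed under differentiation up to linear combinations, which
   is what makes its members smooth: each is differentiable, and so then are
   all their derivatives. *)
Definition flat_exp (k : nat) (t : R) : R :=
  if 0 < t then t^-1 ^+ k * expR (- t^-1) else 0.

Lemma flat_exp_bound k s : 0 < s -> flat_exp k s <= (k.+1)`!%:R * s.
Proof.
move=> s0; rewrite /flat_exp s0 expRN ler_pdivrMr ?expR_gt0//.
have := @expR_ge1Dxn R s^-1 k; rewrite invr_ge0 ltW// => /(_ isT) Hk.
have f0 : (0 : R) < (k.+1)`!%:R by rewrite ltr0n fact_gt0.
have : s^-1 ^+ k.+1 / (k.+1)`!%:R <= expR s^-1 by apply: le_trans Hk; rewrite lerDr.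
rewrite ler_pdivrMr// exprS => /(ler_wpM2l (ltW s0)).
rewrite mulrA divff ?gt_eqF// mul1r => /le_trans; apply.
by rewrite le_eqVlt; apply/orP; left; apply/eqP; ring.
Qed.

Lemma flat_exp_derive (k : nat) (t : R) :
  is_derive t 1 (flat_exp k) (- k%:R * flat_exp k.+1 t + flat_exp k.+2 t).
Proof.
have [t0|t0|t0] := ltgtP 0 t.
- apply: (@near_eq_is_derive R R R (fun t => t^-1 ^+ k * expR (- t^-1))).
    near=> s; rewrite /flat_exp ifT//.
    by near: s; exact: lt_nbhsr.
  have di : is_derive t 1 (fun t : R => t^-1) (- t ^- 2).
    have /is_deriveV := @is_derive_id R R t 1.
    by rewrite gt_eqF// => /(_ isT); rewrite /GRing.scale /= mulr1.
  have de : is_derive t 1 (fun t : R => expR (- t^-1)) (expR (- t^-1) * t ^- 2).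
    have dN : is_derive t 1 (fun t : R => - t^-1) (t ^- 2).
      by rewrite -[t ^- 2]opprK; exact: is_deriveN.
    exact: (@is_derive1_comp R expR (fun t => - t^-1)).
  have dX : is_derive t 1 (fun t : R => t^-1 ^+ k) (- k%:R * t^-1 ^+ k.+1).
    rewrite (_ : (fun t => _) = (fun t : R => t^-1) ^+ k); last first.
      by apply/funext => s; rewrite exprfctE.
    apply: (is_derive_eq (@is_deriveX R R (fun t => t^-1) k t 1 _ di)).
    rewrite /GRing.scale /=; case: k => [|k] /=; first by rewrite oppr0 !mul0r.
    by rewrite -exprVn !exprS expr0; ring.
  apply: (is_derive_eq (@is_deriveM R R _ _ t 1 _ _ dX de)).
  rewrite /flat_exp t0 /GRing.scale /= -exprVn.
  by rewrite !exprS expr0; ring.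
- apply: (@near_eq_is_derive R R R (fun=> 0)).
    near=> s; rewrite /flat_exp ifF//.
    by apply/negP/negP; rewrite -leNgt ltW//; near: s; exact: lt_nbhsl.
  have f0 j : flat_exp j t = 0 by rewrite /flat_exp ltNge ltW.
  by rewrite !f0 mulr0 addr0; exact: is_derive_cst.
- have f0 j : flat_exp j 0 = 0 by rewrite /flat_exp ltxx.
  rewrite -t0 !f0 mulr0 addr0.
  have cv : h^-1 *: (flat_exp k (h *: 1 + 0) - flat_exp k 0) @[h --> 0^'] --> (0 : R).
    apply/cvgrPdist_le => e e0; near=> s.
    rewrite sub0r normrN f0 subr0 addr0 /GRing.scale /= mulr1.
    have [s0|s0] := ltP 0 s; last first.
      by rewrite /flat_exp ltNge s0 /= mulr0 normr0 ltW.
    rewrite (_ : s^-1 * _ = flat_exp k.+1 s); last first.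
      by rewrite /flat_exp s0 mulrA exprS.
    rewrite ger0_norm; last first.
      by rewrite /flat_exp s0 mulr_ge0 ?exprn_ge0 ?invr_ge0 ?expR_ge0// ltW.
    apply: le_trans (flat_exp_bound _ s0) _.
    have F0 : (0 : R) < (k.+2)`!%:R by rewrite ltr0n fact_gt0.
    rewrite mulrC -ler_pdivlMr//.
    suff : `|s| <= e / (k.+2)`!%:R by rewrite ger0_norm// ltW.
    by near: s; apply: dnbhs0_le; rewrite divr_gt0.
  by apply: DeriveDef; [apply/cvg_ex; exists 0|exact: cvg_lim].
Unshelve. all: by end_near. Qed.

Lemma diff_order_flat_exp V j k (U : set V) (f : V -> R) : open U ->
  diff_order j U f -> diff_order j U (fun x => flat_exp k (f x)).
Proof.
move=> oU.
have D i x v : differentiable f x -> differentiable (fun x => flat_exp i (f x)) x /\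
    'D_v (fun x => flat_exp i (f x)) x =
    (- i%:R * flat_exp i.+1 (f x) + flat_exp i.+2 (f x)) * 'D_v f x.
  move=> df; have [d1 d2] := flat_exp_derive i (f x).
  have dg : differentiable (flat_exp i) (f x) by exact/derivable1_diffP.
  split; first exact: (@differentiable_comp _ _ _ _ f (flat_exp i)).
  rewrite [LHS](@derive_comp _ _ _ _ f (flat_exp i))// (deriveE _ dg).
  have -> : 'd (flat_exp i) (f x) ('D_v f x) = 'D_v f x *: 'd (flat_exp i) (f x) 1.
    by rewrite -linearZ; congr ('d _ _ _); rewrite /GRing.scale /= mulr1.
  by rewrite -deriveE// d2 [RHS]mulrC.
elim: j k => [|j IH] k sf.
  split=> // x Ux; exact: (D k x 0 (diff_order_diff sf Ux)).1.
split=> [x Ux|v]; first exact: (D k x 0 (diff_order_diff sf Ux)).1.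
have [_ df] := sf; have sf' := diff_order_S sf.
apply: (eq_diff_order oU _ (diff_orderZ oU (diff_orderD oU (diff_orderZ oU
  (@diff_order_cst R V R j U (- k%:R)) (IH k.+1 sf')) (IH k.+2 sf')) (df v))).
by move=> x Ux; rewrite [RHS](D _ _ _ (diff_order_diff sf Ux)).2.
Qed.

Lemma smooth_near_flat_exp V k (f : V -> R) x : smooth_near f x ->
  smooth_near (fun y => flat_exp k (f y)) x.
Proof.
by apply: smooth_near_order1 => j U oU; exact: diff_order_flat_exp.
Qed.

Definition sqr_dist m (a y : 'rV[R]_m) : R := \sum_j (y 0 j - a 0 j) ^+ 2.

Lemma smooth_near_sqr_dist m (a x : 'rV[R]_m) : smooth_near (sqr_dist a) x.
Proof.
apply: smooth_near_sum => j; rewrite (_ : (fun y => _) =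
  (fun y : 'rV[R]_m => (y 0 j - a 0 j) * (y 0 j - a 0 j))); last first.
  by apply/funext => y; rewrite expr2.
have sj : smooth_near (fun y : 'rV[R]_m => y 0 j - a 0 j) x.
  by apply: smooth_nearB (smooth_near_cst _ _); exact/smooth_near_coord/smooth_near_id.
exact: smooth_nearM.
Qed.

Lemma sqr_dist_ball m (a y : 'rV[R]_m) (r : R) : 0 < r ->
  sqr_dist a y < r ^+ 2 -> `|y - a| < r.
Proof.
move=> r0 yr; rewrite [ltLHS]/Num.Def.normr /= mx_normrE.
apply/bigmax_ltP; split=> //= -[i j] _ /=; rewrite ord1 !mxE.
rewrite -ltr_sqr ?nnegrE// ?(ltW r0)// real_normK ?num_real//.
apply: le_lt_trans yr; rewrite /sqr_dist (bigD1 j)//= lerDl.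
by apply: sumr_ge0 => i' _; exact: sqr_ge0.
Qed.

End Bump.

(** * Charts and changes of coordinates *)

Section Charts.
Context {R : realType} {n : nat} (M : manifold R n).
Implicit Types (c : chart R M n) (x : M) (v w : 'rV[R]_n).

Lemma near_chart c x (P : M -> Prop) : charts c -> chart_dom c x ->
  (\forall y \near x, P y) ->
  \forall a \near c x,
    [/\ chart_dom c (chart_inv c a), c (chart_inv c a) = a & P (chart_inv c a)].
Proof.
move=> cc cx Px.
have im : (c @` chart_dom c) (c x) by exists x.
have ci := chart_inv_cont cc im; rewrite /prop_for /continuous_at in ci.
rewrite chart_mapK// in ci.
have nP : \forall a \near c x, P (chart_inv c a) by exact: ci.
have nO : \forall a \near c x, (c @` chart_dom c) a.
  by apply: open_nbhs_nbhs; split=> //; exact: chart_img_open.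
by near=> a; split; [..|near: a] => //;
  have [y cy <-] : (c @` chart_dom c) a by [near: a];
  rewrite (chart_mapK cc).
Unshelve. all: by end_near. Qed.

Lemma near_chart_dom c x : charts c -> chart_dom c x ->
  \forall y \near x, chart_dom c y.
Proof.
by move=> cc cx; apply: open_nbhs_nbhs; split=> //; exact: chart_dom_open.
Qed.

Lemma near_overlap c c' x : charts c -> charts c' ->
  chart_dom c x -> chart_dom c' x ->
  \forall a \near c x, [/\ chart_dom c (chart_inv c a),
    c (chart_inv c a) = a & chart_dom c' (chart_inv c a)].
Proof. by move=> cc cc' cx cx'; apply/near_chart/near_chart_dom. Qed.

Lemma smooth_transition c c' x : charts c -> charts c' ->
  chart_dom c x -> chart_dom c' x ->
  smooth_near (c' \o chart_inv c) (c x).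
Proof.
move=> cc cc' cx cx'.
have [U [oU Ux] UP] := near_open (near_overlap cc cc' cx cx').
exists U => // s a Ua; have [d K d'] := UP _ Ua.
by apply: (chart_compat cc cc'); exists (chart_inv c a).
Qed.

Lemma coord_change_id c x v : charts c -> chart_dom c x ->
  coord_change c c x v = v.
Proof.
move=> cc cx; rewrite /coord_change.
rewrite (@near_eq_derive _ _ _ _ id); first by rewrite derive_id.
by apply: filterS (near_overlap cc cc cx cx) => a [].
Qed.

Lemma coord_change_comp c c' c'' x v : charts c -> charts c' -> charts c'' ->
  chart_dom c x -> chart_dom c' x -> chart_dom c'' x ->
  coord_change c' c'' x (coord_change c c' x v) = coord_change c c'' x v.
Proof.
move=> cc cc' cc'' cx cx' cx''; rewrite /coord_change.
have s1 := smooth_transition cc cc' cx cx'.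
have s2 := smooth_transition cc' cc'' cx' cx''.
have e : (c' \o chart_inv c) (c x) = c' x by rewrite /= chart_mapK.
rewrite -e in s2 *.
rewrite -(derive_comp v (smooth_near_diff s1) (smooth_near_diff s2)).
apply: near_eq_derive; apply: filterS (near_overlap cc cc' cx cx') => a [_ _ d].
by rewrite /= chart_mapK.
Qed.

Lemma coord_change_linear c c' x : charts c -> charts c' ->
  chart_dom c x -> chart_dom c' x -> linear (coord_change c c' x).
Proof.
move=> cc cc' cx cx' a v w; rewrite /coord_change.
have d := smooth_near_diff (smooth_transition cc cc' cx cx').
by rewrite !deriveE// linearP.
Qed.

Lemma coord_change_eq0 c c' x v : charts c -> charts c' ->
  chart_dom c x -> chart_dom c' x -> coord_change c c' x v = 0 -> v = 0.
Proof.
move=> cc cc' cx cx' v0.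
rewrite -(coord_change_id v cc cx) -(coord_change_comp v cc cc' cc)// v0.
have := coord_change_linear cc' cc cx' cx (-1) 0 0.
by rewrite scaler0 addr0 scaleN1r addNr.
Qed.

Let ca x := chart_at_charts x.
Let da x := chart_at_dom x.

(** ** Tangent charts *)

Lemma tangent_invK c (u : TM M) : charts c -> chart_dom c u.1 ->
  chart_inv (tangent_chart c) (tangent_chart c u) = u.
Proof.
case: u => x y cc /= cx; rewrite row_mxKl row_mxKr chart_mapK//.
by rewrite (coord_change_comp _ (ca x) cc (ca x) (da x))// coord_change_id.
Qed.

Lemma tangent_mapK c (a : 'rV[R]_(n + n)) : charts c ->
  chart_dom c (chart_inv c (lsubmx a)) ->
  c (chart_inv c (lsubmx a)) = lsubmx a ->
  tangent_chart c (chart_inv (tangent_chart c) a) = a.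
Proof.
move=> cc; rewrite /tangent_chart /=; set x := chart_inv c _ => cx e.
rewrite (coord_change_comp _ cc (ca x) cc)//.
by rewrite coord_change_id// e hsubmxK.
Qed.

(** Predicates near a point of TM are read in a chart: the product topology
   on [TM M] is not that of the tangent bundle, because [chart_at] jumps. *)
Definition tnbhs (u : TM M) (P : TM M -> Prop) : Prop :=
  \forall a \near tchart_at u u, P (chart_inv (tchart_at u) a).

Let near_lsubmx m1 m2 (a : 'rV[R]_(m1 + m2)) (P : 'rV[R]_m1 -> Prop) :
  (\forall b \near lsubmx a, P b) -> \forall b \near a, P (lsubmx b).
Proof. by move=> Pa; exact: (@continuous_lsubmx _ _ _ _ a _ Pa). Qed.

Lemma near_tangent_base c (u : TM M) (P : M -> Prop) : charts c ->
  chart_dom c u.1 -> (\forall y \near u.1, P y) ->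
  \forall a \near tangent_chart c u,
    [/\ chart_dom c (chart_inv (tangent_chart c) a).1,
        tangent_chart c (chart_inv (tangent_chart c) a) = a &
        P (chart_inv (tangent_chart c) a).1].
Proof.
move=> cc cx Px.
have := near_chart cc cx Px.
rewrite -[c u.1](row_mxKl _ (coord_change (chart_at u.1) c u.1 u.2)).
move=> /near_lsubmx; apply: filterS => a [d e p]; split => //.
exact: tangent_mapK.
Qed.

Lemma tangent_transitionE c c' (a : 'rV[R]_(n + n)) : charts c -> charts c' ->
  chart_dom c (chart_inv c (lsubmx a)) ->
  chart_dom c' (chart_inv c (lsubmx a)) ->
  c (chart_inv c (lsubmx a)) = lsubmx a ->
  tangent_chart c' (chart_inv (tangent_chart c) a) =
  row_mx ((c' \o chart_inv c) (lsubmx a))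
    ('D_(rsubmx a) (c' \o chart_inv c) (lsubmx a)).
Proof.
move=> cc cc'; rewrite /tangent_chart /=; set x := chart_inv c _ => cx cx' e.
by rewrite (coord_change_comp _ cc (ca x) cc' cx (da x) cx') /coord_change e.
Qed.

Lemma smooth_tangent_transition c c' (u : TM M) : charts c -> charts c' ->
  chart_dom c u.1 -> chart_dom c' u.1 ->
  smooth_near (tangent_chart c' \o chart_inv (tangent_chart c))
    (tangent_chart c u).
Proof.
move=> cc cc' cx cx'.
have sl : smooth_near lsubmx (tangent_chart c u).
  exact: smooth_near_lsubmx (smooth_near_id _).
have sr : smooth_near rsubmx (tangent_chart c u).
  exact: smooth_near_rsubmx (smooth_near_id _).
have st : smooth_near (c' \o chart_inv c) (lsubmx (tangent_chart c u)).
  by rewrite row_mxKl; exact: smooth_transition.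
apply: (@eq_smooth_near _ _ _ (fun a => row_mx ((c' \o chart_inv c) (lsubmx a))
    ('D_(rsubmx a) (c' \o chart_inv c) (lsubmx a)))).
  apply: filterS (near_tangent_base cc cx (near_chart_dom cc' cx')) => a [d e d'].
  rewrite [RHS]tangent_transitionE//.
  by have := congr1 (@lsubmx _ _ _ _) e; rewrite row_mxKl.
apply: smooth_near_row_mx; first exact: (smooth_near_comp sl st).
apply: (@eq_smooth_near _ _ _ (fun a => \sum_j rsubmx a 0 j *:
    'D_(delta_mx 0 j) (c' \o chart_inv c) (lsubmx a))).
  have := smooth_near_nbhs st => /near_lsubmx; apply: filterS => a sa.
  by rewrite [RHS]derive_rV_sum//; exact: smooth_near_diff.
apply: smooth_near_sum => j; apply: smooth_nearZ; first exact: smooth_near_coord.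
exact: (smooth_near_comp sl (smooth_near_derive _ st)).
Qed.

End Charts.

(** * Smooth functions and vector fields on the tangent bundle *)

Section TangentCalculus.
Context {R : realType} {n : nat} (M : manifold R n).
Implicit Types (c : chart R M n) (u : TM M) (P Q : TM M -> Prop).
Implicit Types (W : normedModType R) (X Y : vfield M).

Let ca x := @chart_at_charts _ _ M x.
Let da x := @chart_at_dom _ _ M x.

Let tnbhs_transfer c c' u P : charts c -> charts c' ->
  chart_dom c u.1 -> chart_dom c' u.1 ->
  (\forall a \near tangent_chart c u, P (chart_inv (tangent_chart c) a)) ->
  \forall a \near tangent_chart c' u, P (chart_inv (tangent_chart c') a).
Proof.
move=> cc cc' cu cu' Pu.
have := smooth_near_continuous (smooth_tangent_transition cc' cc cu' cu).
rewrite /prop_for /continuous_at [X in _ --> X](_ : _ = tangent_chart c u); last first.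
  by rewrite /comp tangent_invK.
move=> /(_ _ Pu) tP.
apply: filterS2 (near_tangent_base cc' cu' (near_chart_dom cc cu)) tP.
by move=> a [_ _ d'] Pa; rewrite -(tangent_invK cc d'); exact: Pa.
Qed.

Lemma tnbhsP c u P : charts c -> chart_dom c u.1 ->
  tnbhs u P <->
  \forall a \near tangent_chart c u, P (chart_inv (tangent_chart c) a).
Proof.
move=> cc cu; split; first by apply: tnbhs_transfer.
by apply: tnbhs_transfer.
Qed.

Lemma tnbhsS u P Q : (forall u', P u' -> Q u') -> tnbhs u P -> tnbhs u Q.
Proof. by move=> PQ; apply: filterS => a; exact: PQ. Qed.

Lemma tnbhsI u P Q : tnbhs u P -> tnbhs u Q -> tnbhs u (fun u' => P u' /\ Q u').
Proof. by move=> uP uQ; apply: filterI. Qed.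

Lemma tnbhs_dom c u : charts c -> chart_dom c u.1 ->
  tnbhs u (fun u' => chart_dom c u'.1).
Proof.
move=> cc cu; rewrite /tnbhs.
apply: filterS (near_tangent_base (ca _) (da _) (near_chart_dom cc cu)) => a.
by case.
Qed.

Lemma tnbhs_slit u : slit u -> tnbhs u (@slit _ _ M).
Proof.
move=> su; rewrite /tnbhs.
have cu := near_tangent_base (ca u.1) (da u.1) (near_chart_dom (ca _) (da u.1)).
have ru : rsubmx (tchart_at u u) = u.2.
  by rewrite row_mxKr coord_change_id//.
have nr : \forall a \near tchart_at u u, rsubmx a != 0.
  apply: (@cvgr_neq0 _ _ _ (nbhs (tchart_at u u)) _ (@rsubmx _ _ _ _) u.2) => //.
  by rewrite -ru; exact: continuous_rsubmx.
apply: filterS2 cu nr => a [d _ _] ra.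
apply/eqP => /(coord_change_eq0 (ca _) (ca _) d (da _)) /eqP.
exact/negP.
Qed.

Definition tsmooth W (F : TM M -> W) (u : TM M) : Prop :=
  smooth_near (F \o chart_inv (tchart_at u)) (tchart_at u u).

Let tsmooth_transfer W (F : TM M -> W) c c' u : charts c -> charts c' ->
  chart_dom c u.1 -> chart_dom c' u.1 ->
  smooth_near (F \o chart_inv (tangent_chart c)) (tangent_chart c u) ->
  smooth_near (F \o chart_inv (tangent_chart c')) (tangent_chart c' u).
Proof.
move=> cc cc' cu cu' sF.
have st := smooth_tangent_transition cc' cc cu' cu.
have e : (tangent_chart c \o chart_inv (tangent_chart c')) (tangent_chart c' u)
    = tangent_chart c u by rewrite /comp tangent_invK.
rewrite -e in sF.
apply: (eq_smooth_near _ (smooth_near_comp st sF)).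
have := near_tangent_base cc' cu' (near_chart_dom cc cu).
by apply: filterS => a [_ _ d']; rewrite /comp tangent_invK.
Qed.

Lemma tsmoothP W (F : TM M -> W) c u : charts c -> chart_dom c u.1 ->
  tsmooth F u <->
  smooth_near (F \o chart_inv (tangent_chart c)) (tangent_chart c u).
Proof.
move=> cc cu; split; first by apply: tsmooth_transfer.
by apply: tsmooth_transfer.
Qed.

Lemma tsmooth_tnbhs W (F : TM M -> W) u : tsmooth F u -> tnbhs u (tsmooth F).
Proof.
move=> /smooth_near_nbhs sF; rewrite /tnbhs.
have cu := near_tangent_base (ca u.1) (da u.1) (near_chart_dom (ca _) (da u.1)).
apply: filterS2 cu sF => a [d e _] sa.
by apply/(tsmoothP _ (ca u.1) d); rewrite e.
Qed.

Lemma eq_tsmooth W (F G : TM M -> W) u : tnbhs u (fun u' => F u' = G u') ->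
  tsmooth F u -> tsmooth G u.
Proof. exact: eq_smooth_near. Qed.

Lemma tsmooth_comp m W (F : TM M -> 'rV[R]_m) (h : 'rV[R]_m -> W) u :
  tsmooth F u -> smooth_near h (F u) -> tsmooth (fun u' => h (F u')) u.
Proof.
move=> sF sh; apply: (smooth_near_comp sF).
by rewrite /comp tangent_invK.
Qed.

Lemma tsmooth_chart c u : charts c -> chart_dom c u.1 ->
  tsmooth (tangent_chart c) u.
Proof. by move=> cc cu; exact: smooth_tangent_transition. Qed.

Lemma tsmooth_base c u : charts c -> chart_dom c u.1 ->
  tsmooth (fun u' : TM M => c u'.1) u.
Proof.
move=> cc cu; apply: (@eq_tsmooth _ (fun u' => lsubmx (tangent_chart c u'))).
  by apply: (tnbhsS _ (tnbhs_dom cc cu)) => u' _; rewrite row_mxKl.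
apply: tsmooth_comp (tsmooth_chart cc cu) _.
exact: smooth_near_lsubmx (smooth_near_id _).
Qed.

Lemma smooth_on_slit_imageP W c (G : 'rV[R]_(n + n) -> W) : charts c ->
  smooth_on (tangent_chart c @` (chart_dom (tangent_chart c) `&` @slit _ _ M)) G <->
  forall u, chart_dom c u.1 -> slit u -> smooth_near G (tangent_chart c u).
Proof.
move=> cc; split=> [sG u cu su|sG s _ [u [cu su] <-]]; last first.
  by have [U [_ Ux] /(_ s _ Ux)] := sG u cu su.
have cu' := near_tangent_base cc cu (near_chart_dom cc cu).
have /(tnbhsP _ cc cu) su' := tnbhs_slit su.
have [U [oU Ux] UP] := near_open (filterI cu' su').
exists U => // s a Ua; apply: sG.
have [[d e _] sa] := UP _ Ua.
by exists (chart_inv (tangent_chart c) a).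
Qed.

Lemma smooth_on_slitP W (F : TM M -> W) :
  smooth_on_slit F <-> forall u, slit u -> tsmooth F u.
Proof.
split=> [sF u su|sF c cc].
  apply/(tsmoothP _ (ca u.1) (da u.1)).
  exact: (smooth_on_slit_imageP _ (ca u.1)).1 (sF _ (ca _)) _ (da _) su.
apply/smooth_on_slit_imageP => // u cu su.
exact: (tsmoothP F cc cu).1 (sF _ su).
Qed.

Lemma eq_derive_along W (F G : TM M -> W) u w :
  tnbhs u (fun u' => F u' = G u') -> derive_along F u w = derive_along G u w.
Proof. exact: near_eq_derive. Qed.

Lemma derive_along_chart W (F : TM M -> W) c u w : tsmooth F u ->
  charts c -> chart_dom c u.1 ->
  derive_along F u w =
  'D_(derive_along (tangent_chart c) u w) (F \o chart_inv (tangent_chart c))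
    (tangent_chart c u).
Proof.
move=> sF cc cu.
have dt := smooth_near_diff (tsmooth_chart cc cu).
have dF := smooth_near_diff ((tsmoothP _ cc cu).1 sF).
have e : (tangent_chart c \o chart_inv (tchart_at u)) (tchart_at u u) =
    tangent_chart c u by rewrite /comp tangent_invK.
rewrite -e in dF.
have := derive_comp w dt dF; rewrite e => <-; apply: near_eq_derive.
have := near_tangent_base (ca u.1) (da u.1) (near_chart_dom cc cu).
by apply: filterS => a [_ _ d']; rewrite /comp tangent_invK.
Qed.

Lemma derive_along_id u w : derive_along (tchart_at u) u w = w.
Proof.
rewrite /derive_along (@near_eq_derive _ _ _ _ id) ?derive_id//.
have := near_tangent_base (ca u.1) (da u.1) (near_chart_dom (ca _) (da u.1)).
by apply: filterS => a [].
Qed.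

Lemma derive_along_diff W (F : TM M -> W) u w : tsmooth F u ->
  derive_along F u w = 'd (F \o chart_inv (tchart_at u)) (tchart_at u u) w.
Proof. by move=> sF; rewrite /derive_along deriveE//; exact: smooth_near_diff. Qed.

(** The derivatives in [lie] are taken in a chart which jumps from point to
   point; to differentiate again, they have to be read in a single chart. *)
Lemma near_lie_chart W (F : TM M -> W) X c u : tsmooth F u ->
  charts c -> chart_dom c u.1 ->
  \forall a \near tangent_chart c u,
    (lie X F \o chart_inv (tangent_chart c)) a =
    'D_((lie X (tangent_chart c) \o chart_inv (tangent_chart c)) a)
      (F \o chart_inv (tangent_chart c)) a.
Proof.
move=> sF cc cu.
have /(tnbhsP _ cc cu) sF' := tsmooth_tnbhs sF.
have cu' := near_tangent_base cc cu (near_chart_dom cc cu).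
apply: filterS2 cu' sF' => a [d e _] sa.
by rewrite [LHS](derive_along_chart _ sa cc d) e.
Qed.

(** One chart suffices, since the components in any other chart are Lie
   derivatives of its coordinates ([smooth_vfieldP]). *)
Definition vsmooth X u : Prop := tsmooth (lie X (tchart_at u)) u.

Lemma lie_tsmooth W (F : TM M -> W) X u : vsmooth X u -> tsmooth F u ->
  tsmooth (lie X F) u.
Proof.
move=> sX sF.
apply: (eq_smooth_near _ (smooth_near_derive_dir sF sX)).
apply: filterS (near_lie_chart X sF (ca u.1) (da u.1)) => a H; exact: esym H.
Qed.

Lemma smooth_vfieldP X :
  smooth_vfield X <-> forall u, slit u -> vsmooth X u.
Proof.
split=> [sX u su|sX c cc].
  apply/(tsmoothP _ (ca u.1) (da u.1)).
  exact: (smooth_on_slit_imageP _ (ca u.1)).1 (sX _ (ca _)) _ (da _) su.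
apply/smooth_on_slit_imageP => // u cu su.
apply: (tsmoothP (lie X (tangent_chart c)) cc cu).1.
by apply: lie_tsmooth; [exact: sX|exact: tsmooth_chart].
Qed.

Lemma lie_smooth W (F : TM M -> W) X : smooth_vfield X -> smooth_on_slit F ->
  smooth_on_slit (lie X F).
Proof.
move=> /smooth_vfieldP sX /smooth_on_slitP sF; apply/smooth_on_slitP => u su.
by apply: lie_tsmooth; [exact: sX|exact: sF].
Qed.

Lemma eq_lie W (F G : TM M -> W) X u :
  tnbhs u (fun u' => F u' = G u') -> lie X F u = lie X G u.
Proof. exact: eq_derive_along. Qed.

End TangentCalculus.

Section TangentFields.
Context {R : realType} {n : nat} (M : manifold R n).
Implicit Types (c : chart R M n) (u : TM M) (W : normedModType R).
Implicit Types (X Y : vfield M).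

Let ca x := @chart_at_charts _ _ M x.
Let da x := @chart_at_dom _ _ M x.

Lemma derive_along_lin W (W' : normedModType R) (l : {linear W -> W'})
    (F : TM M -> W) u w : continuous l -> tsmooth F u ->
  derive_along (fun u' => l (F u')) u w = l (derive_along F u w).
Proof. by move=> lc /smooth_near_diff sF; exact: derive_lin. Qed.

Lemma derive_alongB W (F : TM M -> W) u v w : tsmooth F u ->
  derive_along F u (v - w) = derive_along F u v - derive_along F u w.
Proof. by move=> sF; rewrite !derive_along_diff// linearB. Qed.

Lemma derive_alongD W (F : TM M -> W) u v w : tsmooth F u ->
  derive_along F u (v + w) = derive_along F u v + derive_along F u w.
Proof. by move=> sF; rewrite !derive_along_diff// linearD. Qed.

(** Iterated Lie derivatives, split into a first-order and a symmetric part;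
   the latter cancels in commutators. *)
Lemma lie_lie W (F : TM M -> W) X Y u : vsmooth Y u -> tsmooth F u ->
  lie X (lie Y F) u =
  derive_along F u (lie X (lie Y (tchart_at u)) u) +
  'D_(X u) (fun b => 'D_(Y u) (F \o chart_inv (tchart_at u)) b) (tchart_at u u).
Proof.
move=> sY sF.
have nY := near_lie_chart Y sF (ca u.1) (da u.1).
apply: etrans (near_eq_derive (X u) nY) _.
apply: etrans (derive_dir (X u) sF sY) _.
have e : (lie Y (tchart_at u) \o chart_inv (tchart_at u)) (tchart_at u u) = Y u.
  by rewrite /comp tangent_invK// /lie derive_along_id.
by rewrite e.
Qed.

Let Schwarz_for W := forall (f : 'rV[R]_(n + n) -> W) x v w, smooth_near f x ->
  'D_w (fun y => 'D_v f y) x = 'D_v (fun y => 'D_w f y) x.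

Let lie_bracket_for W (F : TM M -> W) X Y u : Schwarz_for W ->
  vsmooth X u -> vsmooth Y u -> tsmooth F u ->
  lie (bracket X Y) F u = lie X (lie Y F) u - lie Y (lie X F) u.
Proof.
move=> SW sX sY sF; rewrite {1}/lie /bracket derive_alongB//.
have cancel (a b p q : W) : p = q -> a - b = a + p - (b + q).
  by move=> ->; rewrite opprD addrACA subrr addr0.
rewrite (lie_lie X sY sF) (lie_lie Y sX sF).
exact: cancel (SW _ _ (Y u) (X u) sF).
Qed.

Lemma lie_bracket_R (F : TM M -> R) X Y u :
  vsmooth X u -> vsmooth Y u -> tsmooth F u ->
  lie (bracket X Y) F u = lie X (lie Y F) u - lie Y (lie X F) u.
Proof.
apply: (@lie_bracket_for R) => f x v w sf; exact: smooth_near_Schwarz.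
Qed.

Lemma lie_bracket_rV m (F : TM M -> 'rV[R]_m) X Y u :
  vsmooth X u -> vsmooth Y u -> tsmooth F u ->
  lie (bracket X Y) F u = lie X (lie Y F) u - lie Y (lie X F) u.
Proof.
apply: (@lie_bracket_for 'rV[R]_m) => f x v w sf; exact: smooth_near_Schwarz_rV.
Qed.

Lemma tsmoothB W (F G : TM M -> W) u : tsmooth F u -> tsmooth G u ->
  tsmooth (fun u => F u - G u) u.
Proof. exact: smooth_nearB. Qed.

Lemma bracket_smooth X Y : smooth_vfield X -> smooth_vfield Y ->
  smooth_vfield (bracket X Y).
Proof.
move=> /smooth_vfieldP sX /smooth_vfieldP sY; apply/smooth_vfieldP => u su.
have sF := tsmooth_chart (ca u.1) (da u.1).
rewrite /vsmooth.
apply: (eq_tsmooth (F := fun u' => lie X (lie Y (tchart_at u)) u' -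
    lie Y (lie X (tchart_at u)) u')).
  apply: (tnbhsS _ (tnbhsI (tnbhs_slit su) (tsmooth_tnbhs sF))) => u' [su' sF'].
  exact: esym (lie_bracket_rV (sX _ su') (sY _ su') sF').
exact: tsmoothB (lie_tsmooth (sX _ su) (lie_tsmooth (sY _ su) sF))
  (lie_tsmooth (sY _ su) (lie_tsmooth (sX _ su) sF)).
Qed.

(** ** Vertical and horizontal components *)

Lemma derive_along_base c u w : charts c -> chart_dom c u.1 ->
  derive_along (fun u' : TM M => c u'.1) u w = lsubmx (derive_along (tangent_chart c) u w).
Proof.
move=> cc cu.
have -> : (fun u' : TM M => c u'.1) = (fun u' => lsubmx (tangent_chart c u')).
  by apply/funext => u'; exact: (esym (row_mxKl _ _)).
apply: derive_along_lin (tsmooth_chart cc cu); exact: continuous_lsubmx.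
Qed.

Lemma coord_change_lsubmx c u w : charts c -> chart_dom c u.1 ->
  coord_change (chart_at u.1) c u.1 (lsubmx w) =
  lsubmx (derive_along (tangent_chart c) u w).
Proof.
move=> cc cu.
have dl : differentiable lsubmx (tchart_at u u) by exact: differentiable_lsubmx.
have dc : differentiable (c \o chart_inv (chart_at u.1)) (lsubmx (tchart_at u u)).
  by rewrite row_mxKl; apply: smooth_near_diff; exact: smooth_transition.
have := derive_comp w dl dc; rewrite [X in _ = 'D__ _ X -> _]row_mxKl.
rewrite (_ : 'D_w lsubmx (tchart_at u u) = lsubmx w); last first.
  by rewrite deriveE// diff_lin//; exact: continuous_lsubmx.
move=> H; exact: etrans (esym H) (derive_along_base w cc cu).
Qed.

Lemma dpiE u w : dpi u w = lsubmx w.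
Proof.
have := derive_along_base w (ca u.1) (da u.1).
by rewrite derive_along_id.
Qed.

Lemma rhoE X u : rho X u = lsubmx (X u).
Proof. exact: dpiE. Qed.

Lemma tchart_at_fibre u y : tchart_at u (u.1, y) = row_mx (chart_at u.1 u.1) y.
Proof. by rewrite /tchart_at/= coord_change_id. Qed.

Lemma gammaE (sigma : pi_field M) u : gamma sigma u = row_mx 0 (sigma u).
Proof.
rewrite /gamma; apply: derive_along_increment => h.
rewrite !tchart_at_fibre addr0 scale0r addr0 opp_row_mx add_row_mx subrr.
rewrite scale_row_mx scaler0 addrAC subrr add0r.
by rewrite /GRing.scale /= mulr1.
Qed.

(** All points of a fibre carry the same coordinates. *)
Lemma derive_along_fibre W (F : TM M -> W) u s :
  derive_along F u (row_mx 0 s) = 'D_s (fun y => F (u.1, y)) u.2.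
Proof.
apply: eq_derive_increment => h.
have inv y : chart_inv (tchart_at u) (row_mx (chart_at u.1 u.1) y) = (u.1, y).
  by rewrite -tchart_at_fibre tangent_invK.
have e0 : tchart_at u u = row_mx (chart_at u.1 u.1) u.2.
  by rewrite -tchart_at_fibre -surjective_pairing.
have eh : h *: row_mx 0 s + tchart_at u u =
    row_mx (chart_at u.1 u.1) (h *: s + u.2).
  by rewrite e0 scale_row_mx scaler0 add_row_mx add0r.
by rewrite eh /comp inv e0 inv.
Qed.

Lemma lie_gamma W (F : TM M -> W) sigma u :
  lie (gamma sigma) F u = 'D_(sigma u) (fun y => F (u.1, y)) u.2.
Proof. by rewrite /lie gammaE derive_along_fibre. Qed.

Lemma tsmooth_fibre W (F : TM M -> W) u : tsmooth F u ->
  smooth_near (fun y => F (u.1, y)) u.2.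
Proof.
move=> sF.
have sr : smooth_near (fun y : 'rV[R]_n => row_mx (chart_at u.1 u.1) y) u.2.
  by apply: smooth_near_row_mx; [exact: smooth_near_cst|exact: smooth_near_id].
have := @smooth_near_comp _ _ _ _ _ (F \o chart_inv (tchart_at u)) _ sr.
rewrite -tchart_at_fibre -surjective_pairing => /(_ sF) sc.
rewrite (_ : (fun y => F (u.1, y)) = (fun y => (F \o chart_inv (tchart_at u))
  (row_mx (chart_at u.1 u.1) y)))//; apply/funext => y.
by rewrite -tchart_at_fibre /comp tangent_invK.
Qed.

End TangentFields.

(** ** Sections of the pullback bundle *)

Section PiFields.
Context {R : realType} {n : nat} (M : manifold R n).
Implicit Types (c : chart R M n) (u : TM M) (W : normedModType R).
Implicit Types (X Y : vfield M) (sigma tau : pi_field M).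

Let ca x := @chart_at_charts _ _ M x.
Let da x := @chart_at_dom _ _ M x.

Definition pcomp c sigma : TM M -> 'rV[R]_n :=
  fun u => coord_change (chart_at u.1) c u.1 (sigma u).

Definition psmooth sigma u : Prop := tsmooth (pcomp (chart_at u.1) sigma) u.

Lemma pcomp_self sigma u : pcomp (chart_at u.1) sigma u = sigma u.
Proof. exact: coord_change_id (ca _) (da _). Qed.

Lemma pcompD c sigma tau u : charts c -> chart_dom c u.1 ->
  pcomp c (fun u => sigma u + tau u) u = pcomp c sigma u + pcomp c tau u.
Proof.
move=> cc cu.
have := coord_change_linear (ca _) cc (da _) cu 1 (sigma u) (tau u).
by rewrite !scale1r.
Qed.

Lemma pcompZ c (k : TM M -> R) sigma u : charts c -> chart_dom c u.1 ->
  pcomp c (fun u => k u *: sigma u) u = k u *: pcomp c sigma u.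
Proof.
move=> cc cu; rewrite /pcomp /coord_change.
have d := smooth_near_diff (smooth_transition (ca u.1) cc (da u.1) cu).
by rewrite !(deriveE _ d) linearZ.
Qed.

Lemma tsmooth_derive_base c (f : 'rV[R]_n -> 'rV[R]_n) (P : TM M -> 'rV[R]_n) u :
  charts c -> chart_dom c u.1 -> smooth_near f (c u.1) -> tsmooth P u ->
  tsmooth (fun u' => 'D_(P u') f (c u'.1)) u.
Proof.
move=> cc cu sf sP.
have sB := tsmooth_base cc cu.
have eB : ((fun u' : TM M => c u'.1) \o chart_inv (tchart_at u)) (tchart_at u u) = c u.1.
  by rewrite /comp tangent_invK.
rewrite -eB in sf.
have nf : \forall a \near tchart_at u u,
    smooth_near f (((fun u' : TM M => c u'.1) \o chart_inv (tchart_at u)) a).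
  exact: smooth_near_continuous sB _ (smooth_near_nbhs sf).
have sS := smooth_near_sum (fun j => smooth_nearZ (smooth_near_coord j sP)
  (smooth_near_comp sB (smooth_near_derive (delta_mx 0 j) sf))).
apply: (eq_smooth_near _ sS); apply: (filterS _ nf) => a sa.
exact: esym (derive_rV_sum _ (smooth_near_diff sa)).
Qed.

Lemma pcomp_change c c' sigma u : charts c -> charts c' ->
  chart_dom c u.1 -> chart_dom c' u.1 ->
  pcomp c' sigma u = 'D_(pcomp c sigma u) (c' \o chart_inv c) (c u.1).
Proof. by move=> cc cc' cu cu'; rewrite -[RHS]/(coord_change c c' u.1 _) coord_change_comp. Qed.

Let psmooth_transfer c c' sigma u : charts c -> charts c' ->
  chart_dom c u.1 -> chart_dom c' u.1 ->
  tsmooth (pcomp c sigma) u -> tsmooth (pcomp c' sigma) u.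
Proof.
move=> cc cc' cu cu' sc.
apply: (eq_tsmooth _ (tsmooth_derive_base cc cu (smooth_transition cc cc' cu cu') sc)).
apply: (tnbhsS _ (tnbhsI (tnbhs_dom cc cu) (tnbhs_dom cc' cu'))) => u' [d d'].
exact: esym (pcomp_change sigma cc cc' d d').
Qed.

Lemma psmoothP c sigma u : charts c -> chart_dom c u.1 ->
  psmooth sigma u <-> tsmooth (pcomp c sigma) u.
Proof.
move=> cc cu; split; first exact: (psmooth_transfer (ca _) cc (da _) cu).
exact: (psmooth_transfer cc (ca _) cu (da _)).
Qed.

Lemma smooth_pi_fieldP sigma :
  smooth_pi_field sigma <-> forall u, slit u -> psmooth sigma u.
Proof.
split=> [sX u su|sX c cc].
  apply/(tsmoothP _ (ca u.1) (da u.1)).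
  exact: (smooth_on_slit_imageP _ (ca u.1)).1 (sX _ (ca _)) _ (da _) su.
apply/smooth_on_slit_imageP => // u cu su.
exact: (tsmoothP (pcomp c sigma) cc cu).1 ((psmoothP sigma cc cu).1 (sX u su)).
Qed.

Lemma eq_psmooth sigma tau u : tnbhs u (fun u' => sigma u' = tau u') ->
  psmooth sigma u -> psmooth tau u.
Proof.
move=> st; apply: eq_tsmooth; apply: (tnbhsS _ st) => u' e.
by rewrite /pcomp e.
Qed.

Lemma eq_smooth_pi_field sigma tau : (forall u, slit u -> sigma u = tau u) ->
  smooth_pi_field sigma -> smooth_pi_field tau.
Proof.
move=> st /smooth_pi_fieldP ss; apply/smooth_pi_fieldP => u su.
by apply: eq_psmooth (ss u su); exact: (tnbhsS st (tnbhs_slit su)).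
Qed.

Lemma eq_smooth_on_slit W (F G : TM M -> W) : (forall u, slit u -> F u = G u) ->
  smooth_on_slit F -> smooth_on_slit G.
Proof.
move=> FG /smooth_on_slitP sF; apply/smooth_on_slitP => u su.
by apply: eq_tsmooth (sF u su); exact: (tnbhsS FG (tnbhs_slit su)).
Qed.

Lemma eq_smooth_vfield X Y : (forall u, slit u -> X u = Y u) ->
  smooth_vfield X -> smooth_vfield Y.
Proof.
move=> XY /smooth_vfieldP sX; apply/smooth_vfieldP => u su.
apply: eq_tsmooth (sX u su); apply: (tnbhsS _ (tnbhs_slit su)) => u' su'.
by rewrite /lie XY.
Qed.

Lemma smooth_pi_fieldD sigma tau : smooth_pi_field sigma -> smooth_pi_field tau ->
  smooth_pi_field (fun u => sigma u + tau u).
Proof.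
move=> /smooth_pi_fieldP ss /smooth_pi_fieldP st; apply/smooth_pi_fieldP => u su.
have s2 := smooth_nearD (ss u su) (st u su).
apply: (@eq_tsmooth _ _ _ _ (fun u' => pcomp (chart_at u.1) sigma u' +
  pcomp (chart_at u.1) tau u') _ _ _ s2).
apply: (tnbhsS _ (tnbhs_dom (ca u.1) (da u.1))) => u' d.
exact: esym (pcompD sigma tau (ca u.1) d).
Qed.

Lemma smooth_pi_fieldZ (k : TM M -> R) sigma : smooth_on_slit k ->
  smooth_pi_field sigma -> smooth_pi_field (fun u => k u *: sigma u).
Proof.
move=> /smooth_on_slitP sk /smooth_pi_fieldP ss; apply/smooth_pi_fieldP => u su.
have s2 := smooth_nearZ (sk u su) (ss u su).
apply: (@eq_tsmooth _ _ _ _ (fun u' => k u' *: pcomp (chart_at u.1) sigma u') _ _ _ s2).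
apply: (tnbhsS _ (tnbhs_dom (ca u.1) (da u.1))) => u' d.
exact: esym (pcompZ k sigma (ca u.1) d).
Qed.

Lemma smooth_on_slit_cst W (w : W) : smooth_on_slit (fun _ : TM M => w).
Proof. by apply/smooth_on_slitP => u su; exact: smooth_near_cst. Qed.

Lemma smooth_on_slitD W (F G : TM M -> W) : smooth_on_slit F ->
  smooth_on_slit G -> smooth_on_slit (fun u => F u + G u).
Proof.
move=> /smooth_on_slitP sF /smooth_on_slitP sG; apply/smooth_on_slitP => u su.
exact: smooth_nearD (sF u su) (sG u su).
Qed.

Lemma smooth_on_slitM (F G : TM M -> R) : smooth_on_slit F ->
  smooth_on_slit G -> smooth_on_slit (fun u => F u * G u).
Proof.
move=> /smooth_on_slitP sF /smooth_on_slitP sG; apply/smooth_on_slitP => u su.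
exact: smooth_nearM (sF u su) (sG u su).
Qed.

Lemma smooth_on_slitV (F : TM M -> R) : smooth_on_slit F ->
  (forall u, slit u -> F u != 0) -> smooth_on_slit (fun u => (F u)^-1).
Proof.
move=> /smooth_on_slitP sF F0; apply/smooth_on_slitP => u su.
apply: smooth_nearV (sF u su); rewrite /comp tangent_invK//; exact: F0.
Qed.

Lemma tnbhs_neq0 (F : TM M -> R) u : tsmooth F u -> F u != 0 ->
  tnbhs u (fun u' => F u' != 0).
Proof.
move=> sF.
have e : (F \o chart_inv (tchart_at u)) (tchart_at u u) = F u.
  by rewrite /comp tangent_invK.
rewrite -e => F0.
have cF := smooth_near_continuous sF.
exact (cvgr_neq0 _ cF F0).
Qed.

Lemma smooth_pi_fieldN sigma : smooth_pi_field sigma ->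
  smooth_pi_field (fun u => - sigma u).
Proof.
move=> ss; apply: eq_smooth_pi_field (smooth_pi_fieldZ (smooth_on_slit_cst (-1 : R)) ss).
by move=> u _; rewrite scaleN1r.
Qed.

Lemma smooth_pi_fieldB sigma tau : smooth_pi_field sigma -> smooth_pi_field tau ->
  smooth_pi_field (fun u => sigma u - tau u).
Proof. by move=> ss st; exact: smooth_pi_fieldD ss (smooth_pi_fieldN st). Qed.

Lemma pcomp_rho c X u : charts c -> chart_dom c u.1 ->
  pcomp c (rho X) u = lsubmx (lie X (tangent_chart c) u).
Proof. by move=> cc cu; rewrite /pcomp rhoE coord_change_lsubmx. Qed.

Lemma rho_smooth X : smooth_vfield X -> smooth_pi_field (rho X).
Proof.
move=> /smooth_vfieldP sX; apply/smooth_pi_fieldP => u su.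
have s2 := smooth_near_lsubmx (sX u su).
apply: (@eq_tsmooth _ _ _ _ (fun u' => lsubmx (lie X (tchart_at u) u')) _ _ _ s2).
apply: (tnbhsS _ (tnbhs_dom (ca u.1) (da u.1))) => u' d.
exact: esym (pcomp_rho X (ca u.1) d).
Qed.

Lemma lie_vertical_chart X sigma c u : charts c -> chart_dom c u.1 ->
  X u = row_mx 0 (sigma u) ->
  lie X (tangent_chart c) u = row_mx 0 (pcomp c sigma u).
Proof.
move=> cc cu Xu; rewrite /lie Xu derive_along_fibre.
apply: derive_along_increment => h.
rewrite /tangent_chart /=.
rewrite (coord_change_linear (ca _) cc (da _) cu).
rewrite opp_row_mx add_row_mx subrr addrK scale_row_mx scaler0.
by [].
Qed.

Lemma gamma_smooth sigma : smooth_pi_field sigma -> smooth_vfield (gamma sigma).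
Proof.
move=> /smooth_pi_fieldP ss; apply/smooth_vfieldP => u su.
have s2 := smooth_near_row_mx (smooth_near_cst (0 : 'rV[R]_n) _) (ss u su).
apply: (@eq_tsmooth _ _ _ _ (fun u' => row_mx 0 (pcomp (chart_at u.1) sigma u')) _ _ _ s2).
apply: (tnbhsS _ (tnbhs_dom (ca u.1) (da u.1))) => u' d.
exact: esym (lie_vertical_chart (ca u.1) d (gammaE sigma u')).
Qed.

Lemma rho_gamma sigma u : rho (gamma sigma) u = 0.
Proof. by rewrite rhoE gammaE row_mxKl. Qed.

Lemma vertical_gamma X : smooth_vfield X ->
  (forall u, slit u -> rho X u = 0) ->
  exists2 sigma, smooth_pi_field sigma & forall u, slit u -> X u = gamma sigma u.
Proof.
move=> /smooth_vfieldP sX X0.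
pose sigma : pi_field M := fun u => rsubmx (X u).
have XE u : slit u -> X u = row_mx 0 (sigma u).
  by move=> su; rewrite -(X0 _ su) rhoE hsubmxK.
exists sigma; last by move=> u su; rewrite gammaE; exact: XE.
apply/smooth_pi_fieldP => u su.
have s2 := smooth_near_rsubmx (sX u su).
apply: (@eq_tsmooth _ _ _ _ (fun u' => rsubmx (lie X (tchart_at u) u')) _ _ _ s2).
apply: (tnbhsS _ (tnbhsI (tnbhs_slit su) (tnbhs_dom (ca u.1) (da u.1)))) => u' [su' d].
by rewrite (lie_vertical_chart (ca u.1) d (XE _ su')) row_mxKr.
Qed.

Lemma eta_smooth : smooth_pi_field (@Defs.eta R n M).
Proof.
apply/smooth_pi_fieldP => u su.
have s2 := smooth_near_rsubmx (tsmooth_chart (ca u.1) (da u.1)).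
apply: (@eq_tsmooth _ _ _ _ (fun u' => rsubmx (tchart_at u u')) _ _ _ s2).
apply: (tnbhsS _ (tnbhs_dom (ca u.1) (da u.1))) => u' d.
exact: row_mxKr.
Qed.

End PiFields.

(** * Sections with a prescribed value *)

Section FibreConstant.
Context {R : realType} {n : nat} (M : manifold R n).

Let ca x := @chart_at_charts _ _ M x.
Let da x := @chart_at_dom _ _ M x.

Lemma compact_sqr_dist_ball (a : 'rV[R]_n) (r : R) : 0 < r ->
  compact [set b | sqr_dist a b <= r].
Proof.
move=> r0; apply: bounded_closed_compact.
  have r1 : 0 < r + 1 by rewrite ltr_wpDl// ltW.
  exists (`|a| + (r + 1)); split; first by rewrite num_real.
  move=> t rt b /= br.
  have /(sqr_dist_ball r1) : sqr_dist a b < (r + 1) ^+ 2.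
    by apply: le_lt_trans br _; rewrite sqrrD expr1n mulr1 mulr2n; nra.
  move=> ba; rewrite -[b](subrK a) (le_trans (ler_normD _ _))//.
  by rewrite addrC (le_trans _ (ltW rt))// lerD2l ltW.
have cs : continuous (sqr_dist a).
  by move=> b; exact: smooth_near_continuous (smooth_near_sqr_dist a b).
rewrite -[X in closed X]/(sqr_dist a @^-1` [set t | t <= r]).
by apply: preimage_closed; [move=> b _; exact: cs|exact: closed_le].
Qed.

(** Concurrence is a condition on global sections only; cutting off a section
   with constant coordinates turns it into a condition on single vectors. The
   sections do not depend on the fibre coordinate over [x0], so that their
   derivatives along the fibre vanish. *)
Lemma fibre_constant_section (x0 : M) (v : 'rV[R]_n) :
  exists2 sigma : pi_field M, smooth_pi_field sigma &
    forall y, sigma (x0, y) = v.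
Proof.
pose c := chart_at x0.
have im : open_nbhs (c x0) (c @` chart_dom c).
  by split; [exact/chart_img_open/ca|exists x0 => //; exact: da].
have /nbhs_ballP[r /= r0 rO] := open_nbhs_nbhs im.
pose q := (r / 2) ^+ 2.
have q0 : 0 < q by rewrite exprn_gt0// divr_gt0.
have inO b : sqr_dist (c x0) b <= q -> (c @` chart_dom c) b.
  move=> bq; apply: rO; rewrite -ball_normE /ball_ /= distrC.
  apply: sqr_dist_ball => //; apply: le_lt_trans bq _.
  by rewrite /q ltr_sqr ?nnegrE ?divr_ge0 ?(ltW r0)// ltr_pdivrMr// ltr_pMr// ltr1n.
pose psi (x : M) : R :=
  if `[< chart_dom c x >] then flat_exp 0 (q - sqr_dist (c x0) (c x)) else 0.
have psi0 : psi x0 != 0.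
  rewrite /psi; case: asboolP => [_|[]]; last exact: da.
  rewrite (_ : sqr_dist _ _ = 0); last first.
    by rewrite /sqr_dist big1// => j _; rewrite subrr expr0n.
  by rewrite /flat_exp subr0 q0 expr0 mul1r gt_eqF// expR_gt0.
pose sigma : pi_field M := fun u =>
  (psi u.1 / psi x0) *: coord_change c (chart_at u.1) u.1 v.
exists sigma; last first.
  move=> y; rewrite /sigma divff// scale1r.
  by rewrite coord_change_id; [|exact: ca|exact: da].
apply/smooth_pi_fieldP => u su.
have [cu|ncu] := pselect (chart_dom c u.1).
  apply/(psmoothP sigma (ca x0) cu).
  apply: (@eq_tsmooth _ _ _ _ (fun u' =>
      (flat_exp 0 (q - sqr_dist (c x0) (c u'.1)) * (psi x0)^-1) *: v)).
    apply: (tnbhsS _ (tnbhs_dom (ca x0) cu)) => u' d.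
    rewrite /sigma (pcompZ _ _ (ca x0) d).
    have -> : psi u'.1 = flat_exp 0 (q - sqr_dist (c x0) (c u'.1)).
      by rewrite /psi asboolT.
    congr (_ *: _); rewrite /pcomp.
    rewrite (coord_change_comp _ (ca x0) (ca _) (ca x0) d (da _) d).
    exact: esym (coord_change_id v (ca x0) d).
  apply: (tsmooth_comp (h := fun a => (flat_exp 0 (q - sqr_dist (c x0) a) *
    (psi x0)^-1) *: v) (tsmooth_base (ca x0) cu)).
  apply: smooth_nearZ (smooth_near_cst _ _).
  apply: smooth_nearM (smooth_near_cst _ _).
  apply: smooth_near_flat_exp; apply: smooth_nearB (smooth_near_cst _ _) _.
  exact: smooth_near_sqr_dist.
pose K := chart_inv c @` [set b | sqr_dist (c x0) b <= q].
have cK : closed K.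
  apply: compact_closed; first exact: manifold_hausdorff.
  apply: continuous_compact; last exact: compact_sqr_dist_ball.
  apply: continuous_in_subspaceT => b; rewrite inE => /= bq.
  by apply: chart_inv_cont; [exact: ca|exact: inO].
have nK : \forall x \near u.1, (~` K) x.
  apply: open_nbhs_nbhs; split; first exact: closed_openC.
  move=> [b /= bq bu]; apply: ncu; rewrite -bu.
  have [x dx <-] := inO b bq.
  by rewrite chart_mapK//; exact: ca.
apply: (@eq_psmooth _ _ _ (fun _ => 0)); last first.
  apply: (@eq_tsmooth _ _ _ _ (fun _ => 0)); last exact: smooth_near_cst.
  apply: (tnbhsS _ (tnbhs_dom (ca u.1) (da u.1))) => u' d.
  by rewrite /pcomp /coord_change derive0.
apply: filterS (near_tangent_base (ca u.1) (da u.1) nK) => a [_ _].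
set x := chart_inv (tchart_at u) a => nKx; rewrite /sigma.
suff -> : psi x.1 = 0 by rewrite mul0r scale0r.
rewrite /psi; case: asboolP => // dx.
have : q < sqr_dist (c x0) (c x.1).
  rewrite ltNge; apply/negP => xq; apply: nKx; exists (c x.1) => //.
  by rewrite chart_mapK//; exact: ca.
by move=> xq; rewrite /flat_exp subr_gt0 ltNge (ltW xq).
Qed.

End FibreConstant.

(** * Brackets and the projection to the pullback bundle *)

Section Brackets.
Context {R : realType} {n : nat} (M : manifold R n).
Implicit Types (c : chart R M n) (u : TM M) (W : normedModType R).
Implicit Types (X Y Z : vfield M) (sigma tau : pi_field M).

Let ca x := @chart_at_charts _ _ M x.
Let da x := @chart_at_dom _ _ M x.

Lemma lieB W (F G : TM M -> W) X u : tsmooth F u -> tsmooth G u ->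
  lie X (fun u' => F u' - G u') u = lie X F u - lie X G u.
Proof.
move=> sF sG; have dF := smooth_near_diff sF; have dG := smooth_near_diff sG.
exact: (deriveB (diff_derivable (v:=X u) dF) (diff_derivable dG)).
Qed.

Lemma lieD W (F G : TM M -> W) X u : tsmooth F u -> tsmooth G u ->
  lie X (fun u' => F u' + G u') u = lie X F u + lie X G u.
Proof.
move=> sF sG; have dF := smooth_near_diff sF; have dG := smooth_near_diff sG.
exact: (deriveD (diff_derivable (v:=X u) dF) (diff_derivable dG)).
Qed.

Lemma lieM (F G : TM M -> R) X u : tsmooth F u -> tsmooth G u ->
  lie X (fun u' => F u' * G u') u = lie X F u * G u + F u * lie X G u.
Proof.
move=> sF sG.
have e (H : TM M -> R) : (H \o chart_inv (tchart_at u)) (tchart_at u u) = H u.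
  by rewrite /comp tangent_invK.
have [_ /(_ (X u))] := differentiable_scale (smooth_near_diff sF) (smooth_near_diff sG).
by rewrite !e.
Qed.

Lemma lie_cst W (w : W) X u : lie X (fun _ => w) u = 0.
Proof. exact: derive_cst. Qed.

Lemma lieV (F : TM M -> R) X u : tsmooth F u -> F u != 0 ->
  lie X (fun u' => (F u')^-1) u = - lie X F u / F u ^+ 2.
Proof.
move=> sF F0.
have e : (F \o chart_inv (tchart_at u)) (tchart_at u u) = F u.
  by rewrite /comp tangent_invK.
have := deriveV _ (diff_derivable (v := X u) (smooth_near_diff sF)).
rewrite e => /(_ F0) H; apply: etrans H _.
by rewrite /GRing.scale /= mulNr mulrC mulNr.
Qed.

Definition base_coord c : TM M -> 'rV[R]_n := fun u => c u.1.

Lemma pcomp_rho_lie c X u : charts c -> chart_dom c u.1 ->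
  pcomp c (rho X) u = lie X (base_coord c) u.
Proof.
by move=> cc cu; rewrite pcomp_rho// -derive_along_base.
Qed.

Lemma rho_lie X u : rho X u = lie X (base_coord (chart_at u.1)) u.
Proof.
have := pcomp_rho_lie X (ca u.1) (da u.1); rewrite pcomp_self; exact.
Qed.

(** In coordinates [rho X] consists of the Lie derivatives of the coordinates of
   the base, and [bracket X Y] acts as a commutator. *)
Lemma rho_bracket X Y u : vsmooth X u -> vsmooth Y u ->
  rho (bracket X Y) u =
  lie X (pcomp (chart_at u.1) (rho Y)) u - lie Y (pcomp (chart_at u.1) (rho X)) u.
Proof.
move=> sX sY.
have sb : tsmooth (base_coord (chart_at u.1)) u by exact: tsmooth_base (ca _) (da _).
have e Z : tnbhs u (fun u' => lie Z (base_coord (chart_at u.1)) u' =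
    pcomp (chart_at u.1) (rho Z) u').
  apply: (tnbhsS _ (tnbhs_dom (ca u.1) (da u.1))) => u' d.
  exact: esym (pcomp_rho_lie Z (ca _) d).
rewrite rho_lie -(eq_lie X (e Y)) -(eq_lie Y (e X)).
exact: lie_bracket_rV sX sY sb.
Qed.

(** The derivative of a section along the fibres, whose tangent spaces all
   carry the same coordinates. *)
Definition fibre_derive sigma tau : pi_field M :=
  fun u => 'D_(sigma u) (fun y => tau (u.1, y)) u.2.

Lemma psmooth_fibre sigma u : psmooth sigma u ->
  smooth_near (fun y => sigma (u.1, y)) u.2.
Proof.
move=> /tsmooth_fibre; rewrite (_ : (fun y => _) = (fun y => sigma (u.1, y)))//.
by apply/funext => y; exact: coord_change_id (ca u.1) (da u.1).
Qed.

Lemma pcomp_fibre_derive c sigma tau u : charts c -> chart_dom c u.1 ->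
  psmooth tau u ->
  pcomp c (fibre_derive sigma tau) u = lie (gamma sigma) (pcomp c tau) u.
Proof.
move=> cc cu st; rewrite lie_gamma.
have dA := smooth_near_diff (smooth_transition (ca u.1) cc (da u.1) cu).
have dt := smooth_near_diff (psmooth_fibre st).
have H := derive_lin (sigma u) (diff_continuous dA) dt.
have E v : coord_change (chart_at u.1) c u.1 v =
    'd (c \o chart_inv (chart_at u.1)) (chart_at u.1 u.1) v by exact: deriveE.
have e : (fun y => pcomp c tau (u.1, y)) =
    'd (c \o chart_inv (chart_at u.1)) (chart_at u.1 u.1) \o
      (fun y => tau (u.1, y)) by apply/funext => y; exact: E.
rewrite e; exact: etrans (E _) (esym H).
Qed.

Lemma fibre_derive_smooth sigma tau : smooth_pi_field sigma ->
  smooth_pi_field tau -> smooth_pi_field (fibre_derive sigma tau).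
Proof.
move=> ss st; have /smooth_vfieldP sg := gamma_smooth ss.
move/smooth_pi_fieldP: st => st; apply/smooth_pi_fieldP => u su.
have s2 := lie_tsmooth (sg u su) (st u su).
apply: (eq_tsmooth _ s2).
apply: (tnbhsS _ (tnbhsI (tnbhs_slit su) (tnbhs_dom (ca u.1) (da u.1)))).
move=> u' [su' d]; exact: esym (pcomp_fibre_derive sigma (ca u.1) d (st u' su')).
Qed.

Lemma lie_gamma_pcomp sigma tau u :
  lie (gamma sigma) (pcomp (chart_at u.1) tau) u = fibre_derive sigma tau u.
Proof.
have e : (fun y => pcomp (chart_at u.1) tau (u.1, y)) = (fun y => tau (u.1, y)).
  by apply/funext => y; exact: coord_change_id (ca u.1) (da u.1).
by rewrite lie_gamma e.
Qed.

Lemma rho_bracket_gamma X sigma tau u : slit u -> smooth_pi_field sigma ->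
  smooth_vfield X -> (forall u, slit u -> rho X u = tau u) ->
  rho (bracket (gamma sigma) X) u = fibre_derive sigma tau u.
Proof.
move=> su ss sX Xt.
have /smooth_vfieldP sg := gamma_smooth ss.
move/smooth_vfieldP: sX => sX.
rewrite (rho_bracket (sg u su) (sX u su)).
have nX : tnbhs u (fun u' => pcomp (chart_at u.1) (rho X) u' =
    pcomp (chart_at u.1) tau u').
  by apply: (tnbhsS _ (tnbhs_slit su)) => u' su'; rewrite /pcomp Xt.
rewrite (eq_lie _ nX) lie_gamma_pcomp.
have ng : tnbhs u (fun u' => pcomp (chart_at u.1) (rho (gamma sigma)) u' = 0).
  apply: (tnbhsS _ (tnbhs_slit su)) => u' _.
  by rewrite /pcomp rho_gamma /coord_change derive0.
by rewrite (eq_lie _ ng) lie_cst subr0.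
Qed.

Lemma rho_bracket_gamma2 sigma tau u : slit u -> smooth_pi_field sigma ->
  smooth_pi_field tau -> rho (bracket (gamma sigma) (gamma tau)) u = 0.
Proof.
move=> su ss st.
rewrite (rho_bracket_gamma (tau := fun _ => 0) su ss (gamma_smooth st)).
  exact: derive_cst.
by move=> u' _; exact: rho_gamma.
Qed.

Lemma bracketC X Y u : bracket X Y u = - bracket Y X u.
Proof. by rewrite /bracket opprB. Qed.

Lemma vsmoothD X Y u : vsmooth X u -> vsmooth Y u ->
  vsmooth (fun u' => X u' + Y u') u.
Proof.
move=> sX sY; have s2 := smooth_nearD sX sY.
apply: (eq_tsmooth (F := fun u' => lie X (tchart_at u) u' + lie Y (tchart_at u) u') _ s2).
apply: (tnbhsS _ (tsmooth_tnbhs (tsmooth_chart (ca u.1) (da u.1)))) => u' sF.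
exact: esym (derive_alongD _ _ sF).
Qed.

Lemma smooth_vfieldD X Y : smooth_vfield X -> smooth_vfield Y ->
  smooth_vfield (fun u' => X u' + Y u').
Proof.
move=> /smooth_vfieldP sX /smooth_vfieldP sY; apply/smooth_vfieldP => u su.
exact: vsmoothD (sX u su) (sY u su).
Qed.

Lemma bracketDl X X' Y u : slit u -> smooth_vfield X -> smooth_vfield X' ->
  smooth_vfield Y ->
  bracket (fun u => X u + X' u) Y u = bracket X Y u + bracket X' Y u.
Proof.
move=> su /smooth_vfieldP sX /smooth_vfieldP sX' /smooth_vfieldP sY.
have sF := tsmooth_chart (ca u.1) (da u.1).
have sXF := lie_tsmooth (sX u su) sF; have sXF' := lie_tsmooth (sX' u su) sF.
have sYF := lie_tsmooth (sY u su) sF.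
have e : tnbhs u (fun u' => lie (fun u => X u + X' u) (tchart_at u) u' =
    lie X (tchart_at u) u' + lie X' (tchart_at u) u').
  by apply: (tnbhsS _ (tsmooth_tnbhs sF)) => u' s'; exact: derive_alongD.
have e1 : lie (fun u => X u + X' u) (lie Y (tchart_at u)) u =
    lie X (lie Y (tchart_at u)) u + lie X' (lie Y (tchart_at u)) u.
  exact: derive_alongD.
have e2 := etrans (eq_lie Y e) (lieD Y sXF sXF').
have interchange (a b p q : 'rV[R]_(n + n)) : (a + b) - (p + q) = (a - p) + (b - q).
  by rewrite opprD addrACA.
exact: etrans (congr2 (fun a b => a - b) e1 e2) (interchange _ _ _ _).
Qed.

Lemma eq_lie_field (W : normedModType R) (F : TM M -> W) X Y u : X u = Y u ->
  lie X F u = lie Y F u.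
Proof. by move=> e; rewrite -[LHS]/(derive_along F u (X u)) e. Qed.

Local Opaque lie.

Lemma eq_bracket X Y Z u : slit u -> (forall u, slit u -> X u = Y u) ->
  bracket X Z u = bracket Y Z u.
Proof.
move=> su XY.
have e : tnbhs u (fun u' => lie X (tchart_at u) u' = lie Y (tchart_at u) u').
  by apply: (tnbhsS _ (tnbhs_slit su)) => u' su'; exact: eq_lie_field (XY _ su').
have e1 : lie X (lie Z (tchart_at u)) u = lie Y (lie Z (tchart_at u)) u.
  exact: eq_lie_field (XY u su).
have e2 : lie Z (lie X (tchart_at u)) u = lie Z (lie Y (tchart_at u)) u.
  exact: eq_lie e.
have E (V : vfield M) : bracket V Z u =
    lie V (lie Z (tchart_at u)) u - lie Z (lie V (tchart_at u)) u.
  exact: erefl.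
rewrite -> (E X), (E Y), e1, e2.
exact: erefl.
Qed.

Local Opaque bracket rho.

(** The projection of a bracket is a commutator of Lie derivatives acting on
   the coordinates of the base, and commutators satisfy the Jacobi identity. *)
Lemma rho_jacobi X Y Z u : slit u -> smooth_vfield X -> smooth_vfield Y ->
  smooth_vfield Z ->
  rho (bracket X (bracket Y Z)) u + rho (bracket Y (bracket Z X)) u +
  rho (bracket Z (bracket X Y)) u = 0.
Proof.
move=> su sX sY sZ.
pose b := base_coord (chart_at u.1).
have sb : tsmooth b u by exact: tsmooth_base (ca _) (da _).
have nb : tnbhs u (fun u' => slit u' /\ tsmooth b u').
  exact: tnbhsI (tnbhs_slit su) (tsmooth_tnbhs sb).
have E X1 X2 X3 : smooth_vfield X1 -> smooth_vfield X2 -> smooth_vfield X3 ->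
    rho (bracket X1 (bracket X2 X3)) u =
    lie X1 (lie X2 (lie X3 b)) u - lie X1 (lie X3 (lie X2 b)) u -
    (lie X2 (lie X3 (lie X1 b)) u - lie X3 (lie X2 (lie X1 b)) u).
  move=> s1 s2 s3; have s23 := bracket_smooth s2 s3.
  move/smooth_vfieldP: s1 => s1; move/smooth_vfieldP: s2 => s2.
  move/smooth_vfieldP: s3 => s3; move/smooth_vfieldP: s23 => s23.
  have e : tnbhs u (fun u' => lie (bracket X2 X3) b u' =
      lie X2 (lie X3 b) u' - lie X3 (lie X2 b) u').
    apply: (tnbhsS _ nb) => u' [su' sb'].
    exact: lie_bracket_rV (s2 _ su') (s3 _ su') sb'.
  have e1 := lie_bracket_rV (s1 u su) (s23 u su) sb.
  have e2 := lie_bracket_rV (s2 u su) (s3 u su) (lie_tsmooth (s1 u su) sb).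
  have e3 := lieB X1 (lie_tsmooth (s2 _ su) (lie_tsmooth (s3 _ su) sb))
    (lie_tsmooth (s3 _ su) (lie_tsmooth (s2 _ su) sb)).
  by rewrite rho_lie e1 e2 (eq_lie X1 e) e3.
have cyclic (r1 r2 r3 a1 a2 a3 a4 a5 a6 : 'rV[R]_n) :
    r1 = a1 - a2 - (a3 - a4) -> r2 = a3 - a5 - (a6 - a2) ->
    r3 = a6 - a4 - (a1 - a5) -> r1 + r2 + r3 = 0.
  by move=> -> -> ->; apply/rowP => j; rewrite !mxE; ring.
exact: cyclic (E X Y Z sX sY sZ) (E Y Z X sY sZ sX) (E Z X Y sZ sX sY).
Qed.

End Brackets.

(** * The metric of a Finsler energy *)

Section Metric.
Context {R : realType} {n : nat} (M : manifold R n).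
Variable L : TM M -> R.
Hypothesis energy_smooth : smooth_on_slit (fun u => L u ^+ 2).
Implicit Types (u : TM M) (v w x y z : 'rV[R]_n).
Implicit Types (sigma tau : pi_field M).

Let g := finsler_metric L.
Let E (x : M) z := L (x, z) ^+ 2.

Let sE u : slit u -> smooth_near (E u.1) u.2.
Proof. by move=> su; exact: tsmooth_fibre ((smooth_on_slitP _).1 energy_smooth _ su). Qed.

Lemma slit_fibre u : slit u -> \forall y \near u.2, slit ((u.1, y) : TM M).
Proof.
by move=> su; apply: (@cvgr_neq0 _ _ _ (nbhs u.2) _ id u.2).
Qed.

Lemma metric_sym u v w : slit u -> g u v w = g u w v.
Proof.
move=> su.
apply: (@f_equal R R (fun t => 2^-1 * t)).
exact: smooth_near_Schwarz w v (sE su).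
Qed.

Lemma metric_linearl u w : slit u -> linear (fun v => g u v w : R^o).
Proof.
move=> su a v v'; rewrite /g /finsler_metric.
have dE := smooth_near_diff (smooth_near_derive w (sE su)).
by rewrite !(deriveE _ dE) linearP /= mulrDr scalerAr.
Qed.

Lemma metric_linearr u v : slit u -> linear (fun w => g u v w : R^o).
Proof.
move=> su a w w'; rewrite !(metric_sym v)//; exact: metric_linearl.
Qed.

Lemma metricDl u v v' w : slit u -> g u (v + v') w = g u v w + g u v' w.
Proof. by move=> su; have := metric_linearl w su 1 v v'; rewrite !scale1r. Qed.

Lemma metricZl u a v w : slit u -> g u (a *: v) w = a * g u v w.
Proof.
move=> su; have := metric_linearl w su (-1) v v; rewrite scaleN1r addNr scaleN1r addNr.
by move=> g0; have := metric_linearl w su a v 0; rewrite g0 !addr0.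
Qed.

Lemma metricDr u v w w' : slit u -> g u v (w + w') = g u v w + g u v w'.
Proof. by move=> su; rewrite !(metric_sym v)//; exact: metricDl. Qed.

Lemma metricZr u a v w : slit u -> g u v (a *: w) = a * g u v w.
Proof. by move=> su; rewrite !(metric_sym v)//; exact: metricZl. Qed.

Lemma metricNl u v w : slit u -> g u (- v) w = - g u v w.
Proof. by move=> su; rewrite -scaleN1r metricZl// mulN1r. Qed.

Lemma metricNr u v w : slit u -> g u v (- w) = - g u v w.
Proof. by move=> su; rewrite !(metric_sym v)//; exact: metricNl. Qed.

Lemma metric0l u v w : slit u -> v = 0 -> g u v w = 0.
Proof.
by move=> su ->; have := metricZl 0 0 w su; rewrite scale0r mul0r.
Qed.

Lemma metric0r u v w : slit u -> w = 0 -> g u v w = 0.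
Proof. by move=> su w0; rewrite metric_sym//; exact: metric0l. Qed.

Lemma metric_smooth_fibre u v w : slit u ->
  smooth_near (fun y => g (u.1, y) v w) u.2.
Proof.
move=> su; apply: smooth_nearM (smooth_near_cst _ _) _.
exact: smooth_near_derive (smooth_near_derive w (sE su)).
Qed.

(** The derivative of the metric along the fibre: twice the Cartan tensor. *)
Definition cartan_tensor u x v w : R := 'D_x (fun y => g (u.1, y) v w) u.2.

(** Up to a factor this is a third derivative of the energy along the fibre. *)
Lemma cartan_tensorC u x v w : slit u ->
  cartan_tensor u x v w = cartan_tensor u v x w.
Proof.
move=> su; rewrite /cartan_tensor /g /finsler_metric.
have sw := smooth_near_derive w (sE su).
have d v' := smooth_near_diff (smooth_near_derive v' sw).
apply: etrans (deriveMcst 2^-1 x (d v)) _.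
apply: etrans _ (esym (deriveMcst 2^-1 v (d x))).
apply: (@f_equal R R (fun t => 2^-1 * t)); exact: smooth_near_Schwarz v x sw.
Qed.

Lemma cartan_tensor_sym u x v w : slit u ->
  cartan_tensor u x v w = cartan_tensor u x w v.
Proof.
move=> su; apply: near_eq_derive; apply: filterS (slit_fibre su) => y sy.
exact: metric_sym.
Qed.

(** The Hessian in the definition of the metric is taken in fixed directions. To
   express it by Lie derivatives along [gamma sigma] and [gamma tau], the term
   coming from the variation of [tau] is subtracted. *)
Lemma metric_smooth sigma tau : smooth_pi_field sigma -> smooth_pi_field tau ->
  smooth_on_slit (fun u => g u (sigma u) (tau u)).
Proof.
move=> ss st.
have sg := gamma_smooth ss; have st' := gamma_smooth st.
have sd := gamma_smooth (fibre_derive_smooth ss st).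
have H1 := lie_smooth sg (lie_smooth st' energy_smooth).
have H2 := lie_smooth sd energy_smooth.
have H3 := smooth_on_slitM (smooth_on_slit_cst (M := M) (- 1 : R)) H2.
have H4 := smooth_on_slitM (smooth_on_slit_cst (M := M) (2^-1 : R)) (smooth_on_slitD H1 H3).
apply: eq_smooth_on_slit H4 => -[p y0] su.
have e1 : lie (gamma sigma) (lie (gamma tau) (fun u => L u ^+ 2)) (p, y0) =
    'D_(sigma (p, y0)) (fun y => 'D_(tau (p, y)) (E p) y) y0.
  have e y : lie (gamma tau) (fun u => L u ^+ 2) (p, y) =
      'D_(tau (p, y)) (E p) y by exact: lie_gamma.
  by apply: etrans (lie_gamma _ _ _) _; apply: eq_derive => y; exact: e.
have e2 := lie_gamma (fun u => L u ^+ 2) (fibre_derive sigma tau) (p, y0).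
have stu := psmooth_fibre ((smooth_pi_fieldP _).1 st _ su).
have e3 := derive_dir (sigma (p, y0)) (sE su) stu.
have solve (A B P Q S : R) : A = P -> B = Q -> P = Q + S ->
    2^-1 * (A + -1 * B) = 2^-1 * S.
  by move=> -> -> ->; rewrite mulN1r addrAC subrr add0r.
exact: solve e1 e2 e3.
Qed.

Lemma lie_gamma_metric x sigma tau u : slit u -> smooth_pi_field sigma ->
  smooth_pi_field tau ->
  'D_x (fun y => g (u.1, y) (sigma (u.1, y)) (tau (u.1, y))) u.2 =
  cartan_tensor u x (sigma u) (tau u) +
  g u ('D_x (fun y => sigma (u.1, y)) u.2) (tau u) +
  g u (sigma u) ('D_x (fun y => tau (u.1, y)) u.2).
Proof.
case: u => p y0 su /smooth_pi_fieldP ss /smooth_pi_fieldP st /=.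
have sf := psmooth_fibre (ss _ su); have tf := psmooth_fibre (st _ su).
rewrite /= in sf tf.
have ns := slit_fibre su; rewrite /= in ns.
have sr v : smooth_near (fun y => g (p, y) v (tau (p, y)) : R^o) y0.
  apply: (derive_pairing (l := fun y w => g (p, y) v w : R^o) _ _ tf).1.
    by apply: filterS ns => y sy; exact: metric_linearr.
  by move=> w; exact: (@metric_smooth_fibre (p, y0)).
have [_ H1] := derive_pairing (l := fun y v => g (p, y) v (tau (p, y)) : R^o)
  (filterS (fun y sy => metric_linearl (tau (p, y)) sy) ns) sr sf.
have [_ H2] := derive_pairing (l := fun y w => g (p, y) (sigma (p, y0)) w : R^o)
  (filterS (fun y sy => metric_linearr (sigma (p, y0)) sy) ns)
  (fun w => @metric_smooth_fibre (p, y0) (sigma (p, y0)) w su) tf.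
rewrite (H1 x) (H2 x) /cartan_tensor /=.
by rewrite addrC -addrA addrC -!addrA; congr (_ + _); rewrite addrC.
Qed.

Lemma metric_homog u v w (t : R) : slit u -> 0 < t ->
  (forall u t, 0 < t -> L (u.1, t *: u.2) = t * L u) ->
  g (u.1, t *: u.2) v w = g u v w.
Proof.
case: u => p y su t0 hL /=.
have st : slit ((p, t *: y) : TM M).
  by rewrite /slit /= scaler_eq0 negb_or gt_eqF.
have hE z : E p (t *: z) = t ^+ 2 * E p z.
  by rewrite /E (hL (p, z)) // exprMn.
have tn0 := lt0r_neq0 t0.
have dE z (sz : slit ((p, z) : TM M)) : differentiable (E p) z.
  exact: smooth_near_diff (sE sz).
have dD z (sz : slit ((p, z) : TM M)) : differentiable (fun y => 'D_w (E p) y) z.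
  exact: smooth_near_diff (smooth_near_derive w (sE sz)).
have h1 : \forall z \near y, 'D_w (E p) (t *: z) = t * 'D_w (E p) z.
  apply: filterS (slit_fibre su) => z sz.
  have stz : slit ((p, t *: z) : TM M).
    by rewrite /slit /= scaler_eq0 negb_or gt_eqF.
  have nE : \forall z' \near z, E p (t *: z') = t ^+ 2 * E p z'.
    by apply: filterS (slit_fibre sz) => z' _; exact: hE.
  have := derive_homog w (dE _ sz) (dE _ stz) nE.
  by rewrite expr2 -mulrA => /(mulfI tn0).
have := derive_homog v (dD _ su) (dD _ st) h1.
by move=> /(mulfI tn0) H; apply: (@f_equal R R (fun t => 2^-1 * t)); exact: H.
Qed.

End Metric.

(** * Linear connections on the pullback bundle *)

Section Connection.
Context {R : realType} {n : nat} (M : manifold R n).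
Variable D : connection_op M.
Hypothesis DC : is_connection D.
Implicit Types (u : TM M) (X Y Z : vfield M) (sigma tau : pi_field M).

Local Opaque lie bracket rho.

Let one : TM M -> R := fun u => (u.2 != 0)%:R.

Let one_smooth : smooth_on_slit one.
Proof.
apply: eq_smooth_on_slit (smooth_on_slit_cst (M := M) (1 : R)) => u su.
by rewrite /one su.
Qed.

(** Multiplication by the indicator function of nonzero vectors, which is
   smooth there, shows that a connection ignores the zero vectors. *)
Lemma conn_eqr X sigma tau u : smooth_vfield X -> smooth_pi_field sigma ->
  (forall u, slit u -> sigma u = tau u) -> slit u -> D X sigma u = D X tau u.
Proof.
move=> sX ss st su; have stau := eq_smooth_pi_field st ss.
have E s : smooth_pi_field s -> D X s u = D X (fun u => one u *: s u) u.
  move=> hs; rewrite (conn_leibniz DC one_smooth sX hs su).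
  have -> : lie X one u = 0.
    have e : tnbhs u (fun u' => one u' = 1).
      by apply: (tnbhsS _ (tnbhs_slit su)) => u' su'; rewrite /one su'.
    by rewrite (eq_lie X e) lie_cst.
  by rewrite scale0r add0r /one su scale1r.
rewrite (E _ ss) (E _ stau); congr (D X _ u); apply/funext => u'.
rewrite /one; case: (boolP (u'.2 != 0)) => [su'|_]; last by rewrite !scale0r.
by rewrite st.
Qed.

Lemma conn_eql X Y sigma u : smooth_vfield X -> smooth_pi_field sigma ->
  (forall u, slit u -> X u = Y u) -> slit u -> D X sigma u = D Y sigma u.
Proof.
move=> sX ss XY su; have sY := eq_smooth_vfield XY sX.
have E Z : smooth_vfield Z -> D Z sigma u = D (fun u => one u *: Z u) sigma u.
  by move=> sZ; rewrite (conn_scalel DC one_smooth sZ ss su) /one su scale1r.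
rewrite (E _ sX) (E _ sY); congr (D _ sigma u); apply/funext => u'.
rewrite /one; case: (boolP (u'.2 != 0)) => [su'|_]; last by rewrite !scale0r.
by rewrite XY.
Qed.

Lemma conn0r X sigma u : smooth_vfield X ->
  (forall u, slit u -> sigma u = 0) -> slit u -> D X sigma u = 0.
Proof.
move=> sX s0 su.
have ss : smooth_pi_field (fun _ : TM M => 0 : 'rV[R]_n).
  have se := eta_smooth (M := M).
  by apply: (eq_smooth_pi_field _ (smooth_pi_fieldB se se)) => u' _; exact: subrr.
rewrite -(conn_eqr sX ss (fun u su => esym (s0 u su)) su).
have := conn_addr DC sX ss ss su.
rewrite (_ : (fun _ => 0 + 0) = (fun _ => 0)); last by apply/funext => u'; rewrite addr0.
by move=> /(congr1 (fun v => v - D X (fun _ => 0) u)); rewrite subrr addrK.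
Qed.

Lemma connNr X sigma u : smooth_vfield X -> smooth_pi_field sigma -> slit u ->
  D X (fun u => - sigma u) u = - D X sigma u.
Proof.
move=> sX ss su; apply/eqP; rewrite -addr_eq0; apply/eqP.
rewrite -(conn_addr DC sX (smooth_pi_fieldN ss) ss su).
by apply: conn0r => // u' _; rewrite addNr.
Qed.

Lemma connNl X sigma u : smooth_vfield X -> smooth_pi_field sigma -> slit u ->
  D (fun u => - X u) sigma u = - D X sigma u.
Proof.
move=> sX ss su.
have := conn_scalel DC (smooth_on_slit_cst (M := M) (-1 : R)) sX ss su.
rewrite scaleN1r => <-; congr (D _ _ u); apply/funext => u'.
by rewrite scaleN1r.
Qed.

Lemma smooth_vfieldN X : smooth_vfield X -> smooth_vfield (fun u => - X u).
Proof.
move=> /smooth_vfieldP sX; apply/smooth_vfieldP => u su.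
have cu := tsmooth_chart (chart_at_charts u.1) (chart_at_dom u.1).
have s2 := smooth_nearN (sX u su).
apply: (eq_tsmooth _ s2); apply: (tnbhsS _ (tsmooth_tnbhs cu)) => u' s'.
have E w : derive_along (tchart_at u) u' (- w) = - derive_along (tchart_at u) u' w.
  by rewrite !derive_along_diff// linearN.
exact: esym (E _).
Qed.

Lemma rhoD X Y u : rho (fun u => X u + Y u) u = rho X u + rho Y u.
Proof. by rewrite !rhoE linearD. Qed.

Lemma rhoN X u : rho (fun u => - X u) u = - rho X u.
Proof. by rewrite !rhoE linearN. Qed.

Lemma eq_rho X Y u : X u = Y u -> rho X u = rho Y u.
Proof. by rewrite !rhoE => ->. Qed.

Lemma torsionC X Y u : torsion D X Y u = - torsion D Y X u.
Proof.
have e1 := eq_rho (Y := fun u => - bracket Y X u) (bracketC X Y u).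
have e2 := rhoN (bracket Y X) u.
have solve (a b c d : 'rV[R]_n) : c = - d -> a - b - c = - (b - a - d).
  by move=> ->; apply/rowP => j; rewrite !mxE; ring.
exact: solve (etrans e1 e2).
Qed.

Lemma eq_torsion X Y Z u : smooth_vfield X -> smooth_vfield Z -> slit u ->
  (forall u, slit u -> X u = Y u) -> torsion D X Z u = torsion D Y Z u.
Proof.
move=> sX sZ su XY; rewrite /torsion.
rewrite -> (conn_eql sX (rho_smooth sZ) XY su).
rewrite -> (conn_eqr sZ (rho_smooth sX) (fun u su => eq_rho (XY u su)) su).
rewrite -> (eq_rho (eq_bracket Z su XY)).
exact: erefl.
Qed.

Lemma torsionDl X X' Y u : smooth_vfield X -> smooth_vfield X' ->
  smooth_vfield Y -> slit u ->
  torsion D (fun u => X u + X' u) Y u = torsion D X Y u + torsion D X' Y u.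
Proof.
move=> sX sX' sY su; rewrite /torsion.
rewrite -> (conn_addl DC sX sX' (rho_smooth sY) su).
rewrite -> (conn_eqr sY (rho_smooth (smooth_vfieldD sX sX')) (fun u _ => rhoD X X' u) su).
rewrite -> (conn_addr DC sY (rho_smooth sX) (rho_smooth sX') su).
rewrite -> (eq_rho (Y := fun u => bracket X Y u + bracket X' Y u) (bracketDl su sX sX' sY)).
rewrite -> rhoD.
have solve (a b c d p q : 'rV[R]_n) :
    a + b - (c + d) - (p + q) = (a - c - p) + (b - d - q).
  by apply/rowP => j; rewrite !mxE; ring.
exact: solve.
Qed.

Lemma eq_curvature X Y Z sigma u : smooth_vfield X -> smooth_vfield Z ->
  smooth_pi_field sigma -> slit u -> (forall u, slit u -> X u = Y u) ->
  curvature D X Z sigma u = curvature D Y Z sigma u.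
Proof.
move=> sX sZ ss su XY; rewrite /curvature.
rewrite -> (conn_eql sX (conn_smooth DC sZ ss) XY su).
rewrite -> (conn_eqr sZ (conn_smooth DC sX ss) (fun u => conn_eql sX ss XY (u := u)) su).
rewrite -> (conn_eql (bracket_smooth sX sZ) ss (fun u su => eq_bracket Z su XY) su).
exact: erefl.
Qed.

Lemma curvatureDl X X' Y sigma u : smooth_vfield X -> smooth_vfield X' ->
  smooth_vfield Y -> smooth_pi_field sigma -> slit u ->
  curvature D (fun u => X u + X' u) Y sigma u =
  curvature D X Y sigma u + curvature D X' Y sigma u.
Proof.
move=> sX sX' sY ss su; rewrite /curvature.
rewrite -> (conn_addl DC sX sX' (conn_smooth DC sY ss) su).
rewrite -> (conn_eqr sY (conn_smooth DC (smooth_vfieldD sX sX') ss)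
  (fun u => conn_addl DC sX sX' ss (u := u)) su).
rewrite -> (conn_addr DC sY (conn_smooth DC sX ss) (conn_smooth DC sX' ss) su).
rewrite -> (conn_eql (bracket_smooth (smooth_vfieldD sX sX') sY) ss
  (fun u su => bracketDl su sX sX' sY) su).
rewrite -> (conn_addl DC (bracket_smooth sX sY) (bracket_smooth sX' sY) ss su).
have solve (a b c d p q : 'rV[R]_n) :
    - (a + b) + (c + d) + (p + q) = (- a + c + p) + (- b + d + q).
  by apply/rowP => j; rewrite !mxE; ring.
exact: solve.
Qed.

Lemma curvatureC X Y sigma u : smooth_vfield X -> smooth_vfield Y ->
  smooth_pi_field sigma -> slit u ->
  curvature D X Y sigma u = - curvature D Y X sigma u.
Proof.
move=> sX sY ss su; rewrite /curvature.
rewrite -> (conn_eql (bracket_smooth sX sY) ss (fun u _ => bracketC X Y u) su).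
rewrite -> (connNl (bracket_smooth sY sX) ss su).
have solve (a b c : 'rV[R]_n) : - a + b + - c = - (- b + a + c).
  by apply/rowP => j; rewrite !mxE; ring.
exact: solve.
Qed.

(** Differentiating the equation [D Y (rho Z) - D Z (rho Y) = rho (bracket Y Z)]
   along [X] and summing cyclically leaves the Jacobi identity. *)
Lemma bianchi X Y Z u : smooth_vfield X -> smooth_vfield Y -> smooth_vfield Z ->
  (forall X Y u, smooth_vfield X -> smooth_vfield Y -> slit u ->
     torsion D X Y u = 0) -> slit u ->
  curvature D X Y (rho Z) u + curvature D Y Z (rho X) u +
  curvature D Z X (rho Y) u = 0.
Proof.
move=> sX sY sZ T0 su.
have B U V u' : smooth_vfield U -> smooth_vfield V -> slit u' ->
    D U (rho V) u' - D V (rho U) u' = rho (bracket U V) u'.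
  by move=> sU sV su'; apply/eqP; rewrite -subr_eq0; apply/eqP; exact: T0.
have S U V W : smooth_vfield U -> smooth_vfield V -> smooth_vfield W ->
    D U (D V (rho W)) u - D U (D W (rho V)) u =
    D (bracket V W) (rho U) u + rho (bracket U (bracket V W)) u.
  move=> sU sV sW; have sVW := bracket_smooth sV sW.
  have sr := rho_smooth sV; have sr' := rho_smooth sW.
  rewrite <- (B U (bracket V W) u sU sVW su).
  rewrite <- (conn_eqr sU (smooth_pi_fieldB (conn_smooth DC sV sr') (conn_smooth DC sW sr))
    (fun u' su' => B V W u' sV sW su') su).
  rewrite -> (conn_addr DC sU (conn_smooth DC sV sr')
    (smooth_pi_fieldN (conn_smooth DC sW sr)) su).
  rewrite -> (connNr sU (conn_smooth DC sW sr) su).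
  have solve (a p : 'rV[R]_n) : a = p + (a - p) by rewrite [RHS]addrC subrK.
  exact: solve.
have := rho_jacobi su sX sY sZ.
move: (S X Y Z sX sY sZ) (S Y Z X sY sZ sX) (S Z X Y sZ sX sY).
rewrite /curvature.
have cyclic (a1 a2 a3 a4 a5 a6 b1 b2 b3 r1 r2 r3 : 'rV[R]_n) :
    a1 - a2 = b1 + r1 -> a3 - a4 = b2 + r2 -> a5 - a6 = b3 + r3 ->
    r1 + r2 + r3 = 0 ->
    (- a1 + a4 + b3) + (- a3 + a6 + b1) + (- a5 + a2 + b2) = 0.
  move=> /(canRL (subrK _)) -> /(canRL (subrK _)) -> /(canRL (subrK _)) -> r0.
  rewrite -[RHS]oppr0 -r0; apply/rowP => j; rewrite !mxE; ring.
exact: cyclic.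
Qed.

End Connection.

(** * Cartan connections *)

Section Cartan.
Context {R : realType} {n : nat} (M : manifold R n).
Variables (L : TM M -> R) (nabla : connection_op M).
Variable beta : pi_field M -> vfield M.
Hypothesis energy_smooth : smooth_on_slit (fun u => L u ^+ 2).
Hypothesis posdef : forall u, slit u -> forall v, v != 0 ->
  0 < finsler_metric L u v v.
Hypothesis HC : is_cartan L nabla beta.
Implicit Types (u : TM M) (X Y Z : vfield M) (sigma tau upsilon : pi_field M).

Local Opaque lie bracket rho.

Let g := finsler_metric L.
Let DC := cartan_connection HC.
Let T := hv_torsion nabla beta.

Lemma metric_nondeg u v : slit u -> (forall w, g u v w = 0) -> v = 0.
Proof.
move=> su gv; apply/eqP; apply: contrapT => /negP v0.
by have := posdef su v0; rewrite -/g gv ltxx.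
Qed.

Let sbeta sigma : smooth_pi_field sigma -> smooth_vfield (beta sigma).
Proof. by move=> ss; case: (cartan_horizontal HC ss). Qed.

Let rho_beta sigma u : smooth_pi_field sigma -> slit u ->
  rho (beta sigma) u = sigma u.
Proof. by move=> ss su; case: (cartan_horizontal HC ss) => _ /(_ u su)[]. Qed.

Lemma horizontal_vertical X : smooth_vfield X ->
  exists2 sigma, smooth_pi_field sigma &
    forall u, slit u -> X u = beta (rho X) u + gamma sigma u.
Proof.
move=> sX; have sr := rho_smooth sX; have sb := sbeta sr.
have sV := smooth_vfieldD sX (smooth_vfieldN sb).
have [|sigma ss sE] := vertical_gamma sV.
  move=> u su; rewrite -> (rhoD X (fun u => - beta (rho X) u) u).
  rewrite -> (rhoN (beta (rho X)) u), (rho_beta sr su).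
  exact: subrr.
by exists sigma => // u su; rewrite -sE// addrC subrK.
Qed.

(** The bracket of [gamma sigma] with a lift of [tau] projects to the derivative
   of the components of [tau] along the fibre. *)
Lemma hv_torsionE sigma tau u : smooth_pi_field sigma -> smooth_pi_field tau ->
  slit u -> T sigma tau u = nabla (gamma sigma) tau u - fibre_derive sigma tau u.
Proof.
move=> ss st su.
have sg := gamma_smooth ss; have sb := sbeta st.
have e1 := conn_eqr DC sg (rho_smooth sb) (fun u su => rho_beta st su) su.
have e2 := conn0r DC sb (fun u _ => rho_gamma sigma u) su.
have e3 := rho_bracket_gamma su ss sb (fun u su => rho_beta st su).
rewrite /T /hv_torsion /torsion.
rewrite -> e1, e2, e3.
by rewrite subr0.
Qed.

Lemma hv_torsion_smooth sigma tau : smooth_pi_field sigma ->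
  smooth_pi_field tau -> smooth_pi_field (T sigma tau).
Proof.
move=> ss st; have sg := gamma_smooth ss; have sb := sbeta st.
apply: smooth_pi_fieldB (rho_smooth (bracket_smooth sg sb)).
exact: smooth_pi_fieldB (conn_smooth DC sg (rho_smooth sb))
  (conn_smooth DC sb (rho_smooth sg)).
Qed.

(** Metricity along the fibres, where the bracket terms of the torsion are
   derivatives of components; the symmetry axiom of the (h)hv-torsion then
   isolates it, as in the Koszul formula. *)
Lemma hv_torsion_metric sigma tau upsilon u : smooth_pi_field sigma ->
  smooth_pi_field tau -> smooth_pi_field upsilon -> slit u ->
  2 * g u (T sigma tau u) (upsilon u) =
  cartan_tensor L u (sigma u) (tau u) (upsilon u).
Proof.
have solve (a b a' d d' c : R) : a = b -> b = a' ->
    a + d + (a' + d') = c + d + d' -> 2 * a = c.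
  by move=> -> -> e; lra.
move=> ss st sup su.
have sg := gamma_smooth ss.
have m := cartan_metric HC sg st sup su.
have l := lie_gamma (fun u => g u (tau u) (upsilon u)) sigma u.
have f := lie_gamma_metric energy_smooth (sigma u) su st sup.
have t1 := hv_torsionE ss st su; have t2 := hv_torsionE ss sup su.
have sym := cartan_hv_torsion HC ss st sup su.
have n1 : nabla (gamma sigma) tau u = T sigma tau u + fibre_derive sigma tau u.
  by rewrite t1 subrK.
have n2 : nabla (gamma sigma) upsilon u =
    T sigma upsilon u + fibre_derive sigma upsilon u by rewrite t2 subrK.
rewrite -> n1, n2 in m.
rewrite -> (metricDl energy_smooth (T sigma tau u) (fibre_derive sigma tau u)
  (upsilon u) su) in m.
rewrite -> (metricDr energy_smooth (tau u) (T sigma upsilon u)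
  (fibre_derive sigma upsilon u) su) in m.
have e := etrans (esym (etrans (esym l) m)) f.
have sym' := metric_sym energy_smooth (T sigma upsilon u) (tau u) su.
exact: solve sym sym' e.
Qed.

(** By metricity the function [g sigma tau] can be differentiated twice in terms
   of the connection; its commutator is the derivative along the bracket. *)
Lemma curvature_metric X Y sigma tau u : smooth_vfield X -> smooth_vfield Y ->
  smooth_pi_field sigma -> smooth_pi_field tau -> slit u ->
  g u (curvature nabla X Y sigma u) (tau u) =
  - g u (sigma u) (curvature nabla X Y tau u).
Proof.
have solve (x y l1 l2 lb a1 a2 a3 a4 b1 b2 b3 b4 c1 c2 : R) :
    x = - a1 + b1 + c1 -> y = - a4 + b4 + c2 ->
    lb = l1 - l2 -> lb = c1 + c2 -> l1 = a1 + a2 + (a3 + a4) ->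
    l2 = b1 + b2 + (b3 + b4) -> a2 = b3 -> a3 = b2 -> x = - y by lra.
move=> sX sY ss st su.
have gl p q r w : g u (- p + q + r) w = - g u p w + g u q w + g u r w.
  by rewrite /g !(metricDl energy_smooth _ _ _ su) (metricNl energy_smooth _ _ su).
have gr p q r w : g u w (- p + q + r) = - g u w p + g u w q + g u w r.
  by rewrite /g !(metricDr energy_smooth _ _ _ su) (metricNr energy_smooth _ _ su).
pose h u := g u (sigma u) (tau u).
have sh : smooth_on_slit h by exact: metric_smooth.
have sh' := (smooth_on_slitP h).1 sh u su.
have second U V : smooth_vfield U -> smooth_vfield V ->
    (lie U (lie V h) u : R) =
    g u (nabla U (nabla V sigma) u) (tau u) +
    g u (nabla V sigma u) (nabla U tau u) +
    (g u (nabla U sigma u) (nabla V tau u) +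
     g u (sigma u) (nabla U (nabla V tau) u)).
  move=> sU sV; have sVs := conn_smooth DC sV ss; have sVt := conn_smooth DC sV st.
  have e := tnbhsS (fun u' su' => cartan_metric HC sV ss st su') (tnbhs_slit su).
  have s1 := (smooth_on_slitP _).1 (metric_smooth energy_smooth sVs st) u su.
  have s2 := (smooth_on_slitP _).1 (metric_smooth energy_smooth ss sVt) u su.
  have l := lieD U s1 s2.
  apply: etrans (eq_lie U e) _; apply: etrans l _.
  have m1 := cartan_metric HC sU sVs st su.
  have m2 := cartan_metric HC sU ss sVt su.
  rewrite -> m1, m2; exact: erefl.
have m := cartan_metric HC (bracket_smooth sX sY) ss st su.
have sX' := (smooth_vfieldP X).1 sX u su; have sY' := (smooth_vfieldP Y).1 sY u su.
have b := lie_bracket_R sX' sY' sh'.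
have s1 := second X Y sX sY; have s2 := second Y X sY sX.
have e1 := gl (nabla X (nabla Y sigma) u) (nabla Y (nabla X sigma) u)
  (nabla (bracket X Y) sigma u) (tau u).
have e2 := gr (nabla X (nabla Y tau) u) (nabla Y (nabla X tau) u)
  (nabla (bracket X Y) tau u) (sigma u).
exact: solve e1 e2 b m s1 s2 erefl erefl.
Qed.

Lemma torsion_gamma2 sigma tau u : smooth_pi_field sigma ->
  smooth_pi_field tau -> slit u -> torsion nabla (gamma sigma) (gamma tau) u = 0.
Proof.
move=> ss st su; have sg := gamma_smooth ss; have sg' := gamma_smooth st.
have e1 := conn0r DC sg (fun u _ => rho_gamma tau u) su.
have e2 := conn0r DC sg' (fun u _ => rho_gamma sigma u) su.
have e3 := rho_bracket_gamma2 su ss st.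
rewrite /torsion; rewrite -> e1, e2, e3.
by rewrite !subr0.
Qed.

Lemma hv_torsion_eq0 sigma tau u :
  (forall v w z u, slit u -> cartan_tensor L u v w z = 0) ->
  smooth_pi_field sigma -> smooth_pi_field tau -> slit u -> T sigma tau u = 0.
Proof.
have half0 (a b : R) : 2 * a = b -> b = 0 -> a = 0.
  by move=> <- /eqP; rewrite mulf_eq0 pnatr_eq0 /= => /eqP.
move=> c0 ss st su; apply: (metric_nondeg su) => w.
have [ups sup uE] := fibre_constant_section u.1 w.
have uw : ups u = w by rewrite -(uE u.2); case: (u).
have := half0 _ _ (hv_torsion_metric ss st sup su) (c0 _ _ _ _ su).
rewrite -> uw; exact.
Qed.

Section TorsionFree.
Hypothesis T0 : forall sigma tau u, smooth_pi_field sigma ->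
  smooth_pi_field tau -> slit u -> T sigma tau u = 0.

(** On two horizontal, a horizontal and a vertical, and two vertical arguments
   the torsion vanishes by the axioms, by [T0], and by [torsion_gamma2]. *)
Lemma torsion_free X Y u : smooth_vfield X -> smooth_vfield Y -> slit u ->
  torsion nabla X Y u = 0.
Proof.
move=> sX sY su.
have [sigma ss XE] := horizontal_vertical sX.
have [tau st YE] := horizontal_vertical sY.
have sa := rho_smooth sX; have sb := rho_smooth sY.
have sba := sbeta sa; have sbb := sbeta sb.
have sgs := gamma_smooth ss; have sgt := gamma_smooth st.
have split Z : smooth_vfield Z ->
    torsion nabla (beta (rho Y)) Z u = 0 -> torsion nabla (gamma tau) Z u = 0 ->
    torsion nabla Z Y u = 0.
  move=> sZ t1 t2; rewrite -> (torsionC nabla Z Y u).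
  rewrite -> (eq_torsion DC sY sZ su YE).
  rewrite -> (torsionDl DC sbb sgt sZ su).
  rewrite -> t1, t2; by rewrite addr0 oppr0.
rewrite -> (eq_torsion DC sX sY su XE).
rewrite -> (torsionDl DC sba sgs sY su).
have e1 : torsion nabla (beta (rho X)) Y u = 0.
  exact: split sba (cartan_h_torsion HC sb sa su) (T0 st sa su).
have e2 : torsion nabla (gamma sigma) Y u = 0.
  have t : torsion nabla (beta (rho Y)) (gamma sigma) u = 0.
    have t := T0 ss sb su; rewrite /T /hv_torsion in t.
    by rewrite -> torsionC; rewrite -> t; rewrite oppr0.
  exact: split sgs t (torsion_gamma2 st ss su).
rewrite -> e1, e2; exact: addr0.
Qed.

Lemma eq_curvature_section X Y sigma tau u : smooth_vfield X ->
  smooth_vfield Y -> smooth_pi_field sigma ->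
  (forall u, slit u -> sigma u = tau u) -> slit u ->
  curvature nabla X Y sigma u = curvature nabla X Y tau u.
Proof.
move=> sX sY ss st su; rewrite /curvature.
have eX u' su' : nabla X sigma u' = nabla X tau u' := conn_eqr DC sX ss st su'.
have eY u' su' : nabla Y sigma u' = nabla Y tau u' := conn_eqr DC sY ss st su'.
rewrite -> (conn_eqr DC sX (conn_smooth DC sY ss) eY su).
rewrite -> (conn_eqr DC sY (conn_smooth DC sX ss) eX su).
rewrite -> (conn_eqr DC (bracket_smooth sX sY) ss st su).
exact: erefl.
Qed.

Lemma curvature0 X Y sigma u : smooth_vfield X -> smooth_vfield Y ->
  smooth_pi_field sigma -> (forall u, slit u -> sigma u = 0) -> slit u ->
  curvature nabla X Y sigma u = 0.
Proof.
move=> sX sY ss s0 su; rewrite /curvature.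
rewrite -> (conn0r DC sX (fun u su => conn0r DC sY s0 su) su).
rewrite -> (conn0r DC sY (fun u su => conn0r DC sX s0 su) su).
rewrite -> (conn0r DC (bracket_smooth sX sY) s0 su).
by rewrite oppr0 !addr0.
Qed.

(** For a vertical vector [V] the Bianchi identity makes the curvature [K V Y Z]
   symmetric in [Y] and [Z], whereas [g (K V Y Z) W] is skew in [Z] and [W]. *)
Lemma vertical_curvature sigma Y upsilon u : smooth_pi_field sigma ->
  smooth_vfield Y -> smooth_pi_field upsilon -> slit u ->
  curvature nabla (gamma sigma) Y upsilon u = 0.
Proof.
have solve (p q r : R) : p = - q -> q = - r -> r = - p -> p = 0 by lra.
move=> ss sY sup su; have sV := gamma_smooth ss.
have swap Z tau : smooth_vfield Z -> smooth_pi_field tau ->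
    curvature nabla (gamma sigma) Z tau u =
    curvature nabla (gamma sigma) (beta tau) (rho Z) u.
  move=> sZ st; have sb := sbeta st.
  have B := bianchi DC sV sZ sb torsion_free su.
  have e1 := eq_curvature_section sV sZ (rho_smooth sb)
    (fun u su => rho_beta st su) su.
  have e2 := curvature0 sZ sb (rho_smooth sV) (fun u _ => rho_gamma sigma u) su.
  have e3 := curvatureC DC sb sV (rho_smooth sZ) su.
  rewrite -> e1, e2, e3 in B.
  by move/eqP: B; rewrite addr0 subr_eq0 => /eqP.
rewrite -> (swap Y upsilon sY sup).
have sr := rho_smooth sY.
have hor a b : smooth_pi_field a -> smooth_pi_field b ->
    curvature nabla (gamma sigma) (beta a) b u =
    curvature nabla (gamma sigma) (beta b) a u.
  move=> sa sb; rewrite -> (swap (beta a) b (sbeta sa) sb).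
  exact: eq_curvature_section sV (sbeta sb) (rho_smooth (sbeta sa))
    (fun u su => rho_beta sa su) su.
have form a b c : smooth_pi_field a -> smooth_pi_field b -> smooth_pi_field c ->
    g u (curvature nabla (gamma sigma) (beta a) b u) (c u) = 0.
  have skew a' b' c' : smooth_pi_field a' -> smooth_pi_field b' -> smooth_pi_field c' ->
      g u (curvature nabla (gamma sigma) (beta a') b' u) (c' u) =
      - g u (curvature nabla (gamma sigma) (beta a') c' u) (b' u).
    move=> sa sb sc; rewrite -> (curvature_metric sV (sbeta sa) sb sc su).
    apply: (@f_equal R R -%R).
    exact: (metric_sym energy_smooth (b' u) _ su).
  move=> sa sb sc.
  have h1 := skew a b c sa sb sc; have h2 := skew c a b sc sa sb.
  have h3 := skew b c a sb sc sa.
  rewrite -> (hor a c sa sc) in h1; rewrite -> (hor c b sc sb) in h2.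
  rewrite -> (hor b a sb sa) in h3.
  exact: solve h1 h2 h3.
apply: (metric_nondeg su) => w.
have [c sc cE] := fibre_constant_section u.1 w.
have -> : w = c u by rewrite -(cE u.2); case: (u).
exact: form.
Qed.

(** It follows that curvatures computed with different horizontal lifts agree. *)
Lemma eq_rho_curvature X X' Y upsilon u : smooth_vfield X ->
  smooth_vfield X' -> smooth_vfield Y -> smooth_pi_field upsilon ->
  (forall u, slit u -> rho X u = rho X' u) -> slit u ->
  curvature nabla X Y upsilon u = curvature nabla X' Y upsilon u.
Proof.
move=> sX sX' sY sup rX su.
have sV := smooth_vfieldD sX (smooth_vfieldN sX').
have [|sigma ss VE] := vertical_gamma sV.
  move=> v sv; rewrite -> (rhoD X (fun u => - X' u) v), (rhoN X' v), (rX v sv).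
  exact: subrr.
have XE v : slit v -> X v = X' v + gamma sigma v.
  by move=> sv; rewrite <- (VE v sv); rewrite addrC subrK.
rewrite -> (eq_curvature DC sX sY sup su XE).
rewrite -> (curvatureDl DC sX' (gamma_smooth ss) sY sup su).
rewrite -> (vertical_curvature ss sY sup su).
exact: addr0.
Qed.

Lemma chern_cartan X upsilon u : smooth_vfield X -> smooth_pi_field upsilon ->
  slit u -> chern nabla beta X upsilon u = nabla X upsilon u.
Proof.
move=> sX sup su; have sK := conn_smooth DC sX (eta_smooth (M := M)).
have sub0 (a b : 'rV[R]_n) : b = 0 -> a - b = a by move=> ->; rewrite subr0.
exact (sub0 _ _ (T0 sK sup su)).
Qed.

Lemma chern_curvature X Y upsilon u : smooth_vfield X -> smooth_vfield Y ->
  smooth_pi_field upsilon -> slit u ->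
  curvature (chern nabla beta) X Y upsilon u = curvature nabla X Y upsilon u.
Proof.
move=> sX sY sup su.
have twice Z Z' : smooth_vfield Z -> smooth_vfield Z' ->
    chern nabla beta Z (chern nabla beta Z' upsilon) u = nabla Z (nabla Z' upsilon) u.
  move=> sZ sZ'.
  have e v : slit v -> nabla Z' upsilon v = chern nabla beta Z' upsilon v.
    by move=> sv; exact (esym (chern_cartan sZ' sup sv)).
  have sN := conn_smooth DC sZ' sup.
  exact (etrans (chern_cartan sZ (eq_smooth_pi_field e sN) su)
    (esym (conn_eqr DC sZ sN e su))).
rewrite /curvature.
rewrite -> (twice X Y sX sY), (twice Y X sY sX).
rewrite -> (chern_cartan (bracket_smooth sX sY) sup su).
exact: erefl.
Qed.

End TorsionFree.
End Cartan.

(** * A concurrent section makes the Cartan tensor vanish *)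

Section FibreCalculus.
Context {R : realType}.
Implicit Types V : normedModType R.

Lemma differentiable_entry V m (f : V -> 'rV[R]_m) x j :
  differentiable f x -> differentiable (fun y => f y 0 j) x.
Proof.
move=> df; apply: (@differentiable_comp _ _ _ _ f (fun w : 'rV[R]_m => w 0 j)) => //.
exact: differentiable_coord.
Qed.

Lemma locally_constant V m (f : V -> 'rV[R]_m) y :
  (\forall z \near y, differentiable f z /\ forall v, 'D_v f z = 0) ->
  \forall z \near y, f z = f y.
Proof.
move=> /nbhs_ballP[r /= r0 H]; apply/nbhs_ballP; exists r => //= z yz.
have seg s : 0 <= s <= 1 -> ball y r (y + s *: (z - y)).
  move=> /andP[s0 s1]; rewrite -ball_normE /ball_ /= opprD addNKr normrN normrZ.
  rewrite ger0_norm//; move: yz; rewrite -ball_normE /ball_ /= distrC.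
  by apply: le_lt_trans; rewrite ler_piMl.
apply/rowP => j; apply/eqP; rewrite -subr_eq0; apply/eqP.
have [|s /seg s1] := @MVT_line _ _ (fun x => f x 0 j) y (z - y) 1 ltr01.
  by move=> s /seg/H[df _]; exact: differentiable_entry.
have [df D0] := H _ s1.
have yz1 : y + 1 *: (z - y) = z by rewrite scale1r addrC subrK.
by rewrite yz1 (derive_coord _ _ df) D0 mxE mulr0.
Qed.

Lemma constant_on_ray V (f : V -> R) p v :
  (forall s, 0 <= s -> differentiable f (p + s *: v) /\ 'D_v f (p + s *: v) = 0) ->
  forall t, 0 < t -> f (p + t *: v) = f p.
Proof.
move=> H t t0; apply/eqP; rewrite -subr_eq0; apply/eqP.
have [|s /andP[s0 _]] := @MVT_line _ _ f p v t t0.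
  by move=> s /andP[s0 _]; case: (H s s0).
by have [_ ->] := H s s0; rewrite mulr0.
Qed.

Lemma derive_zero_of_line V (f : V -> R) y v : differentiable f y ->
  (\forall t \near 0, f (y + t *: v) = f y) -> 'D_v f y = 0.
Proof.
move=> df fy.
have dl : differentiable f (y + 0 *: v) by rewrite scale0r addr0.
have := @derive_val _ _ _ _ _ _ _ (derive_line dl).
rewrite (near_eq_derive (1 : R) fy) derive_cst scale0r addr0; exact.
Qed.

Lemma line_continuous V (y v : V) (t : R) : {for t, continuous (fun s : R => y + s *: v)}.
Proof.
by apply: differentiable_continuous; apply: differentiableD.
Qed.

(** Let [h] be homogeneous of degree 0 and let [phi] be a locally constant
   vector field along which [h] is constant, both off the origin. A line in
   the direction [phi y] leads from [y] to infinity in the direction of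
   [phi y], so that homogeneity gives [h y = h (phi y)]; only the points
   proportional to [phi y] are missed by this argument, and they are reached
   by continuity. *)
Lemma homogeneous_invariant_derive m (h : 'rV[R]_m -> R)
    (phi : 'rV[R]_m -> 'rV[R]_m) (y v : 'rV[R]_m) :
  (forall z : 'rV[R]_m, z != 0 -> differentiable h z) ->
  (forall (z : 'rV[R]_m) (t : R), z != 0 -> 0 < t -> h (t *: z) = h z) ->
  (forall z : 'rV[R]_m, z != 0 -> differentiable phi z /\ forall w, 'D_w phi z = 0) ->
  (forall z : 'rV[R]_m, z != 0 -> 'D_(phi z) h z = 0) ->
  y != 0 -> phi y != 0 -> 'D_v h y = 0.
Proof.
move=> dh hom dphi inv y0 phi0.
pose z0 := phi y.
(* the points whose ray in the direction [z0] may meet the origin *)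
pose par (z : 'rV[R]_m) := exists s : R, z + s *: z0 = 0.
have near0 (z : 'rV[R]_m) : z != 0 -> \forall w \near z, w != 0.
  move=> zn0.
  by apply: (@cvgr_neq0 _ _ _ (nbhs z) _ id z).
have far (z : 'rV[R]_m) : phi z = z0 -> ~ par z -> h z = h z0.
  move=> phiz npar.
  have n0 (s : R) : z + s *: z0 != 0 by apply/eqP => e; apply: npar; exists s.
  have phic (s : R) : 0 <= s -> phi (z + s *: z0) = z0.
    rewrite le_eqVlt => /predU1P[<-|s0]; first by rewrite scale0r addr0.
    rewrite -phiz; apply/rowP => j.
    apply: (@constant_on_ray _ (fun w => phi w 0 j) z (phi z)) s0 => t t0.
    have [df D0] := dphi _ (n0 t); rewrite phiz.
    split; last by rewrite (derive_coord _ _ df) D0 mxE.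
    exact: differentiable_entry.
  have hc (t : R) : 0 < t -> h (z0 + t *: z) = h z.
    move=> t0; have ti : 0 < t^-1 by rewrite invr_gt0.
    rewrite addrC -(@constant_on_ray _ h z z0 _ _ ti); last first.
      move=> s s0; split; first exact: dh (n0 s).
      have e := inv _ (n0 s); rewrite -> (phic s s0) in e; exact: e.
    rewrite -[RHS](hom _ _ (n0 _) t0) scalerDr scalerA divff ?scale1r//.
    by rewrite gt_eqF.
  apply/eqP; apply: contrapT => /negP ne.
  have e0 : 0 < `|h z0 - h z| by rewrite normr_gt0 subr_eq0 eq_sym.
  have c1 := differentiable_continuous (dh _ phi0).
  have c2 : {for 0, continuous (fun t : R => h (z0 + t *: z))}.
    apply: (@continuous_comp _ _ _ (fun t : R => z0 + t *: z) h).
      exact: line_continuous.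
    by rewrite scale0r addr0.
  move/cvgrPdist_lt: c2 => /(_ _ e0) /nbhs_ballP[r /= r0 rH].
  have := rH (r / 2); rewrite -ball_normE /ball_ /= sub0r normrN.
  rewrite gtr0_norm ?divr_gt0// ltr_pdivrMr// ltr_pMr// ltr1n => /(_ isT).
  by rewrite scale0r addr0 hc ?divr_gt0// ltxx.
have [[a va]|npv] := pselect (exists a, v = a *: z0).
  by rewrite va (deriveE _ (dh _ y0)) linearZ -(deriveE _ (dh _ y0)) /= inv// scaler0.
have unique (t1 t2 : R) : par (y + t1 *: v) -> par (y + t2 *: v) -> t1 = t2.
  move=> [s1 e1] [s2 e2]; apply/eqP; apply: contrapT => /negP ne; apply: npv.
  have d0 : t1 - t2 != 0 by rewrite subr_eq0.
  exists ((s2 - s1) / (t1 - t2)).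
  have e : (t1 - t2) *: v = (s2 - s1) *: z0.
    have := etrans e1 (esym e2) => /(congr1 (fun w => w - y - s1 *: z0 - t2 *: v)).
    move=> H; apply/rowP => j; move/rowP: H => /(_ j); rewrite !mxE => H; lra.
  by rewrite mulrC -scalerA -e scalerA mulVf// scale1r.
have phin : \forall z \near y, phi z = z0.
  apply: locally_constant; apply: filterS (near0 y y0) => z zn0; exact: dphi.
have lc := @line_continuous _ y v 0.
have ylim : y + (0 : R) *: v = y by rewrite scale0r addr0.
rewrite /prop_for /continuous_at ylim in lc.
have phil : \forall t \near (0 : R), phi (y + t *: v) = z0 := lc _ phin.
have hl : {for 0, continuous (fun t : R => h (y + t *: v))}.
  apply: (@continuous_comp _ _ _ (fun t : R => y + t *: v) h).
    exact: line_continuous.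
  by rewrite ylim; exact: differentiable_continuous (dh _ y0).
have const : \forall t \near (0 : R), ~ par (y + t *: v) -> h (y + t *: v) = h z0.
  by apply: filterS phil => t; exact: far.
have nz : \forall t \near (0 : R), t <> 0 -> h (y + t *: v) = h z0.
  have [[t1 pt1]|np] := pselect (exists t1, par (y + t1 *: v)); last first.
    by apply: filterS const => t + _; apply => pt; apply: np; exists t.
  have [t10|t10] := eqVneq t1 0.
    apply: filterS const => t + tn0; apply => pt; apply: tn0.
    by rewrite -t10; exact: unique.
  have nt1 : \forall t \near (0 : R), t != t1.
    by apply: open_nbhs_nbhs; split; [exact: open_neq|rewrite /= eq_sym].
  apply: filterS2 const nt1 => t + /eqP tt1 _; apply => pt; apply: tt1.
  exact: unique.
have hy : h y = h z0.
  apply/eqP; apply: contrapT => /negP ne.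
  have e0 : 0 < `|h y - h z0| by rewrite normr_gt0 subr_eq0.
  move/cvgrPdist_lt: hl => /(_ _ e0); rewrite ylim => hl.
  have : \forall t \near (0 : R), `|h y - h (y + t *: v)| < `|h y - h z0| /\
      (t <> 0 -> h (y + t *: v) = h z0) by exact: filterI hl nz.
  move=> /nbhs_ballP[r /= r0 rH].
  have := rH (r / 2); rewrite -ball_normE /ball_ /= sub0r normrN.
  rewrite gtr0_norm ?divr_gt0// ltr_pdivrMr// ltr_pMr// ltr1n => /(_ isT)[+ Hr].
  by rewrite Hr ?ltxx//; apply/eqP; rewrite gt_eqF// divr_gt0.
apply: derive_zero_of_line; first exact: dh.
apply: filterS nz => t Ht; have [->|/eqP tn0] := eqVneq t 0; first by rewrite ylim.
by rewrite hy; exact: Ht.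
Qed.

End FibreCalculus.

Section Concurrent.
Context {R : realType} {n : nat} (M : manifold R n).
Variables (L : TM M -> R) (nabla : connection_op M).
Variables (beta : pi_field M -> vfield M) (zeta : pi_field M).
Hypothesis HL : is_finsler L.
Hypothesis HC : is_cartan L nabla beta.
Hypothesis Hzeta : is_concurrent nabla beta zeta.
Implicit Types (u : TM M) (X Y Z : vfield M) (sigma tau upsilon : pi_field M).

Local Opaque lie bracket rho.

Let g := finsler_metric L.
Let DC := cartan_connection HC.
Let T := hv_torsion nabla beta.
Let sz := concurrent_smooth Hzeta.

Lemma finsler_energy_smooth : smooth_on_slit (fun u => L u ^+ 2).
Proof.
have sL := finsler_smooth HL.
by apply: (eq_smooth_on_slit _ (smooth_on_slitM sL sL)) => u _; rewrite expr2.
Qed.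

Let sE := finsler_energy_smooth.

Let double0 (a b : R) : 2 * a = b -> a = 0 -> b = 0.
Proof. by move=> <- ->; rewrite mulr0. Qed.

Let half0 (a b : R) : 2 * a = b -> b = 0 -> a = 0.
Proof. by move=> <- /eqP; rewrite mulf_eq0 pnatr_eq0 /= => /eqP. Qed.

Lemma conn_concurrent X u : smooth_vfield X -> slit u ->
  nabla X zeta u = - rho X u.
Proof.
move=> sX su; have sr := rho_smooth sX.
have [sigma ss XE] := horizontal_vertical HC sX.
have sb : smooth_vfield (beta (rho X)) by case: (cartan_horizontal HC sr).
have sg := gamma_smooth ss.
rewrite -> (conn_eql DC sX sz XE su).
rewrite -> (conn_addl DC sb sg sz su).
rewrite -> (concurrent_horizontal Hzeta sr su).
rewrite -> (concurrent_vertical Hzeta ss su).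
exact: addr0.
Qed.

(** The mixed curvature sends [zeta] to minus the (h)hv-torsion, and it is skew. *)
Lemma hv_torsion_concurrent sigma tau u : smooth_pi_field sigma ->
  smooth_pi_field tau -> slit u -> g u (T sigma tau u) (zeta u) = 0.
Proof.
have half (a b : R) : - a = - - b -> b = a -> a = 0 by lra.
move=> ss st su.
have sg := gamma_smooth ss.
have [sb rb] := cartan_horizontal HC st.
have rho_b u' (su' : slit u') : rho (beta tau) u' = tau u' by case: (rb u' su').
have e : curvature nabla (beta tau) (gamma sigma) zeta u = - T sigma tau u.
  have e1 := conn0r DC sb (fun u su => concurrent_vertical Hzeta ss su) su.
  have e2 := conn_eqr DC sg (conn_smooth DC sb sz)
    (fun u su => concurrent_horizontal Hzeta st su) su.
  have e3 := connNr DC sg st su.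
  have e4 := conn_concurrent (bracket_smooth sb sg) su.
  have e5 := conn_eqr DC sg (rho_smooth sb) rho_b su.
  have e6 := conn0r DC sb (fun u _ => rho_gamma sigma u) su.
  have e7 := etrans (eq_rho (Y := fun u => - bracket (beta tau) (gamma sigma) u)
    (bracketC (gamma sigma) (beta tau) u)) (rhoN _ u).
  rewrite /curvature /T /hv_torsion /torsion.
  rewrite -> e1, e2, e3, e4, e5, e6, e7.
  generalize (nabla (gamma sigma) tau u) (rho (bracket (beta tau) (gamma sigma)) u).
  by move=> a b; rewrite oppr0 add0r addr0 opprK opprD.
have k := curvature_metric sE HC sb sg sz sz su.
rewrite -> e in k.
rewrite -> (metricNl sE (T sigma tau u) (zeta u) su) in k.
rewrite -> (metricNr sE (zeta u) (T sigma tau u) su) in k.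
exact: half k (metric_sym sE (zeta u) (T sigma tau u) su).
Qed.

(** Concurrence and the torsion concern sections; fibre-constant sections with
   prescribed values turn this into a statement on vectors. *)
Lemma cartan_tensor_concurrent u v w : slit u ->
  cartan_tensor L u v w (zeta u) = 0.
Proof.
move=> su.
have [sigma ss sE1] := fibre_constant_section u.1 v.
have [tau st tE1] := fibre_constant_section u.1 w.
have m := hv_torsion_metric sE HC ss st sz su.
have z := hv_torsion_concurrent ss st su.
have sv : sigma u = v by rewrite -(sE1 u.2); case: (u).
have tw : tau u = w by rewrite -(tE1 u.2); case: (u).
rewrite -> sv, tw in m.
exact: double0 m z.
Qed.

(** By [hv_torsionE] this derivative is the vertical covariant derivative of
   [zeta], which is zero, minus the torsion [T] applied to [zeta]. *)
Lemma concurrent_fibre_derive u v : slit u ->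
  'D_v (fun y => zeta (u.1, y)) u.2 = 0.
Proof.
move=> su.
have [sigma ss sE1] := fibre_constant_section u.1 v.
have sv : sigma u = v by rewrite -(sE1 u.2); case: (u).
have t : T sigma zeta u = 0.
  apply: (metric_nondeg (finsler_posdef HL) su) => w.
  have [tau st tE1] := fibre_constant_section u.1 w.
  have tw : tau u = w by rewrite -(tE1 u.2); case: (u).
  have m := hv_torsion_metric sE HC ss sz st su.
  have c := cartan_tensor_sym sE (sigma u) (zeta u) (tau u) su.
  have z := cartan_tensor_concurrent (sigma u) (tau u) su.
  have := half0 m (etrans c z); rewrite -> tw; exact.
have e := hv_torsionE HC ss sz su.
rewrite -/T in e; rewrite -> t in e.
rewrite -> (concurrent_vertical Hzeta ss su) in e.
rewrite /fibre_derive in e; rewrite -> sv in e.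
by move/eqP: e; rewrite sub0r eq_sym oppr_eq0 => /eqP.
Qed.

Lemma cartan_tensor0_at u v w z : slit u -> zeta u != 0 ->
  cartan_tensor L u v w z = 0.
Proof.
case: u => p y su zeta0; rewrite /cartan_tensor /=.
have sl (x : 'rV[R]_n) : x != 0 -> slit ((p, x) : TM M) by [].
have sg (x : 'rV[R]_n) : x != 0 -> smooth_near (fun x => g (p, x) w z) x.
  by move=> x0; exact (metric_smooth_fibre sE w z (sl x x0)).
have zs (x : 'rV[R]_n) : x != 0 -> smooth_near (fun x => zeta (p, x)) x.
  by move=> x0; exact (psmooth_fibre ((smooth_pi_fieldP _).1 sz _ (sl x x0))).
have dg (x : 'rV[R]_n) : x != 0 -> differentiable (fun x => g (p, x) w z) x.
  by move=> x0; exact: smooth_near_diff (sg x x0).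
have hg (x : 'rV[R]_n) (t : R) : x != 0 -> 0 < t -> g (p, t *: x) w z = g (p, x) w z.
  move=> x0 t0; have hL u' t' := finsler_homog HL u' (t := t').
  exact (metric_homog sE w z (sl x x0) t0 hL).
have dz (x : 'rV[R]_n) : x != 0 -> differentiable (fun x => zeta (p, x)) x /\
    forall w, 'D_w (fun x => zeta (p, x)) x = 0.
  move=> x0; split; first exact: smooth_near_diff (zs x x0).
  by move=> w'; exact (concurrent_fibre_derive w' (sl x x0)).
have inv (x : 'rV[R]_n) : x != 0 -> 'D_(zeta (p, x)) (fun x => g (p, x) w z) x = 0.
  move=> x0.
  have c := cartan_tensorC sE (zeta (p, x)) w z (sl x x0).
  have c' := cartan_tensor_sym sE w (zeta (p, x)) z (sl x x0).
  have c0 := cartan_tensor_concurrent w z (sl x x0).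
  exact (etrans c (etrans c' c0)).
exact (homogeneous_invariant_derive v dg hg dz inv su zeta0).
Qed.

(** A nonzero value would persist on an open set, where [zeta] would vanish by
   the previous lemma. But along the geodesic spray the function [g zeta eta]
   has derivative [- L ^ 2], so that [zeta] vanishes on no open set. *)
Lemma cartan_tensor0 u v w z : slit u -> cartan_tensor L u v w z = 0.
Proof.
move=> su; apply/eqP; apply: contrapT => /negP ne.
have val (sigma : pi_field M) v' : (forall y, sigma (u.1, y) = v') -> sigma u = v'.
  by move=> sE1; rewrite -(sE1 u.2); case: (u).
have [sigma ss /val sv] := fibre_constant_section u.1 v.
have [tau st /val tw] := fibre_constant_section u.1 w.
have [ups sup /val uz] := fibre_constant_section u.1 z.
pose c u := g u (T sigma tau u) (ups u).
have sc : smooth_on_slit c.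
  exact (metric_smooth sE (hv_torsion_smooth HC ss st) sup).
have cE u' : slit u' -> 2 * c u' = cartan_tensor L u' (sigma u') (tau u') (ups u').
  by move=> su'; exact (hv_torsion_metric sE HC ss st sup su').
have c0 : c u != 0.
  apply/eqP => c0; move: ne; rewrite -sv -tw -uz.
  by rewrite (double0 (cE u su) c0) eqxx.
have cn : tnbhs u (fun u' => c u' != 0).
  exact (tnbhs_neq0 ((smooth_on_slitP c).1 sc u su) c0).
have zn : tnbhs u (fun u' => zeta u' = 0).
  apply: (tnbhsS _ (tnbhsI (tnbhs_slit su) cn)) => u' [su' cu'].
  apply/eqP; apply: contrapT => /negP z0; move/eqP: cu'; apply.
  exact (half0 (cE u' su') (cartan_tensor0_at _ _ _ su' z0)).
have se := eta_smooth (M := M).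
have [sb rb] := cartan_horizontal HC se; have [K0 rE] := rb u su.
have m := cartan_metric HC sb sz se su.
have b0 : tnbhs u (fun u' => finsler_metric L u' (zeta u') (Defs.eta u') = 0).
  apply: (tnbhsS _ (tnbhsI (tnbhs_slit su) zn)) => u' [su' z0].
  exact (metric0l sE (Defs.eta u') su' z0).
rewrite -> (eq_lie (beta (Defs.eta (M := M))) b0), lie_cst in m.
rewrite /conn_map in K0; rewrite -> K0 in m.
rewrite -> (concurrent_horizontal Hzeta se su) in m.
rewrite -> (metricNl sE (Defs.eta u) (Defs.eta u) su) in m.
rewrite -> (metric0r sE (zeta u) su erefl) in m.
have := finsler_posdef HL su su; rewrite -/(Defs.eta u).
by move/eqP: m; rewrite addr0 eq_sym oppr_eq0 => /eqP ->; rewrite ltxx.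
Qed.

Lemma hv_torsion0 sigma tau u : smooth_pi_field sigma -> smooth_pi_field tau ->
  slit u -> T sigma tau u = 0.
Proof.
exact: (hv_torsion_eq0 sE (finsler_posdef HL) HC (fun v w z u => cartan_tensor0 v w z (u := u))).
Qed.

End Concurrent.

(** * The energy change *)

Section EnergyChange.
Context {R : realType} {n : nat} (M : manifold R n).
Variables (L : TM M -> R) (nabla : connection_op M).
Variables (beta : pi_field M -> vfield M) (zeta : pi_field M).
Hypothesis HL : is_finsler L.
Hypothesis HC : is_cartan L nabla beta.
Hypothesis Hzeta : is_concurrent nabla beta zeta.
Implicit Types (u : TM M) (v w x : 'rV[R]_n).

Local Opaque lie bracket rho.

Let g := finsler_metric L.
Let sE := finsler_energy_smooth HL.
Let sz := concurrent_smooth Hzeta.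
Let Lt := energy_beta_change L zeta.
Let gt := finsler_metric Lt.

Lemma energy_changeE u :
  Lt u ^+ 2 = L u ^+ 2 + g u (zeta u) (Defs.eta u) ^+ 2.
Proof. by rewrite sqr_sqrtr// addr_ge0// sqr_ge0. Qed.

Lemma energy_change_smooth : smooth_on_slit (fun u => Lt u ^+ 2).
Proof.
have sB := metric_smooth sE sz (eta_smooth (M := M)).
apply: (eq_smooth_on_slit _ (smooth_on_slitD sE (smooth_on_slitM sB sB))) => u su.
by rewrite energy_changeE expr2 [in RHS]expr2.
Qed.

Let b v u := g u (zeta u) v.

Lemma zeta_pairing_smooth v u : slit u -> differentiable (fun y => b v (u.1, y)) u.2.
Proof.
move=> su; have [sigma ss E] := fibre_constant_section u.1 v.
have sm := (smooth_on_slitP _).1 (metric_smooth sE sz ss) u su.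
have d := smooth_near_diff (tsmooth_fibre sm).
suff e : (fun y => b v (u.1, y)) =
    (fun y => finsler_metric L (u.1, y) (zeta (u.1, y)) (sigma (u.1, y))).
  by rewrite e.
by apply/funext => y; rewrite E.
Qed.

Lemma zeta_pairing_derive v w u : slit u -> 'D_w (fun y => b v (u.1, y)) u.2 = 0.
Proof.
have solve (t c x y : R) : t = c + x + y -> c = 0 -> x = 0 -> y = 0 -> t = 0.
  by move=> -> -> -> ->; rewrite !addr0.
move=> su; have [sigma ss E] := fibre_constant_section u.1 v.
have e : (fun y => b v (u.1, y)) =
    (fun y => g (u.1, y) (zeta (u.1, y)) (sigma (u.1, y))).
  by apply/funext => y; rewrite E.
have m := lie_gamma_metric sE w su sz ss.
have d := concurrent_fibre_derive HL HC Hzeta w su.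
have c := cartan_tensor0 HL HC Hzeta w (zeta u) (sigma u) su.
have k : 'D_w (fun y => sigma (u.1, y)) u.2 = 0.
  rewrite (_ : (fun y => _) = cst v); first exact: derive_cst.
  by apply/funext => y; exact: E.
apply: etrans (@f_equal _ _ (fun F : 'rV[R]_n -> R => 'D_w F u.2) _ _ e) _.
exact (solve _ _ _ _ m c (metric0l sE _ su d) (metric0r sE _ su k)).
Qed.

(** Since [zeta] and [g] do not vary along the fibres, the function
   [g zeta eta] is linear on them. *)
Lemma zeta_eta_derive w u : slit u ->
  differentiable (fun y => g (u.1, y) (zeta (u.1, y)) y) u.2 /\
  'D_w (fun y => g (u.1, y) (zeta (u.1, y)) y) u.2 = b w u.
Proof.
have solve (t c x y y' : R) : t = c + x + y -> c = 0 -> x = 0 -> y = y' -> t = y'.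
  by move=> -> -> -> ->; rewrite !add0r.
move=> su; have se := eta_smooth (M := M).
have sm := (smooth_on_slitP _).1 (metric_smooth sE sz se) u su.
split; first exact (smooth_near_diff (tsmooth_fibre sm)).
have m := lie_gamma_metric sE w su sz se.
have d := concurrent_fibre_derive HL HC Hzeta w su.
have c := cartan_tensor0 HL HC Hzeta w (zeta u) (Defs.eta u) su.
have k : 'D_w (fun y => @Defs.eta R n M (u.1, y)) u.2 = w by exact: derive_id.
exact (solve _ _ _ _ _ m c (metric0l sE _ su d) (@f_equal _ R (fun t => g u (zeta u) t) _ _ k)).
Qed.

(** For a function [B] that is linear on the fibres, half the Hessian of [B ^ 2]
   is the square of the linear form. *)
Lemma energy_change_metric u v w : slit u ->
  gt u v w = g u v w + g u (zeta u) v * g u (zeta u) w.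
Proof.
have product (t x y d1 d2 z : R) : t = d1 * y + x * d2 -> d2 = 0 -> d1 = z ->
    t = z * y by move=> -> -> ->; rewrite mulr0 addr0.
have square (t x d z : R) : t = d * x + x * d -> d = z -> t = 2 * (x * z).
  by move=> -> ->; ring.
case: u => p y su.
pose E y := L (p, y) ^+ 2; pose B y := g (p, y) (zeta (p, y)) y.
have sl (x : 'rV[R]_n) : x != 0 -> slit ((p, x) : TM M) by [].
have ns : \forall x \near y, x != 0 := slit_fibre su.
have fE : (fun z => Lt (p, z) ^+ 2) = (fun z => E z + B z * B z).
  by apply/funext => z; rewrite energy_changeE expr2 [in RHS]/E expr2.
have sE' (x : 'rV[R]_n) : x != 0 -> smooth_near E x.
  by move=> x0; exact (tsmooth_fibre ((smooth_on_slitP _).1 sE _ (sl x x0))).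
have dB (x : 'rV[R]_n) : x != 0 -> differentiable B x.
  by move=> x0; case: (zeta_eta_derive 0 (sl x x0)).
have DB v' (x : 'rV[R]_n) : x != 0 -> 'D_v' B x = b v' (p, x).
  by move=> x0; case: (zeta_eta_derive v' (sl x x0)).
have D1 (x : 'rV[R]_n) : x != 0 ->
    'D_w (fun z => E z + B z * B z) x = 'D_w E x + 2 * (B x * b w (p, x)).
  move=> x0; have [d2 H] := differentiable_scale (dB x x0) (dB x x0).
  have dE := smooth_near_diff (sE' x x0).
  apply: etrans (deriveD (diff_derivable dE) (diff_derivable d2)) _.
  apply: (@f_equal R R (fun t => 'D_w E x + t)).
  exact (square _ _ _ _ (H w) (DB w x x0)).
have n1 : \forall x \near y, 'D_w (fun z => E z + B z * B z) x =
    'D_w E x + 2 * (B x * b w (p, x)) by apply: filterS ns; exact: D1.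
have dEw := smooth_near_diff (smooth_near_derive w (sE' y su)).
have db := zeta_pairing_smooth w su.
have [d2 H] := differentiable_scale (dB y su) db.
have h := H v.
have d3 := differentiable_scale (differentiable_cst (2 : R) y) d2.
have e2 : 'D_v (fun x => 2 * (B x * b w (p, x))) y = 2 * (b v (p, y) * b w (p, y)).
  apply: etrans (deriveMcst 2 v d2) _; apply: (@f_equal R R (fun t => 2 * t)).
  exact (product _ _ _ _ _ _ h (zeta_pairing_derive w v su) (DB v y su)).
have e3 := deriveD (diff_derivable (v := v) dEw) (diff_derivable (v := v) d3.1).
have e4 := etrans (near_eq_derive v n1) e3.
have e0 := @f_equal _ _ (fun F : 'rV[R]_n -> R => 2^-1 * 'D_v (fun x => 'D_w F x) y) _ _ fE.
have solve (x1 x2 x3 c : R) : x1 = x2 + x3 -> x3 = 2 * c ->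
    2^-1 * x1 = 2^-1 * x2 + c by move=> -> ->; field.
exact (etrans e0 (solve _ _ _ _ e4 e2)).
Qed.

Lemma energy_change_cartan_tensor u x v w : slit u -> cartan_tensor Lt u x v w = 0.
Proof.
have product (t a a' d1 d2 : R) : t = d1 * a + a' * d2 -> d1 = 0 -> d2 = 0 -> t = 0.
  by move=> -> -> ->; rewrite mulr0 mul0r addr0.
have solve (a a' : R) : a = 0 -> a' = 0 -> a + a' = 0 by move=> -> ->; rewrite addr0.
move=> su; rewrite /cartan_tensor.
have n1 : \forall y \near u.2, gt (u.1, y) v w =
    g (u.1, y) v w + b v (u.1, y) *: b w (u.1, y).
  by apply: filterS (slit_fibre su) => y sy; exact: energy_change_metric.
have dg := smooth_near_diff (metric_smooth_fibre sE v w su).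
have [db H] := differentiable_scale (zeta_pairing_smooth v su) (zeta_pairing_smooth w su).
have h := H x.
apply: etrans (near_eq_derive x n1) _.
apply: etrans (deriveD (diff_derivable dg) (diff_derivable db)) _.
have c := cartan_tensor0 HL HC Hzeta x v w su.
rewrite /cartan_tensor in c.
exact (solve _ _ c (product _ _ _ _ _ h (zeta_pairing_derive v x su) (zeta_pairing_derive w x su))).
Qed.

Lemma energy_change_posdef u : slit u -> forall v, v != 0 -> 0 < gt u v v.
Proof.
move=> su v v0; rewrite (energy_change_metric v v su).
by rewrite ltr_pwDl ?(finsler_posdef HL)// -expr2 sqr_ge0.
Qed.

End EnergyChange.

(** * The Cartan and Chern connections of the energy change *)

Section CartanChange.
Context {R : realType} {n : nat} (M : manifold R n).
Variables (L : TM M -> R) (nabla : connection_op M).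
Variables (beta : pi_field M -> vfield M) (zeta : pi_field M).
Hypothesis HL : is_finsler L.
Hypothesis HC : is_cartan L nabla beta.
Hypothesis Hzeta : is_concurrent nabla beta zeta.
Variables (nablat : connection_op M) (betat : pi_field M -> vfield M).
Hypothesis HCt : is_cartan (energy_beta_change L zeta) nablat betat.
Implicit Types (u : TM M) (X Y Z : vfield M) (sigma tau : pi_field M).

Local Opaque lie bracket rho.

Let Lt := energy_beta_change L zeta.
Let g := finsler_metric L.
Let gt := finsler_metric Lt.
Let DC := cartan_connection HC.
Let DCt := cartan_connection HCt.
Let sE := finsler_energy_smooth HL.
Let sEt := energy_change_smooth HL Hzeta.
Let posdeft := energy_change_posdef HL HC Hzeta.
Let sz := concurrent_smooth Hzeta.
Let p2 u := g u (zeta u) (zeta u).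
Let s u := 1 + p2 u.

Lemma energy_change_hv_torsion0 sigma tau u : smooth_pi_field sigma ->
  smooth_pi_field tau -> slit u -> hv_torsion nablat betat sigma tau u = 0.
Proof.
exact (hv_torsion_eq0 sEt posdeft HCt
  (fun v w z u => energy_change_cartan_tensor HL HC Hzeta v w z (u := u))).
Qed.

Lemma concurrent_denom_gt0 u : slit u -> 0 < s u.
Proof.
move=> su; rewrite ltr_pwDl// /p2.
have [z0|z0] := eqVneq (zeta u) 0; first by rewrite /g (metric0l sE (zeta u) su z0).
exact/ltW/finsler_posdef.
Qed.

Let coef X sigma u := g u (rho X u) (sigma u) / s u.

Let smooth_denom : smooth_on_slit s.
Proof.
exact: smooth_on_slitD (smooth_on_slit_cst (M := M) (1 : R)) (metric_smooth sE sz sz).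
Qed.

Let smooth_inv : smooth_on_slit (fun u => (s u)^-1).
Proof.
apply: (smooth_on_slitV smooth_denom) => u su.
by rewrite gt_eqF// concurrent_denom_gt0.
Qed.

Let smooth_coef X sigma : smooth_vfield X -> smooth_pi_field sigma ->
  smooth_on_slit (coef X sigma).
Proof.
move=> sX ss; exact (smooth_on_slitM (metric_smooth sE (rho_smooth sX) ss) smooth_inv).
Qed.

(** The deviation from the formula to be proved in [energy_change_cartan]. *)
Let defect X sigma u := nablat X sigma u - nabla X sigma u + coef X sigma u *: zeta u.

Let defectC X Y u : smooth_vfield X -> smooth_vfield Y -> slit u ->
  defect X (rho Y) u = defect Y (rho X) u.
Proof.
have solve (a b c d r e e' : 'rV[R]_n) : a - b - r = 0 -> c - d - r = 0 ->
    e = e' -> a - c + e = b - d + e'.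
  move=> /eqP; rewrite subr_eq0 subr_eq => /eqP -> /eqP.
  rewrite subr_eq0 subr_eq => /eqP -> ->; congr (_ + _).
  by rewrite opprD addrACA subrr add0r.
move=> sX sY su.
have t := torsion_free HC (fun a b u sa sb => hv_torsion0 HL HC Hzeta sa sb (u := u)) sX sY su.
have tt := torsion_free HCt (fun a b u sa sb => energy_change_hv_torsion0 sa sb (u := u)) sX sY su.
have e : coef X (rho Y) u *: zeta u = coef Y (rho X) u *: zeta u.
  have h := metric_sym sE (rho X u) (rho Y u) su.
  exact (@f_equal R _ (fun t => (t / s u) *: zeta u) _ _ h).
exact (solve _ _ _ _ _ _ _ tt t e).
Qed.

(** The correction term [coef X sigma *: zeta] accounts for the derivative of
   the summand [b (x) b] of the changed metric, which is computed with
   [nabla X zeta = - rho X]. *)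
Let defect_skew X sigma tau u : smooth_vfield X -> smooth_pi_field sigma ->
  smooth_pi_field tau -> slit u ->
  gt u (defect X sigma u) (tau u) = - gt u (sigma u) (defect X tau u).
Proof.
have solve (l m m' A B C D E F a0 b0 x y b c q r p : R) : 1 + p != 0 ->
    l = A + B -> l = m + m' -> m = a0 + b0 ->
    m' = (- q + x) * c + b * (- r + y) ->
    C = a0 + x * c -> D = b0 + b * y -> E = c + p * c -> F = b + b * p ->
    A - C + q / (1 + p) * E = - (B - D + r / (1 + p) * F).
  move=> p0 e1 e2 e3 e4 -> -> -> ->.
  have -> : A = a0 + b0 + ((- q + x) * c + b * (- r + y)) - B.
    by rewrite -e3 -e4 -e2 e1 addrK.
  by field.
have combine (x y z a b c d : R) : x = y + z -> y = a + b -> b = - c -> z = d ->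
    x = a - c + d by move=> -> -> -> ->.
move=> sX ss st su.
have sG := metric_smooth sE ss st.
have sb := metric_smooth sE sz ss; have sc := metric_smooth sE sz st.
have n1 : tnbhs u (fun u => gt u (sigma u) (tau u) = g u (sigma u) (tau u) +
    g u (zeta u) (sigma u) * g u (zeta u) (tau u)).
  apply: (tnbhsS _ (tnbhs_slit su)) => v sv.
  exact (energy_change_metric HL HC Hzeta (sigma v) (tau v) sv).
have tG := (smooth_on_slitP _).1 sG u su.
have tb := (smooth_on_slitP _).1 sb u su; have tc := (smooth_on_slitP _).1 sc u su.
have tbc := (smooth_on_slitP _).1 (smooth_on_slitM sb sc) u su.
have e2 := etrans (eq_lie X n1) (lieD X tG tbc).
have e4 := lieM X tb tc.
have mt := cartan_metric HCt sX ss st su.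
have m := cartan_metric HC sX ss st su.
have lb tau' : smooth_pi_field tau' ->
    lie X (fun u => finsler_metric L u (zeta u) (tau' u)) u =
    - g u (rho X u) (tau' u) + g u (zeta u) (nabla X tau' u).
  move=> st'; have h := cartan_metric HC sX sz st' su.
  rewrite -> (conn_concurrent HC Hzeta sX su) in h.
  rewrite -> (metricNl sE (rho X u) (tau' u) su) in h.
  exact h.
rewrite -> (lb sigma ss), (lb tau st) in e4.
have gtE v w := energy_change_metric HL HC Hzeta v w su.
have F0 := gtE (sigma u) (zeta u).
rewrite -> (metric_sym sE (sigma u) (zeta u) su) in F0.
have p0 : 1 + p2 u != 0 by rewrite gt_eqF// concurrent_denom_gt0.
have key := solve _ _ _ _ _ _ _ _ _ _ _ _ _ _ _ _ _ _ p0 mt e2 m e4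
  (gtE (nabla X sigma u) (tau u)) (gtE (sigma u) (nabla X tau u))
  (gtE (zeta u) (tau u)) F0.
have linl a b k c v : gt u (a - b + k *: c) v = gt u a v - gt u b v + k * gt u c v.
  exact (combine _ _ _ _ _ _ _ (metricDl sEt (a - b) (k *: c) v su)
    (metricDl sEt a (- b) v su) (metricNl sEt b v su) (metricZl sEt k c v su)).
have linr a b k c v : gt u v (a - b + k *: c) = gt u v a - gt u v b + k * gt u v c.
  exact (combine _ _ _ _ _ _ _ (metricDr sEt v (a - b) (k *: c) su)
    (metricDr sEt v a (- b) su) (metricNr sEt v b su) (metricZr sEt k v c su)).
apply: etrans (linl _ _ _ _ _) _; apply: etrans key _.
exact (@f_equal R R -%R _ _ (esym (linr _ _ _ _ _))).
Qed.

(** The two sides differ by a tensor which is symmetric by torsion-freeness and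
   skew by metricity: as for the Levi-Civita connection, it vanishes. *)
Lemma energy_change_cartan X sigma u : smooth_vfield X -> smooth_pi_field sigma ->
  slit u ->
  nablat X sigma u =
  nabla X sigma u - (g u (rho X u) (sigma u) / (1 + g u (zeta u) (zeta u))) *: zeta u.
Proof.
have solve (p q r : R) : p = - q -> q = - r -> r = - p -> p = 0 by lra.
move=> sX ss su.
have sbeta tau : smooth_pi_field tau -> smooth_vfield (beta tau).
  by move=> st; case: (cartan_horizontal HC st).
have rho_beta tau v : smooth_pi_field tau -> slit v -> rho (beta tau) v = tau v.
  by move=> st sv; have [_ /(_ v sv)[]] := cartan_horizontal HC st.
have eq_defect Y a b : smooth_vfield Y -> smooth_pi_field a ->
    (forall u, slit u -> a u = b u) -> defect Y a u = defect Y b u.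
  move=> sY sa ab; rewrite /defect /coef.
  rewrite -> (conn_eqr DCt sY sa ab su), (conn_eqr DC sY sa ab su), (ab u su).
  exact: erefl.
have sym a b : smooth_pi_field a -> smooth_pi_field b ->
    defect (beta a) b u = defect (beta b) a u.
  move=> sa sb; have sba := sbeta a sa; have sbb := sbeta b sb.
  have e1 := eq_defect (beta a) _ _ sba (rho_smooth sbb) (fun v => rho_beta b v sb).
  have e2 := eq_defect (beta b) _ _ sbb (rho_smooth sba) (fun v => rho_beta a v sa).
  exact (etrans (esym e1) (etrans (defectC sba sbb su) e2)).
have skew a b c : smooth_pi_field a -> smooth_pi_field b -> smooth_pi_field c ->
    gt u (defect (beta a) b u) (c u) = - gt u (defect (beta a) c u) (b u).
  move=> sa sb sc; have h := defect_skew (sbeta a sa) sb sc su.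
  have h' := metric_sym sEt (b u) (defect (beta a) c u) su.
  exact (etrans h (@f_equal R R -%R _ _ h')).
have hor a b : smooth_pi_field a -> smooth_pi_field b -> defect (beta a) b u = 0.
  move=> sa sb; apply: (metric_nondeg posdeft su) => w.
  have [c sc cE] := fibre_constant_section u.1 w.
  have <- : c u = w by rewrite -(cE u.2); case: (u).
  have h1 := skew a b c sa sb sc; have h2 := skew c a b sc sa sb.
  have h3 := skew b c a sb sc sa.
  rewrite -> (sym a c sa sc) in h1; rewrite -> (sym c b sc sb) in h2.
  rewrite -> (sym b a sb sa) in h3.
  exact (solve _ _ _ h1 h2 h3).
have d0 : defect X sigma u = 0.
  have sbs := sbeta sigma ss.
  have e1 := eq_defect X _ _ sX (rho_smooth sbs) (fun v => rho_beta sigma v ss).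
  exact (etrans (esym e1) (etrans (defectC sX sbs su) (hor _ _ ss (rho_smooth sX)))).
have fin (a b c : 'rV[R]_n) : a - b + c = 0 -> a = b - c.
  by move=> /eqP; rewrite addr_eq0 subr_eq => /eqP ->; rewrite addrC.
exact (fin _ _ _ d0).
Qed.

(** The section [- zeta] has covariant derivative [rho X], so that no signs
   appear in the Leibniz rule. *)
Let cartan_form X sigma u : smooth_vfield X -> smooth_pi_field sigma -> slit u ->
  nablat X sigma u = nabla X sigma u + coef X sigma u *: - zeta u.
Proof.
by move=> sX ss su; rewrite scalerN; exact (energy_change_cartan sX ss su).
Qed.

(** The denominator [s] has derivative [- 2 g (rho X) zeta] by concurrence. *)
Let lie_coef X Y sigma u : smooth_vfield X -> smooth_vfield Y ->
  smooth_pi_field sigma -> slit u ->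
  lie X (coef Y sigma) u =
  (g u (nabla X (rho Y) u) (sigma u) + g u (rho Y u) (nabla X sigma u)) / s u +
  2 * g u (rho Y u) (sigma u) * g u (rho X u) (zeta u) / s u ^+ 2.
Proof.
have solve (l lG lv ls lp G v q : R) : v != 0 -> l = lG * v^-1 + G * lv ->
    lv = - ls / v ^+ 2 -> ls = 0 + lp -> lp = - q + - q ->
    l = lG / v + 2 * G * q / v ^+ 2.
  by move=> v0 -> -> -> ->; field.
move=> sX sY ss su.
have sr := rho_smooth sY.
have v0 : s u != 0 by rewrite gt_eqF// concurrent_denom_gt0.
have tG := (smooth_on_slitP _).1 (metric_smooth sE sr ss) u su.
have ti := (smooth_on_slitP _).1 smooth_inv u su.
have ts := (smooth_on_slitP _).1 smooth_denom u su.
have tp := (smooth_on_slitP _).1 (metric_smooth sE sz sz) u su.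
have t1 := (smooth_on_slitP _).1 (smooth_on_slit_cst (M := M) (1 : R)) u su.
have e1 := lieM X tG ti.
have e2 := lieV X ts v0.
have e3 := lieD X t1 tp.
rewrite -> (lie_cst (1 : R) X u) in e3.
have e4 := cartan_metric HC sX sz sz su.
rewrite -> (metric_sym sE (zeta u) (nabla X zeta u) su) in e4.
rewrite -> (conn_concurrent HC Hzeta sX su) in e4.
rewrite -> (metricNl sE (rho X u) (zeta u) su) in e4.
have m := cartan_metric HC sX sr ss su.
rewrite -> m in e1.
exact (solve _ _ _ _ _ _ _ _ v0 e1 e2 e3 e4).
Qed.

Let cartan_form2 X Y sigma u : smooth_vfield X -> smooth_vfield Y ->
  smooth_pi_field sigma -> slit u ->
  nablat X (nablat Y sigma) u =
  nabla X (nabla Y sigma) u + coef Y sigma u *: rho X u -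
  ((g u (nabla X (rho Y) u) (sigma u) + g u (rho Y u) (nabla X sigma u) +
    g u (rho X u) (nabla Y sigma u)) / s u +
   g u (rho Y u) (sigma u) * g u (rho X u) (zeta u) / s u ^+ 2) *: zeta u.
Proof.
have solve (t a a' d d' r z : 'rV[R]_n) (k l q q1 q2 G c3 S m1 : R) : S != 0 ->
    t = a + q *: - z -> a = a' + d -> d = l *: - z + k *: d' -> d' = r ->
    l = m1 / S + 2 * G * c3 / S ^+ 2 -> k = G / S ->
    q = q1 / S -> q1 = q2 + k * - c3 ->
    t = a' + k *: r - ((m1 + q2) / S + G * c3 / S ^+ 2) *: z.
  move=> S0 -> -> -> -> -> -> -> ->; apply/rowP => j; rewrite !mxE.
  by field.
move=> sX sY ss su.
have sNY := conn_smooth DC sY ss.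
have sN := smooth_pi_fieldN sz.
have sk := smooth_coef sY ss.
have skz := smooth_pi_fieldZ sk sN.
have ssum := smooth_pi_fieldD sNY skz.
have v0 : s u != 0 by rewrite gt_eqF// concurrent_denom_gt0.
have e0 := conn_eqr DCt sX (conn_smooth DCt sY ss)
  (fun v sv => cartan_form sY ss sv) su.
have e1 := etrans e0 (cartan_form sX ssum su).
have e2 := conn_addr DC sX sNY skz su.
have e3 := conn_leibniz DC sk sX sN su.
have opp (a b c : 'rV[R]_n) : a = - b -> b = - c -> a = c.
  by move=> -> ->; rewrite opprK.
have e4 := opp _ _ _ (connNr DC sX sz su) (conn_concurrent HC Hzeta sX su).
have e5 := lie_coef sX sY ss su.
have lin (x y k a b c : R) : x = y + a -> a = k * b -> b = - c -> x = y + k * - c.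
  by move=> -> -> ->.
have e6 := lin _ _ _ _ _ _
  (metricDr sE (rho X u) (nabla Y sigma u) (coef Y sigma u *: - zeta u) su)
  (metricZr sE (coef Y sigma u) (rho X u) (- zeta u) su)
  (metricNr sE (rho X u) (zeta u) su).
exact (solve _ _ _ _ _ _ _ _ _ _ _ _ _ _ _ _ v0 e1 e2 e3 e4 e5 erefl erefl e6).
Qed.

(** On alternation the terms of [cartan_form2] with derivatives of [sigma] cancel,
   and those with derivatives of [rho X] and [rho Y] combine with the bracket
   term to the torsion of [nabla], which vanishes. *)
Lemma energy_change_curvature X Y sigma u : smooth_vfield X -> smooth_vfield Y ->
  smooth_pi_field sigma -> slit u ->
  curvature nablat X Y sigma u = curvature nabla X Y sigma u +
  alternate (fun X Y : vfield M =>
    (g u (rho X u) (sigma u) / (1 + g u (zeta u) (zeta u))) *: rho Y u +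
    (g u (rho Y u) (sigma u) * g u (rho X u) (zeta u) /
      (1 + g u (zeta u) (zeta u)) ^+ 2) *: zeta u) X Y.
Proof.
have solve (t1 t2 t3 a1 a2 a3 z rX rY : 'rV[R]_n)
    (S GX GY cX cY q1 q2 q3 q4 b : R) : S != 0 ->
    t1 = a1 + (GY / S) *: rX - ((q1 + q2 + q3) / S + GY * cX / S ^+ 2) *: z ->
    t2 = a2 + (GX / S) *: rY - ((q4 + q3 + q2) / S + GX * cY / S ^+ 2) *: z ->
    t3 = a3 + (b / S) *: - z -> b = q1 - q4 ->
    - t1 + t2 + t3 = - a1 + a2 + a3 +
      ((GX / S) *: rY + (GY * cX / S ^+ 2) *: z -
       ((GY / S) *: rX + (GX * cY / S ^+ 2) *: z)).
  move=> S0 -> -> -> ->; apply/rowP => j; rewrite !mxE; by field.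
move=> sX sY ss su.
have v0 : s u != 0 by rewrite gt_eqF// concurrent_denom_gt0.
have sb := bracket_smooth sX sY.
have e1 := cartan_form2 sX sY ss su.
have e2 := cartan_form2 sY sX ss su.
have e3 := cartan_form sb ss su.
have t := torsion_free HC (fun a b u sa sb => hv_torsion0 HL HC Hzeta sa sb (u := u)) sX sY su.
have sub (a b c : 'rV[R]_n) : a - b - c = 0 -> c = a + - b.
  by move=> /eqP; rewrite subr_eq0 => /eqP ->.
have r := sub _ _ _ t.
have lin (f : 'rV[R]_n -> R) (c a b : 'rV[R]_n) : c = a + - b ->
    f (a + - b) = f a + f (- b) -> f (- b) = - f b -> f c = f a - f b.
  by move=> -> -> ->.
have e4 := lin (fun v => g u v (sigma u)) _ _ _ r
  (metricDl sE (nabla X (rho Y) u) (- nabla Y (rho X) u) (sigma u) su)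
  (metricNl sE (nabla Y (rho X) u) (sigma u) su).
exact (solve _ _ _ _ _ _ _ _ _ _ _ _ _ _ _ _ _ _ _ v0 e1 e2 e3 e4).
Qed.

End CartanChange.

Theorem theorem5p12 (R : realType) (n : nat) (M : manifold R n)
    (L : TM M -> R) (HL : is_finsler L)
    (nabla : connection_op M) (beta : pi_field M -> vfield M)
    (Hnabla : is_cartan L nabla beta)
    (zeta : pi_field M) (Hzeta : is_concurrent nabla beta zeta)
    (nablat : connection_op M) (betat : pi_field M -> vfield M)
    (Hnablat : is_cartan (energy_beta_change L zeta) nablat betat) :
  let g := finsler_metric L in
  let p2 := fun u => g u (zeta u) (zeta u) in
  let T := hv_torsion nabla beta in
  let K := conn_map nabla in
  let D := chern nabla beta in
  let Dt := chern nablat betat in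
  (forall (X Y : vfield M) (Z : pi_field M),
     smooth_vfield X -> smooth_vfield Y -> smooth_pi_field Z ->
     forall u, slit u ->
       curvature Dt X Y Z u =
         curvature D X Y Z u
         + (g u (torsion nabla X Y u) (Z u) / (1 + p2 u)) *: zeta u
         + alternate (fun X Y : vfield M =>
             (g u (rho X u) (Z u) / (1 + p2 u)) *: rho Y u
             - (g u (rho X u) (T (K Y) Z u) / (1 + p2 u)) *: zeta u
             + (g u (rho Y u) (Z u) * g u (rho X u) (zeta u)
                / (1 + p2 u) ^+ 2) *: zeta u) X Y)
  /\
  (forall X Y Z : pi_field M,
     smooth_pi_field X -> smooth_pi_field Y -> smooth_pi_field Z ->
     forall u, slit u ->
       [/\ v_curvature Dt X Y Z u = 0 /\ v_curvature D X Y Z u = 0,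
           hv_curvature Dt betat X Y Z u =
             hv_curvature D beta X Y Z u
             - (2 * (g u (T Y X u) (Z u) / (1 + p2 u))) *: zeta u &
           h_curvature Dt betat X Y Z u =
             h_curvature D beta X Y Z u
             + alternate (fun X Y : pi_field M =>
                 (g u (X u) (Z u) / (1 + p2 u)) *: Y u
                 + (g u (Y u) (Z u) * g u (X u) (zeta u)
                    / (1 + p2 u) ^+ 2) *: zeta u) X Y]).
Proof.
have solve (x y x' y' z A1 A2 B1 B2 : 'rV[R]_n) (c d1 d2 S : R) : x = x' ->
    y = y' -> x' = y' + (A1 + B1 - (A2 + B2)) -> c = 0 -> d1 = 0 -> d2 = 0 ->
    x = y + (c / S) *: z +
      ((A1 - (d1 / S) *: z + B1) - (A2 - (d2 / S) *: z + B2)).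
  by move=> -> -> -> -> -> ->; rewrite !mul0r !scale0r !subr0 addr0.
have solve_hv (x x' y y' z : 'rV[R]_n) (t S : R) : x = x' -> x' = 0 -> y = y' ->
    y' = 0 -> t = 0 -> x = y - (2 * (t / S)) *: z.
  by move=> -> -> -> -> ->; rewrite mul0r mulr0 scale0r subr0.
have solve_h (x x' y y' k rX rX' rY rY' : 'rV[R]_n)
    (f : 'rV[R]_n -> 'rV[R]_n -> 'rV[R]_n) : x = x' -> x' = k + f rX rY ->
    y = y' -> k = y' -> rX = rX' -> rY = rY' -> x = y + f rX' rY'.
  by move=> -> -> -> -> -> ->.
move=> g p2 T K D Dt.
have DC := cartan_connection Hnabla; have DCt := cartan_connection Hnablat.
have sE := finsler_energy_smooth HL.
have sEt := energy_change_smooth HL Hzeta.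
have pos := finsler_posdef HL.
have post := energy_change_posdef HL Hnabla Hzeta.
have T0 sigma tau u (ss : smooth_pi_field sigma) (st : smooth_pi_field tau) :=
  hv_torsion0 HL Hnabla Hzeta ss st (u := u).
have T0t sigma tau u (ss : smooth_pi_field sigma) (st : smooth_pi_field tau) :=
  energy_change_hv_torsion0 HL Hnabla Hzeta Hnablat ss st (u := u).
have sbeta sigma : smooth_pi_field sigma -> smooth_vfield (beta sigma).
  by move=> ss; case: (cartan_horizontal Hnabla ss).
have sbetat sigma : smooth_pi_field sigma -> smooth_vfield (betat sigma).
  by move=> ss; case: (cartan_horizontal Hnablat ss).
have rho_beta sigma v : smooth_pi_field sigma -> slit v -> rho (beta sigma) v = sigma v.
  by move=> ss sv; have [_ /(_ v sv)[]] := cartan_horizontal Hnabla ss.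
have rho_betat sigma v : smooth_pi_field sigma -> slit v -> rho (betat sigma) v = sigma v.
  by move=> ss sv; have [_ /(_ v sv)[]] := cartan_horizontal Hnablat ss.
have opp0 (a b : 'rV[R]_n) : a = - b -> b = 0 -> a = 0 by move=> -> ->; rewrite oppr0.
split=> [X Y Z sX sY sZ u su|X Y Z sX sY sZ u su].
  have sK V : smooth_vfield V -> smooth_pi_field (K V).
    by move=> sV; exact (conn_smooth DC sV (eta_smooth (M := M))).
  have c0 := metric0l sE (Z u) su (torsion_free Hnabla T0 sX sY su).
  have d1 := metric0r sE (rho X u) su (T0 _ _ _ (sK Y sY) sZ su).
  have d2 := metric0r sE (rho Y u) su (T0 _ _ _ (sK X sX) sZ su).
  have e1 := chern_curvature Hnablat T0t sX sY sZ su.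
  have e2 := chern_curvature Hnabla T0 sX sY sZ su.
  have e3 := energy_change_curvature HL Hnabla Hzeta Hnablat sX sY sZ su.
  exact (solve _ _ _ _ _ _ _ _ _ _ _ _ _ e1 e2 e3 c0 d1 d2).
have sgX := gamma_smooth sX; have sgY := gamma_smooth sY.
have sbX := sbeta X sX; have sbY := sbeta Y sY.
have sbtX := sbetat X sX; have sbtY := sbetat Y sY.
split.
- split.
    exact (etrans (chern_curvature Hnablat T0t sgX sgY sZ su)
      (vertical_curvature sEt post Hnablat T0t sX sgY sZ su)).
  exact (etrans (chern_curvature Hnabla T0 sgX sgY sZ su)
    (vertical_curvature sE pos Hnabla T0 sX sgY sZ su)).
- have e1 := chern_curvature Hnablat T0t sbtX sgY sZ su.
  have e2 := opp0 _ _ (curvatureC DCt sbtX sgY sZ su)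
    (vertical_curvature sEt post Hnablat T0t sY sbtX sZ su).
  have e3 := chern_curvature Hnabla T0 sbX sgY sZ su.
  have e4 := opp0 _ _ (curvatureC DC sbX sgY sZ su)
    (vertical_curvature sE pos Hnabla T0 sY sbX sZ su).
  have t := metric0l sE (Z u) su (T0 _ _ _ sY sX su).
  exact (solve_hv _ _ _ _ _ _ _ e1 e2 e3 e4 t).
have e1 := chern_curvature Hnablat T0t sbtX sbtY sZ su.
have e2 := energy_change_curvature HL Hnabla Hzeta Hnablat sbtX sbtY sZ su.
have e3 := chern_curvature Hnabla T0 sbX sbY sZ su.
have rX v (sv : slit v) := etrans (rho_betat X v sX sv) (esym (rho_beta X v sX sv)).
have rY v (sv : slit v) := etrans (rho_betat Y v sY sv) (esym (rho_beta Y v sY sv)).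
have swap (a b c d : 'rV[R]_n) : a = - b -> b = c -> d = - c -> a = d.
  by move=> -> -> ->.
have e4 := etrans (eq_rho_curvature sE pos Hnabla T0 sbtX sbX sbtY sZ rX su)
  (swap _ _ _ _ (curvatureC DC sbX sbtY sZ su)
    (eq_rho_curvature sE pos Hnabla T0 sbtY sbY sbX sZ rY su)
    (curvatureC DC sbX sbY sZ su)).
exact (solve_h _ _ _ _ _ _ _ _ _
  (fun x y => ((g u x (Z u) / (1 + p2 u)) *: y +
      (g u y (Z u) * g u x (zeta u) / (1 + p2 u) ^+ 2) *: zeta u) -
    ((g u y (Z u) / (1 + p2 u)) *: x +
      (g u x (Z u) * g u y (zeta u) / (1 + p2 u) ^+ 2) *: zeta u))
  e1 e2 e3 e4 (rho_betat X u sX su) (rho_betat Y u sY su)).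
Qed.
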